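(* Consider the three-dimensional Hurwitz space of coverings $(\mathbb C/\mathbb L,\lambda)$, $\mathbb L=2\omega_1\mathbb Z+2\omega_2\mathbb Z$, $\lambda(P)=\wp(z_P)+c$. The semi-simple Hurwitz–Frobenius manifold induced by the normalized holomorphic differential $\phi_1(P)=\frac{dz_P}{2\omega_1}$ is described by the Darboux–Egoroff metric $\eta(\phi_1)$ and its flat coordinates $$t_1=\frac{\omega_2}{2\pi\mathrm i\,\omega_1},\qquad t_2=\frac1{\sqrt2\,\omega_1},\qquad t_3=-\frac{\zeta(\omega_1)}{\omega_1}+c,$$ the unit vector field $e_{\phi_1}=\partial_{t_3}$, the Euler vector field $\mathcal E_{\phi_1}=\frac{t_2}2\partial_{t_2}+t_3\partial_{t_3}$ and the prepotential $$\mathbf F_{\phi_1}(t_1,t_2,t_3)=\frac{t_3^2}2t_1+\frac{t_3}2t_2^2+\frac{\pi^2}{24}t_2^4E_2(2\pi\mathrm i\,t_1).$$ Moreover, $\mathbf F_{\phi_1}$ is quasi-homogeneous of degree $2$: $\mathcal E_{\phi_1}.\mathbf F_{\phi_1}=2\mathbf F_{\phi_1}$.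
   Context: $\omega_1,\omega_2\in\mathbb C$ with $\tau=\omega_2/\omega_1$, $\Im\tau>0$; $\wp$ and $\zeta$ are the Weierstrass functions of the lattice $\mathbb L$; $c$ is a constant in $z_P$ (a parameter). The map $\lambda=\wp+c$ has a double pole at $\infty^0$ ($z=0$) and finite simple ramification points $P_j$ at $z=\omega_j$, $j=1,2,3$, $\omega_3=\omega_1+\omega_2$, with critical values $\lambda_j=\wp(\omega_j)+c$. Coverings are taken modulo biholomorphisms intertwining the maps (rescaling of $\mathbb L$ with $\tilde\lambda=\alpha^2\wp(z;2\alpha\omega_1,2\alpha\omega_2)+c$), with fixed homology basis $a=[x,x+2\omega_1]$, $b=[x,x+2\omega_2]$; $\lambda_1,\lambda_2,\lambda_3$ are local coordinates on the Hurwitz space $\mathcal H_{1,2}(1)$. Frobenius structure induced by $\phi_1$: metric $\eta(\phi_1)=\frac12\sum_{k=1}^3\phi_1(P_k)^2(d\lambda_k)^2$ with $\phi_1(P_k)=\frac{\phi_1}{dx_k}|_{P_k}$, $x_k=\sqrt{\lambda-\lambda_k}$; multiplication $\partial_{\lambda_i}\circ\partial_{\lambda_j}=\delta_{ij}\partial_{\lambda_j}$; unit $\sum_j\partial_{\lambda_j}$; Euler field $\sum_j\lambda_j\partial_{\lambda_j}$. A prepotential is a function $F$ of the flat coordinates with $\partial_{t_\alpha}\partial_{t_\beta}\partial_{t_\gamma}F=\eta(\phi_1)(\partial_{t_\alpha}\circ\partial_{t_\beta},\partial_{t_\gamma})$. $E_2(\tau)=1-24\sum_{n\ge1}\frac{nq^n}{1-q^n}$,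 $q=e^{2\pi\mathrm i\tau}$ (the argument of $E_2$ in $\mathbf F_{\phi_1}$ is $2\pi\mathrm i t_1=\tau$). *)

(* Defs.v *)
(* MathComp-Analysis, over the complex numbers R[i] of an arbitrary R : realType. *)
From HB Require Import structures.
From mathcomp Require Import all_boot all_order all_algebra complex.
From mathcomp Require Import boolp classical_sets functions reals topology.
From mathcomp Require Import normedtype sequences derive exp trigo.
Set Implicit Arguments.
Unset Strict Implicit.
Unset Printing Implicit Defensive.
Import Order.TTheory GRing.Theory Num.Theory numFieldNormedType.Exports.
Local Open Scope classical_set_scope.
Local Open Scope ring_scope.

(* R[i] as a normed module over itself, so that derivatives are complex ones. *)
HB.instance Definition _ (R : realType) := NormedModule.copy R[i] (R[i]^o).

Section ComplexFunctions.
Variable R : realType.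
Local Notation C := R[i].

Definition ii : C := ('i)%C.
Definition cpi : C := (@pi R)%:C%C.
Definition cexp (z : C) : C :=
  (expR (complex.Re z))%:C%C * Complex (cos (complex.Im z)) (sin (complex.Im z)).

Definition E2 (tau : C) : C :=
  let q := cexp (2 * cpi * ii * tau) in
  1 - 24 * limn (fun N => \sum_(1 <= n < N) n%:R * q ^+ n / (1 - q ^+ n)).

(* Sum of f over the nonzero points of 2 w1 Z + 2 w2 Z, as the limit of the
   sums over the index squares |i - N|, |j - N| <= N. It is only used for
   absolutely convergent families, where the exhaustion does not matter. *)
Definition lattice_sum (w1 w2 : C) (f : C -> C) : C :=
  limn (fun N => \sum_(i < N.*2.+1)
    \sum_(j < N.*2.+1 | (i != N :> nat) || (j != N :> nat))
      f (2 * w1 * (i%:R - N%:R) + 2 * w2 * (j%:R - N%:R))).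

Definition wp (w1 w2 z : C) : C :=
  (z ^+ 2)^-1 + lattice_sum w1 w2 (fun l => ((z - l) ^+ 2)^-1 - (l ^+ 2)^-1).

Definition wzeta (w1 w2 z : C) : C :=
  z^-1 + lattice_sum w1 w2 (fun l => (z - l)^-1 + l^-1 + z / l ^+ 2).

End ComplexFunctions.

Definition k1 : 'I_3 := @Ordinal 3 0 isT.
Definition k2 : 'I_3 := @Ordinal 3 1 isT.
Definition k3 : 'I_3 := @Ordinal 3 2 isT.

Definition row3 (T : nmodType) (a b c : T) : 'rV[T]_3 :=
  \row_(i < 3) [:: a; b; c]`_i.

(* Holomorphic geometry on a domain D of C^3. A tangent vector at m is a row
   vector, and a coordinate system is a map x : 'rV_3 -> 'rV_3. *)
Section Geometry.
Variable R : realType.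
Local Notation C := R[i].
Local Notation V := 'rV[R[i]]_3.

Definition local_coordinates (D : set V) (x : V -> V) : Prop :=
  forall m, D m -> differentiable x m /\ 'J x m \in unitmx.

(* d x_i (v) at m *)
Definition dcoord (x : V -> V) (i : 'I_3) (m v : V) : C := ('d x m v) 0 i.

(* The field dual to the differentials d x_j: dcoord x j m (dd x i m) = (i == j)
   wherever x is a local coordinate system, as 'd x m v = v *m 'J x m. *)
Definition dd (x : V -> V) (i : 'I_3) (m : V) : V := row i (invmx ('J x m)).

Definition flat_coordinates (D : set V) (g : V -> V -> V -> C) (x : V -> V) :=
  local_coordinates D x /\
  exists G : 'M[C]_3, forall m, D m -> forall i j,
    g m (dd x i m) (dd x j m) = G i j.

Definition flat_metric (D : set V) (g : V -> V -> V -> C) : Prop :=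
  forall m, D m -> exists (U : set V) (x : V -> V),
    [/\ open U, U m, U `<=` D & flat_coordinates U g x].

(* Diagonal and nondegenerate in the coordinates x, flat, and with symmetric
   rotation coefficients  (d_j H_i) / H_j, where H_i ^ 2 = g_ii. *)
Definition darboux_egoroff (D : set V) (g : V -> V -> V -> C) (x : V -> V) :=
  [/\ local_coordinates D x,
      forall m, D m -> forall i j, (g m (dd x i m) (dd x j m) == 0) = (i != j),
      flat_metric D g &
      forall m, D m -> exists H : 'I_3 -> V -> C,
        (\forall p \near m, forall i, differentiable (H i) p /\
           H i p ^+ 2 = g p (dd x i p) (dd x i p)) /\
        forall i j, i != j ->
          'D_(dd x j m) (H i) m / H j m = 'D_(dd x i m) (H j) m / H i m].

Definition partial (i : 'I_3) (F : V -> C) : V -> C := 'D_(delta_mx 0 i) F.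

Definition prepotential (D : set V) (g : V -> V -> V -> C)
    (mul : V -> V -> V -> V) (t : V -> V) (F : V -> C) : Prop :=
  forall m, D m -> forall a b c,
    [/\ derivable F (t m) (delta_mx 0 c),
        derivable (partial c F) (t m) (delta_mx 0 b),
        derivable (partial b (partial c F)) (t m) (delta_mx 0 a) &
        partial a (partial b (partial c F)) (t m) =
          g m (mul m (dd t a m) (dd t b m)) (dd t c m)].

End Geometry.

(* A point m = (w1, w2, c) stands for the covering (C/L, wp + c) with
   L = 2 w1 Z + 2 w2 Z and homology basis a = [x, x + 2 w1], b = [x, x + 2 w2].
   The rescaling equivalence lets every covering be written with leading
   coefficient 1; what remains is (w1, w2, c) ~ (- w1, - w2, c), induced by
   z |-> - z, so hurwitz_domain is an unramified double cover of the Hurwitz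
   space. It is the space on which phi_1 (and t_2) has a definite sign. *)
Section HurwitzSpace.
Variable R : realType.
Local Notation C := R[i].
Local Notation V := 'rV[R[i]]_3.

Definition w1 (m : V) : C := m 0 k1.
Definition w2 (m : V) : C := m 0 k2.
Definition cst_term (m : V) : C := m 0 k3.

Definition hurwitz_domain : set V :=
  [set m | w1 m != 0 /\ 0 < complex.Im (w2 m / w1 m)].

Definition covering (m : V) (z : C) : C := wp (w1 m) (w2 m) z + cst_term m.

(* position of the ramification point P_k *)
Definition ram_point (m : V) : 'I_3 -> C :=
  row3 (w1 m) (w2 m) (w1 m + w2 m) 0.

(* the critical values lambda_k *)
Definition lam (m : V) : V := \row_k covering m (ram_point m k).

(* x = sqrt (covering - lambda_k) near P_k; two choices, x and - x *)
Definition std_param (m : V) (k : 'I_3) : set (C -> C) :=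
  [set x : C -> C | \forall z \near ram_point m k,
     derivable x z (1 : C) /\ x z ^+ 2 = covering m z - lam m 0 k].

(* phi_1 = phi1 m z dz *)
Definition phi1 (m : V) (z : C) : C := (2 * w1 m)^-1.

(* (phi_1 / d x_k)(P_k), with x_k chosen by xget; its sign is that of x_k and
   it only enters the metric through its square. *)
Definition phi1_at (m : V) (k : 'I_3) : C :=
  phi1 m (ram_point m k) /
    derive1 (xget (fun=> 0) (std_param m k)) (ram_point m k).

Definition eta_phi1 (m u v : V) : C :=
  2^-1 * \sum_k phi1_at m k ^+ 2 * dcoord lam k m u * dcoord lam k m v.

Definition hmul (m u v : V) : V :=
  \sum_k (dcoord lam k m u * dcoord lam k m v) *: dd lam k m.

Definition unit_field (m : V) : V := \sum_k dd lam k m.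

Definition euler_field (m : V) : V := \sum_k lam m 0 k *: dd lam k m.

Definition tcoord (m : V) : V :=
  row3 (w2 m / (2 * cpi R * ii R * w1 m))
       ((sqrtC 2 * w1 m)^-1)
       (- (wzeta (w1 m) (w2 m) (w1 m) / w1 m) + cst_term m).

Definition Fphi1 (t : V) : C :=
  let t1 := t 0 k1 in let t2 := t 0 k2 in let t3 := t 0 k3 in
  t3 ^+ 2 / 2 * t1 + t3 / 2 * t2 ^+ 2 +
  cpi R ^+ 2 / 24 * t2 ^+ 4 * E2 (2 * cpi R * ii R * t1).

End HurwitzSpace.

Arguments hurwitz_domain {R}.

(* Main.v *)
(* Put q = exp(2 pi i tau), r = exp(pi i tau). Lipschitz's formula turns
   lattice sums into sums over the integers of f(x q^n), f(x) = x / (1 - x)^2,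
   so that the critical values are affine functions of the values
   b_1, b_2, b_3 of sum f(x q^n) at x = -1, r, -r.

   Let s(y) = sum g(y r^n), g(y) = y / (1 - y^2). Partial fractions and
   telescoping give s(y)^2 = sum f(y^2 q^n) - b_2, so s is a square root of
   lambda - lambda_2 near the second ramification point; the other two follow
   by changing the basis of the lattice. Its derivative at its zero t,
   t^2 = r, comes from the fact that s(y) s(t y) is constant: the derivative
   has square (b_2 - b_1)(b_2 - b_3), up to an explicit factor. In particular
   b_1 - b_2 = s(i)^2, which never vanishes by an arithmetic-geometric-mean
   recursion.

   Similar manipulations of double series give the logarithmic derivative of
   s(i) in tau, hence the Halphen system
     b_j' = 2 pi i ((b_j - b_k)(b_j - b_l) - b_j^2)
   up to one scalar defect d; since d(tau) = 4 d(2 tau) and d tends to 0 with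
   r, d = 0. Also E_2 = -4 (b_1 + b_2 + b_3).

   In the coordinates t one has lambda_k = t_3 - 2 pi^2 t_2^2 b_k(2 pi i t_1)
   and eta_kk = 1 / (16 pi^4 t_2^2 prod_(l <> k) (b_k - b_l)). Everything else
   is differentiation by the Halphen system and Lagrange interpolation at
   b_1, b_2, b_3. *)
Require Import Defs.
From HB Require Import structures.
From mathcomp Require Import all_boot all_order all_algebra complex.
From mathcomp Require Import boolp classical_sets functions reals topology.
From mathcomp Require Import normedtype landau sequences derive exp trigo.
From mathcomp Require Import ring lra zify.
Set Implicit Arguments.
Unset Strict Implicit.
Unset Printing Implicit Defensive.
Import Order.TTheory GRing.Theory Num.Theory numFieldNormedType.Exports.
Local Open Scope classical_set_scope.
Local Open Scope ring_scope.

(** * The modulus with values in [R], where real inequalities apply *)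

Section Modulus.
Variable R : realType.
Local Notation C := R[i].
Implicit Types x y z : C.

(** No theory of elliptic functions enters. Each identity is a partial fraction identity between
    terms, summed as an absolutely convergent double family in two directions; sums are therefore
    taken over the net of finite subsets, where they may be sheared and iterated. The product s(y)
    s(t y) is constant because, by parity, s(y) + s(t y) is the same sum for the nome t: the square
    formula for the nomes t and r leaves only constants in the cross term. Classically s(i) = (i/2)
    theta_3(r)^2, and the values at r and -r obey the arithmetic-geometric mean relations; a zero
    would propagate along r -> -r^2 towards 0, where s(i) tends to i/2. The logarithmic derivatives
    of s(i) at r and -r control only b_1 - b_2 and b_1 - b_3, whence a single unknown d;
    differentiating b_2 + b_3 = 4 b_2(2 tau) relates its values at tau and 2 tau. Series are
    differentiated through explicit quadratic remainders of their terms. In the coordinates t, d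
    lambda_k is a quadratic polynomial in b_k, so the metric and the structure constants are divided
    differences of polynomials of degree at most 6. *)

Definition cmod z : R := ComplexField.Normc.normc z.

Lemma cmod_normE z : `|z| = (cmod z)%:C%C.
Proof. by []. Qed.
Lemma cmod0 : cmod 0 = 0. Proof. exact: ComplexField.Normc.normc0. Qed.
Lemma cmod1 : cmod 1 = 1. Proof. exact: ComplexField.Normc.normc1. Qed.
Lemma cmodM x y : cmod (x * y) = cmod x * cmod y.
Proof. exact: ComplexField.Normc.normcM. Qed.
Lemma cmodV x : cmod x^-1 = (cmod x)^-1.
Proof. exact: ComplexField.Normc.normcV. Qed.
Lemma cmodN x : cmod (- x) = cmod x. Proof. exact: normcN. Qed.
Lemma cmod_ge0 x : 0 <= cmod x. Proof. case: x => a b; exact: sqrtr_ge0. Qed.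
Lemma cmodD x y : cmod (x + y) <= cmod x + cmod y.
Proof. exact: le_normcD. Qed.
Lemma cmod_eq0 x : (cmod x == 0) = (x == 0).
Proof.
apply/eqP/eqP => [|->]; [exact: ComplexField.Normc.eq0_normc | exact: cmod0].
Qed.
Lemma cmod_gt0 x : (0 < cmod x) = (x != 0).
Proof. by rewrite lt_def cmod_ge0 andbT cmod_eq0. Qed.
Lemma cmodC x y : cmod (x - y) = cmod (y - x).
Proof. by rewrite -cmodN opprB. Qed.
Lemma cmodX x n : cmod (x ^+ n) = cmod x ^+ n.
Proof. by elim: n => [|n IH]; rewrite ?expr0 ?cmod1 // !exprS cmodM IH. Qed.
Lemma cmodB x y : cmod x - cmod y <= cmod (x - y).
Proof. by have := cmodD (x - y) y; rewrite subrK; lra. Qed.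
Lemma cmodD_ge x y : cmod x - cmod y <= cmod (x + y).
Proof. by have := cmodB x (- y); rewrite opprK cmodN. Qed.
Lemma cmod_triangle x y z : cmod (x - z) <= cmod (x - y) + cmod (y - z).
Proof. by apply: le_trans (cmodD _ _); rewrite addrA subrK. Qed.
Lemma cmod_real (a : R) : cmod a%:C%C = `|a|.
Proof. by rewrite /cmod /= expr0n /= addr0 sqrtr_sqr. Qed.
Lemma cmodMn x n : cmod (x *+ n) = cmod x *+ n. Proof. exact: normcMn. Qed.
Lemma cmod_nat n : cmod n%:R = n%:R. Proof. by rewrite cmodMn cmod1. Qed.
Lemma cmod_sqr z : cmod z ^+ 2 = complex.Re z ^+ 2 + complex.Im z ^+ 2.
Proof. by case: z => a b; rewrite /cmod /= sqr_sqrtr ?addr_ge0 ?sqr_ge0. Qed.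
Lemma cmod_ge_Re z : `|complex.Re z| <= cmod z.
Proof.
rewrite -(@ler_pXn2r _ 2) ?nnegrE ?cmod_ge0 // cmod_sqr real_normK ?num_real //.
by rewrite lerDl sqr_ge0.
Qed.
Lemma cmod_ge_Im z : `|complex.Im z| <= cmod z.
Proof.
rewrite -(@ler_pXn2r _ 2) ?nnegrE ?cmod_ge0 // cmod_sqr real_normK ?num_real //.
by rewrite lerDr sqr_ge0.
Qed.
Lemma cmod_leD z : cmod z <= `|complex.Re z| + `|complex.Im z|.
Proof.
case: z => a b.
have E : Complex a b = a%:C%C + Complex 0 b.
  by apply/eqP; rewrite eq_complex /= addr0 add0r !eqxx.
rewrite [in leLHS]E; apply: le_trans (cmodD _ _) _; rewrite cmod_real; apply: lerD => //.
by rewrite /cmod /= expr0n /= add0r sqrtr_sqr.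
Qed.
Lemma cmod_sum (I : Type) (r : seq I) (P : pred I) (F : I -> C) :
  cmod (\sum_(i <- r | P i) F i) <= \sum_(i <- r | P i) cmod (F i).
Proof.
elim/big_ind2: _ => [|x u y v hx hy|i _]; rewrite ?cmod0 //.
by apply: le_trans (cmodD _ _) _; exact: lerD.
Qed.
Lemma cmod_small z : (forall e : R, 0 < e -> cmod z <= e) -> z = 0.
Proof.
move=> h; apply/eqP; rewrite -cmod_eq0 eq_le cmod_ge0 andbT.
by rewrite leNgt; apply/negP => z0; have := h (cmod z / 2) ltac:(lra); lra.
Qed.
Lemma ReD x y : complex.Re (x + y) = complex.Re x + complex.Re y.
Proof. by case: x y => [? ?] []. Qed.
Lemma ImD x y : complex.Im (x + y) = complex.Im x + complex.Im y.
Proof. by case: x y => [? ?] []. Qed.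
Lemma Re_sum (I : Type) (r : seq I) (P : pred I) (F : I -> C) :
  complex.Re (\sum_(i <- r | P i) F i) = \sum_(i <- r | P i) complex.Re (F i).
Proof. exact: (big_morph _ ReD). Qed.
Lemma Im_sum (I : Type) (r : seq I) (P : pred I) (F : I -> C) :
  complex.Im (\sum_(i <- r | P i) F i) = \sum_(i <- r | P i) complex.Im (F i).
Proof. exact: (big_morph _ ImD). Qed.
End Modulus.

(** * Unconditional summation *)

(* Convergence of the net of finite partial sums, finite subsets being
   represented by uniq lists. *)
Section HasSum.
Variable R : realType.
Local Notation C := R[i].

Definition has_sum (I : eqType) (a : I -> C) (s : C) : Prop :=
  forall e : R, 0 < e -> exists A : seq I, forall B : seq I,
    uniq B -> {subset A <= B} -> cmod (\sum_(i <- B) a i - s) < e.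

Definition summable_by (I : eqType) (a : I -> C) (M : R) : Prop :=
  forall B : seq I, uniq B -> \sum_(i <- B) cmod (a i) <= M.

Definition summable (I : eqType) (a : I -> C) : Prop :=
  exists M, summable_by a M.

Lemma has_sum_unique (I : eqType) (a : I -> C) s t :
  has_sum a s -> has_sum a t -> s = t.
Proof.
move=> hs ht; apply/eqP; rewrite -subr_eq0; apply/eqP/cmod_small => e e0.
have [A hA] := hs (e / 2) ltac:(lra); have [B hB] := ht (e / 2) ltac:(lra).
set D := undup (A ++ B).
have uD : uniq D by exact: undup_uniq.
have h1 := hA D uD ltac:(by move=> i; rewrite mem_undup mem_cat => ->).
have h2 := hB D uD ltac:(by move=> i; rewrite mem_undup mem_cat => ->; rewrite orbT).
have := cmod_triangle s (\sum_(i <- D) a i) t.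
by rewrite (cmodC s (\sum_(i <- D) a i)); lra.
Qed.

Lemma eq_has_sum (I : eqType) (a b : I -> C) s :
  (forall i, a i = b i) -> has_sum a s -> has_sum b s.
Proof. by move=> h; rewrite (_ : a = b) //; apply: funext. Qed.

Lemma has_sum0 (I : eqType) : has_sum (fun _ : I => 0) 0.
Proof. by move=> e e0; exists [::] => B _ _; rewrite big1 // subrr cmod0. Qed.

Lemma has_sumD (I : eqType) (a b : I -> C) s t :
  has_sum a s -> has_sum b t -> has_sum (fun i => a i + b i) (s + t).
Proof.
move=> hs ht e e0.
have [A hA] := hs (e / 2) ltac:(lra); have [B hB] := ht (e / 2) ltac:(lra).
exists (A ++ B) => D uD sD.
have h1 := hA D uD ltac:(by move=> i Ai; apply: sD; rewrite mem_cat Ai).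
have h2 := hB D uD ltac:(by move=> i Ai; apply: sD; rewrite mem_cat Ai orbT).
rewrite big_split /= opprD addrACA.
by apply: le_lt_trans (cmodD _ _) _; rewrite [e]splitr; exact: ltrD.
Qed.

Lemma has_sumZ (I : eqType) (a : I -> C) k s :
  has_sum a s -> has_sum (fun i => k * a i) (k * s).
Proof.
move=> hs e e0.
have k1 : 0 < cmod k + 1 by have := cmod_ge0 k; lra.
have [A hA] := hs (e / (cmod k + 1)) ltac:(exact: divr_gt0).
exists A => B uB sB; have := hA B uB sB.
rewrite -mulr_sumr -mulrBr cmodM ltr_pdivlMr // => h.
by have := cmod_ge0 (\sum_(i <- B) a i - s); nra.
Qed.

Lemma has_sumZr (I : eqType) (a : I -> C) k s :
  has_sum a s -> has_sum (fun i => a i * k) (s * k).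
Proof.
by move=> h; rewrite mulrC; apply: eq_has_sum (has_sumZ k h) => i; rewrite mulrC.
Qed.

Lemma has_sumN (I : eqType) (a : I -> C) s :
  has_sum a s -> has_sum (fun i => - a i) (- s).
Proof.
by move=> h; rewrite -mulN1r; apply: eq_has_sum (has_sumZ (-1) h) => i; rewrite mulN1r.
Qed.

Lemma has_sumB (I : eqType) (a b : I -> C) s t :
  has_sum a s -> has_sum b t -> has_sum (fun i => a i - b i) (s - t).
Proof. by move=> hs ht; apply: has_sumD hs (has_sumN ht). Qed.

(** A finite list of indices is pulled back to the list of its preimages; only zero terms are lost.
    Sums over the naturals, over one sign or over one parity class become sums over [int] in this
    way. *)
Lemma has_sum_ext (I J : eqType) (phi : J -> I) (a : I -> C) s :
  injective phi -> (forall i, (forall j, i <> phi j) -> a i = 0) ->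
  has_sum (a \o phi) s -> has_sum a s.
Proof.
move=> inj h0 hs e e0; have [A hA] := hs e e0.
have pre (B : seq I) : uniq B -> exists B' : seq J, [/\ uniq B',
    (forall j, (phi j \in B) = (j \in B')) &
    \sum_(i <- B) a i = \sum_(j <- B') a (phi j)].
  elim: B => [|i B IH] /=; first by exists [::]; rewrite !big_nil.
  case/andP => iB /IH [B' [uB' mB' sB']].
  have [[j ij]|nj] := pselect (exists j, i = phi j).
    exists (j :: B'); split.
    - by rewrite /= uB' -mB' -ij iB.
    - by move=> k; rewrite !inE ij (inj_eq inj) mB'.
    - by rewrite !big_cons sB' ij.
  exists B'; split => //.
  - move=> k; rewrite inE mB'; case: eqP => //= ki.
    by case: nj; exists k.
  - by rewrite big_cons sB' h0 ?add0r // => j ij; apply: nj; exists j.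
exists (map phi A) => B uB sB.
have [B' [uB' mB' ->]] := pre B uB.
by apply: hA => // j jA; rewrite -mB'; apply: sB; exact: map_f.
Qed.

Lemma has_sum_bij (I J : eqType) (phi : J -> I) (psi : I -> J) (a : I -> C) s :
  cancel phi psi -> cancel psi phi -> has_sum a s -> has_sum (a \o phi) s.
Proof.
move=> k1 k2 hs; apply: (@has_sum_ext J I psi) (can_inj k2) _ _ => //.
  by move=> j /(_ (phi j)); rewrite k1.
by apply: eq_has_sum hs => i /=; rewrite k2.
Qed.

Lemma has_sum_point (I : eqType) (i0 : I) (c : C) :
  has_sum (fun i => if i == i0 then c else 0) c.
Proof.
move=> e e0; exists [:: i0] => B uB sB.
rewrite (bigD1_seq i0) ?sB ?inE //= eqxx big1 ?addr0 ?subrr ?cmod0 //.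
by move=> i /negPf ->.
Qed.

Lemma has_sum_seq (I : eqType) (r : seq I) (a : I -> C) :
  uniq r -> has_sum (fun i => if i \in r then a i else 0) (\sum_(i <- r) a i).
Proof.
move=> ur e e0; exists r => B uB sB.
rewrite -big_mkcond /= -big_filter (perm_big r) ?subrr ?cmod0 //=.
apply: uniq_perm; rewrite ?filter_uniq // => i.
by rewrite mem_filter; case: (boolP (i \in r)) => //= /sB.
Qed.

Lemma summable_le (I : eqType) (a b : I -> C) M :
  (forall i, cmod (a i) <= cmod (b i)) -> summable_by b M -> summable_by a M.
Proof.
by move=> h hb B uB; apply: le_trans (hb B uB); apply: ler_sum => i _.
Qed.

Lemma summable_byZ (I : eqType) (a : I -> C) k M :
  summable_by a M -> summable_by (fun i => k * a i) (cmod k * M).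
Proof.
move=> h B uB; under eq_bigr do rewrite cmodM.
by rewrite -mulr_sumr ler_wpM2l ?cmod_ge0 ?h.
Qed.

Lemma summableD (I : eqType) (a b : I -> C) :
  summable a -> summable b -> summable (fun i => a i + b i).
Proof.
move=> [M hM] [M' hM']; exists (M + M') => B uB.
apply: le_trans (lerD (hM B uB) (hM' B uB)).
by rewrite -big_split /=; apply: ler_sum => i _; exact: cmodD.
Qed.

Lemma summableZ (I : eqType) (a : I -> C) k :
  summable a -> summable (fun i => k * a i).
Proof. by move=> [M hM]; exists (cmod k * M); exact: summable_byZ. Qed.

Lemma eq_summable (I : eqType) (a b : I -> C) :
  (forall i, a i = b i) -> summable a -> summable b.
Proof. by move=> h; rewrite (_ : a = b) //; apply: funext. Qed.

Lemma summable_seq (I : eqType) (r : seq I) (a : I -> C) :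
  summable (fun i => if i \in r then a i else 0).
Proof.
exists (\sum_(i <- undup r) cmod (a i)) => B uB.
rewrite (eq_bigr (fun i => if i \in r then cmod (a i) else 0)); last first.
  by move=> i _; case: ifP => // _; rewrite cmod0.
rewrite -big_mkcond /= [leRHS](bigID (mem B)) /=.
rewrite -[leLHS]addr0 lerD ?sumr_ge0 // => [|i _]; last exact: cmod_ge0.
rewrite -big_filter -[leRHS]big_filter (perm_big [seq i <- undup r | i \in B]) //=.
apply: uniq_perm; rewrite ?filter_uniq ?undup_uniq // => i.
by rewrite !mem_filter mem_undup andbC.
Qed.

(** The exceptional list contributes a finitely supported family, so bounds valid for large indices
    suffice. *)
Lemma summable_off (I : eqType) (r : seq I) (a b : I -> C) :
  (forall i, i \notin r -> cmod (a i) <= cmod (b i)) -> summable b -> summable a.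
Proof.
move=> h sb.
have s1 : summable (fun i => if i \in r then 0 else a i).
  case: sb => M hM; exists M; apply: summable_le hM => i.
  by case: ifPn => [_|/h //]; rewrite cmod0 cmod_ge0.
apply: eq_summable (summableD s1 (summable_seq r a)) => i.
by case: ifP; rewrite ?add0r ?addr0.
Qed.

Lemma summable_inj (I J : eqType) (phi : J -> I) (a : I -> C) :
  injective phi -> summable a -> summable (a \o phi).
Proof.
move=> inj [M hM]; exists M => B uB.
by have := hM (map phi B); rewrite map_inj_uniq // big_map; apply.
Qed.

Lemma summable_ext (I J : eqType) (phi : J -> I) (a : I -> C) :
  injective phi -> (forall i, (forall j, i <> phi j) -> a i = 0) ->
  summable (a \o phi) -> summable a.
Proof.
move=> inj h0 [M hM]; exists M => B uB.
have [B' [uB' ->]] : exists B' : seq J, uniq B' /\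
    \sum_(i <- B) cmod (a i) = \sum_(j <- B') cmod (a (phi j)).
  suff [B' [uB' _ h]] : exists B' : seq J, [/\ uniq B',
    (forall j, (phi j \in B) = (j \in B')) &
    \sum_(i <- B) cmod (a i) = \sum_(j <- B') cmod (a (phi j))] by exists B'.
  elim: B uB => [|i B IH] /=; first by exists [::]; rewrite !big_nil.
  case/andP => iB /IH [B' [uB' mB' sB']].
  have [[j ij]|nj] := pselect (exists j, i = phi j).
    exists (j :: B'); split.
    - by rewrite /= uB' -mB' -ij iB.
    - by move=> k; rewrite !inE ij (inj_eq inj) mB'.
    - by rewrite !big_cons sB' ij.
  exists B'; split => //.
  - move=> k; rewrite inE mB'; case: eqP => //= ki.
    by case: nj; exists k.
  - rewrite big_cons sB' h0 ?cmod0 ?add0r // => j ij; apply: nj; by exists j.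
exact: hM.
Qed.

(** Monotone nets converge to their supremum: a list almost reaching it controls all larger
    lists. *)
Let sup_nonneg (I : eqType) (a : I -> R) (M : R) :
  (forall i, 0 <= a i) -> (forall B, uniq B -> \sum_(i <- B) a i <= M) ->
  exists s, forall e, 0 < e -> exists A : seq I, forall B : seq I,
    uniq B -> {subset A <= B} -> `|\sum_(i <- B) a i - s| < e.
Proof.
move=> a0 hM.
pose E : set R := [set x | exists2 B : seq I, uniq B & x = \sum_(i <- B) a i]%classic.
have supE : has_sup E.
  split; first by exists 0, [::] => //; rewrite big_nil.
  by exists M => _ [B uB ->]; exact: hM.
exists (sup E) => e e0.
have [_ [A uA ->] hA] := sup_adherent e0 supE.
exists A => B uB sB.
have h1 : \sum_(i <- A) a i <= \sum_(i <- B) a i.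
  rewrite [leRHS](bigID (mem A)) /= -[leLHS]addr0 lerD ?sumr_ge0 //.
  rewrite -[leRHS]big_filter (perm_big [seq i <- B | i \in A]) //=.
  apply: uniq_perm; rewrite ?filter_uniq // => i; rewrite mem_filter.
  by case: (boolP (i \in A)) => //= /sB.
have h2 : \sum_(i <- B) a i <= sup E by apply: sup_upper_bound => //; exists B.
by rewrite ler0_norm; lra.
Qed.

(** Reduces to nonnegative families: the modulus, the modulus plus the real part and the modulus
    plus the imaginary part converge to [s0], [s1], [s2], and differences recover the real and
    imaginary parts. *)
Lemma summable_has_sum (I : eqType) (a : I -> C) :
  summable a -> exists s, has_sum a s.
Proof.
case=> M hM.
have [s0 h0] := sup_nonneg (fun i => cmod_ge0 (a i)) hM.
have hRe : forall i, 0 <= cmod (a i) + complex.Re (a i).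
  by move=> i; have := cmod_ge_Re (a i); rewrite ler_norml => /andP[]; lra.
have hIm : forall i, 0 <= cmod (a i) + complex.Im (a i).
  by move=> i; have := cmod_ge_Im (a i); rewrite ler_norml => /andP[]; lra.
have [|s1 h1] := sup_nonneg hRe (M := M + M).
  move=> B uB; apply: le_trans (lerD (hM B uB) (hM B uB)).
  rewrite -big_split /=; apply: ler_sum => i _; rewrite lerD2l.
  by apply: le_trans (ler_norm _) (cmod_ge_Re _).
have [|s2 h2] := sup_nonneg hIm (M := M + M).
  move=> B uB; apply: le_trans (lerD (hM B uB) (hM B uB)).
  rewrite -big_split /=; apply: ler_sum => i _; rewrite lerD2l.
  by apply: le_trans (ler_norm _) (cmod_ge_Im _).
exists (Complex (s1 - s0) (s2 - s0)) => e e0.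
have [A0 H0] := h0 (e / 4) ltac:(lra); have [A1 H1] := h1 (e / 4) ltac:(lra).
have [A2 H2] := h2 (e / 4) ltac:(lra).
exists (A0 ++ A1 ++ A2) => B uB sB.
have {}H0 := H0 B uB ltac:(by move=> i Ai; apply: sB; rewrite !mem_cat Ai).
have {}H1 := H1 B uB ltac:(by move=> i Ai; apply: sB; rewrite !mem_cat Ai orbT).
have {}H2 := H2 B uB ltac:(by move=> i Ai; apply: sB; rewrite !mem_cat Ai !orbT).
rewrite !big_split /= in H1 H2.
apply: le_lt_trans (cmod_leD _) _.
case E: (\sum_(i <- B) a i) => [x y] /=.
have Ex : x = \sum_(i <- B) complex.Re (a i) by rewrite -Re_sum E.
have Ey : y = \sum_(i <- B) complex.Im (a i) by rewrite -Im_sum E.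
rewrite -Ex in H1; rewrite -Ey in H2.
move: H0 H1 H2; set m := \sum_(i <- B) cmod _.
rewrite !ltr_norml => /andP[? ?] /andP[? ?] /andP[? ?].
have hx : `|x - (s1 - s0)| < e / 2 by rewrite ltr_norml; apply/andP; split; lra.
have hy : `|y - (s2 - s0)| < e / 2 by rewrite ltr_norml; apply/andP; split; lra.
lra.
Qed.

Lemma has_sum_le (I : eqType) (a : I -> C) s M :
  summable_by a M -> has_sum a s -> cmod s <= M.
Proof.
move=> hM hs; apply/ler_addgt0Pr => e e0; have [A hA] := hs e e0.
have uA : uniq (undup A) by exact: undup_uniq.
have h := hA _ uA ltac:(by move=> i; rewrite mem_undup).
have h1 := le_trans (cmod_sum _ _ _) (hM _ uA).
by have := cmodB s (\sum_(i <- undup A) a i); rewrite cmodC; lra.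
Qed.

(** A rectangle [B x K] containing [A] has sum close to [s]; enlarging [K] brings each of the
    finitely many row sums close to [g i]. Applied to a reindexed family, it exchanges or shears the
    order of summation. *)
Lemma has_sum_fubini (I J : eqType) (a : I * J -> C) (g : I -> C) s :
  has_sum a s -> (forall i, has_sum (fun j => a (i, j)) (g i)) -> has_sum g s.
Proof.
move=> hs hg e e0; have [A hA] := hs (e / 2) ltac:(lra).
exists (map fst A) => B uB sB.
(* The successor keeps the division meaningful when there are no rows. *)
pose n : R := (size B).+1%:R.
have n0 : 0 < n by rewrite ltr0n.
have en0 : 0 < e / 2 / n by apply: divr_gt0 => //; lra.
have /choice [D hD] : forall i, exists D : seq J, forall B : seq J,
    uniq B -> {subset D <= B} -> cmod (\sum_(j <- B) a (i, j) - g i) < e / 2 / n.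
  by move=> i; exact: hg.
set K := undup (flatten (map D B) ++ map snd A).
have uK : uniq K by exact: undup_uniq.
have sK i : i \in B -> {subset D i <= K}.
  move=> iB j jD; rewrite mem_undup mem_cat; apply/orP; left.
  by apply/flattenP; exists (D i) => //; exact: map_f.
have u2 : uniq [seq (i, j) | i <- B, j <- K] by apply: allpairs_uniq => // -[? ?] [].
have := hA _ u2; rewrite big_allpairs_dep /= => {}hA.
have {}hA : cmod (\sum_(i <- B) \sum_(j <- K) a (i, j) - s) < e / 2.
  apply: hA => -[i j] ijA; apply/allpairsP; exists (i, j) => /=; split => //.
    by apply: sB; apply: (map_f fst ijA).
  by rewrite mem_undup mem_cat (map_f snd ijA) orbT.
have h2 : cmod (\sum_(i <- B) \sum_(j <- K) a (i, j) - \sum_(i <- B) g i) <= e / 2.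
  rewrite -sumrB; apply: le_trans (cmod_sum _ _ _) _.
  apply: (@le_trans _ _ (\sum_(i <- B) e / 2 / n)).
    rewrite !big_seq; apply: ler_sum => i iB; apply/ltW/hD => //; exact: sK.
  rewrite big_const_seq count_predT iter_addr_0.
  have -> : (e / 2 / n) *+ size B = (e / 2) * ((size B)%:R / n) by rewrite -mulr_natr; ring.
  have : (size B)%:R / n <= 1 by rewrite ler_pdivrMr // mul1r ler_nat.
  move=> h; apply: ler_piMr => //; lra.
apply: le_lt_trans (cmod_triangle _ (\sum_(i <- B) \sum_(j <- K) a (i, j)) _) _.
by rewrite cmodC; lra.
Qed.

Lemma summable_byM (I J : eqType) (a : I -> C) (b : J -> C) M N :
  summable_by a M -> summable_by b N ->
  summable_by (fun p : I * J => a p.1 * b p.2) (M * N).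
Proof.
move=> hM hN B uB.
set B1 := undup (map fst B); set B2 := undup (map snd B).
have u1 : uniq B1 by exact: undup_uniq.
have u2 : uniq B2 by exact: undup_uniq.
have N0 : 0 <= N by have := hN [::] isT; rewrite big_nil.
apply: (@le_trans _ _ (\sum_(p <- [seq (i, j) | i <- B1, j <- B2]) cmod (a p.1 * b p.2))).
  set B12 := [seq _ | _ <- _, _ <- _].
  have u12 : uniq B12 by apply: allpairs_uniq => // -[? ?] [].
  rewrite [leRHS](bigID (mem B)) /= -[leLHS]addr0.
  rewrite lerD ?sumr_ge0 // => [|i _]; last exact: cmod_ge0.
  rewrite -[leRHS]big_filter (perm_big [seq i <- B12 | i \in B]) //=.
  apply: uniq_perm; rewrite ?filter_uniq // => -[i j].
  rewrite mem_filter; case: (boolP (_ \in B)) => //= h.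
  symmetry; apply/allpairsP; exists (i, j); rewrite !mem_undup; split => //.
    by apply: (map_f fst h).
  by apply: (map_f snd h).
rewrite big_allpairs_dep /=.
have -> : \sum_(i <- B1) \sum_(j <- B2) cmod (a i * b j) =
    (\sum_(i <- B1) cmod (a i)) * (\sum_(j <- B2) cmod (b j)).
  rewrite mulr_suml; apply: eq_bigr => i _.
  by rewrite mulr_sumr; apply: eq_bigr => j _; rewrite cmodM.
apply: ler_pM; rewrite ?sumr_ge0 ?hM ?hN //; move=> *; exact: cmod_ge0.
Qed.

Lemma summableM (I J : eqType) (a : I -> C) (b : J -> C) :
  summable a -> summable b -> summable (fun p : I * J => a p.1 * b p.2).
Proof. by move=> [M hM] [N hN]; exists (M * N); exact: summable_byM. Qed.

Lemma has_sumM (I J : eqType) (a : I -> C) (b : J -> C) s t :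
  summable a -> summable b -> has_sum a s -> has_sum b t ->
  has_sum (fun p : I * J => a p.1 * b p.2) (s * t).
Proof.
move=> sa sb hs ht; have [u hu] := summable_has_sum (summableM sa sb).
have := has_sum_fubini hu (fun i => has_sumZ (a i) ht) => /= h.
by rewrite (has_sum_unique (has_sumZr t hs) h).
Qed.

Lemma has_sum_seqlim (I : eqType) (a : I -> C) s (W : nat -> seq I) :
  has_sum a s -> (forall n, uniq (W n)) ->
  (forall i, exists n0, forall n, (n0 <= n)%N -> i \in W n) ->
  forall e : R, 0 < e -> exists n0, forall n, (n0 <= n)%N ->
    cmod (\sum_(i <- W n) a i - s) < e.
Proof.
move=> hs uW hW e e0; have [A hA] := hs e e0.
have [n0 hn0] : exists n0, forall n, (n0 <= n)%N -> {subset A <= W n}.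
  elim: A {hA} => [|i A [n1 h1]]; first by exists 0%N.
  have [n2 h2] := hW i; exists (maxn n1 n2) => n; rewrite geq_max => /andP[n1n n2n] j.
  by rewrite inE => /orP[/eqP ->|]; [exact: h2 | exact: h1].
by exists n0 => n hn; apply: hA => //; exact: hn0.
Qed.

(** Dominated convergence in the form that Lipschitz's formula calls for: all approximating families
    have the same sum [s]. The error splits into a finite list [A], where convergence is pointwise,
    and tails bounded by those of [b]. *)
Lemma has_sum_tannery (I : eqType) (a : nat -> I -> C) (a' : I -> C) (b : I -> C) s :
  summable b -> (forall K i, cmod (a K i) <= cmod (b i)) ->
  (forall i (e : R), 0 < e -> exists K0, forall K, (K0 <= K)%N -> cmod (a K i - a' i) < e) ->
  (forall K, has_sum (a K) s) -> has_sum a' s.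
Proof.
move=> [M hM] hab hlim hs.
have ha' i : cmod (a' i) <= cmod (b i).
  apply/ler_addgt0Pr => e e0; have [K /(_ K (leqnn K)) hK] := hlim i e e0.
  by have := cmodB (a' i) (a K i); rewrite cmodC; have := hab K i; lra.
have [s' hs'] := summable_has_sum (ex_intro _ M (summable_le ha' hM)).
suff -> : s = s' by [].
have [m hm] := sup_nonneg (fun i => cmod_ge0 (b i)) hM.
apply/eqP; rewrite -subr_eq0; apply/eqP/cmod_small => e e0.
(* Two partial sums of the moduli of [b] within [e / 24] of their limit differ by less than
   [e / 12], which bounds the tail outside [A]. *)
have [A0 hA0] := hm (e / 24) ltac:(lra).
have [A1 hA1] := hs' (e / 6) ltac:(lra).
pose A := undup (A0 ++ A1).
have uA : uniq A by exact: undup_uniq.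
have [K hK] : exists K, cmod (\sum_(i <- A) a K i - \sum_(i <- A) a' i) <= e / 6.
  have [K0 hK0] : exists K0, forall K i, (K0 <= K)%N -> i \in A ->
      cmod (a K i - a' i) < e / 6 / (size A).+1%:R.
    elim: A {uA} (_ / _ / _) (divr_gt0 (divr_gt0 e0 (ltr0n R 6)) (ltr0n R (size A).+1)) => [|i A IH] d d0.
      by exists 0%N.
    have [K1 h1] := IH d d0; have [K2 h2] := hlim i d d0.
    exists (maxn K1 K2) => K j; rewrite geq_max => /andP[? ?].
    by rewrite inE => /orP[/eqP ->|]; [exact: h2 | exact: h1].
  exists K0; rewrite -sumrB; apply: le_trans (cmod_sum _ _ _) _.
  apply: (@le_trans _ _ (\sum_(i <- A) e / 6 / (size A).+1%:R)).
    by rewrite !big_seq; apply: ler_sum => i iA; apply/ltW/hK0.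
  rewrite big_const_seq count_predT iter_addr_0.
  have -> : (e / 6 / (size A).+1%:R) *+ size A = (e / 6) * ((size A)%:R / (size A).+1%:R).
    by rewrite -mulr_natr; ring.
  have : (size A)%:R / (size A).+1%:R <= 1 :> R by rewrite ler_pdivrMr ?ltr0n // mul1r ler_nat.
  move=> h; apply: ler_piMr => //; lra.
have [A2 hA2] := hs K (e / 6) ltac:(lra).
pose B := undup (A ++ A2).
have uB : uniq B by exact: undup_uniq.
have h2 := hA2 B uB ltac:(by move=> i h; rewrite mem_undup mem_cat h orbT).
have h1 := hA1 A uA ltac:(by move=> i h; rewrite mem_undup mem_cat h orbT).
have hb1 := hA0 A uA ltac:(by move=> i h; rewrite mem_undup mem_cat h).
have hb2 := hA0 B uB ltac:(by move=> i h; rewrite mem_undup mem_cat mem_undup mem_cat h).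
have split_B (F : I -> C) : \sum_(i <- B) F i = \sum_(i <- A) F i + \sum_(i <- B | i \notin A) F i.
  rewrite (bigID (mem A)) /= -big_filter (perm_big A) //.
  apply: uniq_perm; rewrite ?filter_uniq // => i.
  rewrite mem_filter; case: (boolP (i \in A)) => //= h.
  by rewrite mem_undup mem_cat h.
have split_Br (F : I -> R) : \sum_(i <- B) F i = \sum_(i <- A) F i + \sum_(i <- B | i \notin A) F i.
  rewrite (bigID (mem A)) /= -big_filter (perm_big A) //.
  apply: uniq_perm; rewrite ?filter_uniq // => i.
  rewrite mem_filter; case: (boolP (i \in A)) => //= h.
  by rewrite mem_undup mem_cat h.
have h3 : cmod (\sum_(i <- B | i \notin A) a K i) <= e / 12.
  apply: le_trans (cmod_sum _ _ _) _.
  apply: (@le_trans _ _ (\sum_(i <- B | i \notin A) cmod (b i))); first exact: ler_sum.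
  by move: hb1 hb2; rewrite split_Br !ltr_norml => /andP[? ?] /andP[? ?]; lra.
have E : s - s' = - (\sum_(i <- B) a K i - s) + \sum_(i <- B | i \notin A) a K i
  + (\sum_(i <- A) a K i - \sum_(i <- A) a' i) + (\sum_(i <- A) a' i - s').
  by rewrite split_B; ring.
rewrite E; apply: le_trans (cmodD _ _) _.
apply: le_trans (lerD (cmodD _ _) (lexx _)) _.
apply: le_trans (lerD (lerD (cmodD _ _) (lexx _)) (lexx _)) _.
by rewrite cmodN; lra.
Qed.

Definition tsum (I : eqType) (a : I -> C) : C := xget 0 [set s | has_sum a s]%classic.

Lemma tsumP (I : eqType) (a : I -> C) s : has_sum a s -> tsum a = s.
Proof.
move=> hs; apply: has_sum_unique (hs).
by rewrite /tsum; case: xgetP => [t _ //|/(_ s)].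
Qed.

Lemma has_tsum (I : eqType) (a : I -> C) : summable a -> has_sum a (tsum a).
Proof. by move=> /summable_has_sum [s hs]; rewrite (tsumP hs). Qed.

End HasSum.

(** * Sums over the naturals and the integers: geometric decay and telescoping *)

Section IntSums.
Variable R : realType.
Local Notation C := R[i].

Lemma summable_nat (a : nat -> C) M :
  (forall N, \sum_(0 <= i < N) cmod (a i) <= M) -> summable_by a M.
Proof.
move=> h B uB.
have [N hN] : exists N, forall i, i \in B -> (i < N)%N.
  elim: B {uB} => [|i B [N hN]]; first by exists 0%N.
  exists (maxn i.+1 N) => j; rewrite inE leq_max => /orP[/eqP ->|/hN ->].
    by rewrite ltnSn.
  by rewrite orbT.
apply: le_trans (h N); rewrite [leRHS](bigID (mem B)) /=.
rewrite -[leLHS]addr0 lerD ?sumr_ge0 // => [|i _]; last exact: cmod_ge0.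
rewrite -[leRHS]big_filter (perm_big [seq i <- index_iota 0 N | i \in B]) //=.
apply: uniq_perm; rewrite ?filter_uniq ?iota_uniq // => i.
by rewrite mem_filter mem_index_iota; case: (boolP (i \in B)) => //= /hN ->.
Qed.

Lemma has_sum_int (a : int -> C) s t :
  has_sum (fun n : nat => a (Posz n)) s -> has_sum (fun n : nat => a (Negz n)) t ->
  has_sum a (s + t).
Proof.
move=> hs ht.
pose ap (n : int) := if n is Posz _ then a n else 0.
pose am (n : int) := if n is Negz _ then a n else 0.
have hp : has_sum ap s.
  apply: (@has_sum_ext R int nat Posz) hs; first by move=> m n [].
  by case=> n // /(_ n).
have hm : has_sum am t.
  apply: (@has_sum_ext R int nat Negz) ht; first by move=> m n [].
  by case=> n // /(_ n).
by apply: eq_has_sum (has_sumD hp hm) => -[] n; rewrite /= ?addr0 ?add0r.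
Qed.

Lemma summable_int (a : int -> C) :
  summable (fun n : nat => a (Posz n)) -> summable (fun n : nat => a (Negz n)) ->
  summable a.
Proof.
move=> hs ht.
pose ap (n : int) := if n is Posz _ then a n else 0.
pose am (n : int) := if n is Negz _ then a n else 0.
have hp : summable ap.
  apply: (@summable_ext R int nat Posz) hs; first by move=> m n [].
  by case=> n // /(_ n).
have hm : summable am.
  apply: (@summable_ext R int nat Negz) ht; first by move=> m n [].
  by case=> n // /(_ n).
by apply: eq_summable (summableD hp hm) => -[] n; rewrite /= ?addr0 ?add0r.
Qed.

Lemma sum_geo_le (rho : R) N : 0 <= rho < 1 ->
  \sum_(0 <= i < N) rho ^+ i <= (1 - rho)^-1.
Proof.
move=> /andP[r0 r1]; have d0 : 0 < 1 - rho by lra.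
rewrite -[leRHS]mul1r ler_pdivlMr //.
suff -> : (\sum_(0 <= i < N) rho ^+ i) * (1 - rho) = 1 - rho ^+ N.
  by rewrite lerBlDr lerDl exprn_ge0.
elim: N => [|N IH]; first by rewrite big_geq // mul0r expr0 subrr.
by rewrite big_nat_recr //= mulrDl IH exprS; ring.
Qed.

(** Each of the [n] powers [rho ^ i] with [i < n] is at least [rho ^ n], so [n * rho ^ n] is below
    the geometric sum. *)
Lemma natmul_geo_le (rho : R) n : 0 <= rho < 1 ->
  n%:R * rho ^+ n <= (1 - rho)^-1.
Proof.
move=> hr; apply: le_trans (sum_geo_le n hr).
move: hr => /andP[r0 r1].
rewrite mulr_natl -[X in _ *+ X]subn0 -sumr_const_nat.
rewrite !big_nat; apply: ler_sum => i /andP[_ /ltnW iN].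
by apply: ler_wiXn2l => //; lra.
Qed.

Lemma geo_small (rho C0 e : R) : 0 <= rho < 1 -> 0 < e ->
  exists N, forall n, (N <= n)%N -> C0 * rho ^+ n <= e.
Proof.
move=> hr e0; pose M := `|C0| / (1 - rho) / e.
have /andP[r0 r1] := hr.
exists (Num.truncn M).+1 => n hn.
have hM : M < n%:R by apply: lt_le_trans (truncnS_gt M) _; rewrite ler_nat.
have n0 : 0 < n%:R :> R.
  by apply: le_lt_trans hM; rewrite /M !divr_ge0 ?normr_ge0 //; lra.
have h := natmul_geo_le n hr.
apply: (@le_trans _ _ (`|C0| * rho ^+ n)).
  by apply: ler_wpM2r; rewrite ?exprn_ge0 // ler_norm.
rewrite /M ltr_pdivrMr // in hM.
rewrite -(ler_pM2l n0) mulrCA; apply: le_trans (ltW hM).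
exact: ler_wpM2l.
Qed.

(** Two-sided geometric decay. The families over [int] built from a nome are shown to have it and,
    unlike mere summability, it survives multiplication by [n]. *)
Definition geob (a : int -> C) : Prop := exists (rho K : R),
  0 < rho < 1 /\ forall n, cmod (a n) <= K * rho ^+ absz n.

Lemma summable_geo_nat (a : nat -> C) (rho K : R) : 0 <= rho < 1 ->
  (forall n, cmod (a n) <= K * rho ^+ n) -> summable_by a (K / (1 - rho)).
Proof.
move=> hr h; apply: summable_nat => N.
have K0 : 0 <= K by have := le_trans (cmod_ge0 _) (h 0%N); rewrite expr0 mulr1.
apply: (@le_trans _ _ (\sum_(0 <= i < N) K * rho ^+ i)); first exact: ler_sum.
by rewrite -mulr_sumr; apply: ler_wpM2l => //; exact: sum_geo_le.
Qed.

Lemma geob_summable a : geob a -> summable a.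
Proof.
move=> [rho [K [/andP[r0 r1] h]]].
apply: summable_int.
  exists (K / (1 - rho)); apply: summable_geo_nat => [|n]; first lra.
  exact: (h (Posz n)).
exists (K * rho / (1 - rho)); apply: summable_geo_nat => [|n]; first lra.
by have := h (Negz n); rewrite /= exprS mulrA.
Qed.

(** The rate is weakened from [rho] to its square root: of the two factors [sqrt rho ^ |n|], one
    absorbs [n] and the other remains. *)
Lemma geob_natmul a : geob a -> geob (fun n => n%:~R * a n).
Proof.
move=> [rho [K [/andP[r0 r1] h]]].
have s0 : 0 < Num.sqrt rho by rewrite sqrtr_gt0.
have s1 : Num.sqrt rho < 1 by rewrite -sqrtr1 ltr_sqrt.
have s2 : rho = Num.sqrt rho * Num.sqrt rho by rewrite -expr2 sqr_sqrtr ?ltW.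
have K0 : 0 <= K by have := le_trans (cmod_ge0 _) (h 0); rewrite expr0 mulr1.
exists (Num.sqrt rho), (K / (1 - Num.sqrt rho)); split; first by rewrite s0 s1.
move=> n; rewrite cmodM.
have -> : cmod (n%:~R : C) = (absz n)%:R.
  by case: n => n; rewrite ?NegzE ?mulrNz ?cmodN /= -?pmulrn cmod_nat.
have := h n; rewrite {1}s2 exprMn => hn.
have h1 := @natmul_geo_le (Num.sqrt rho) (absz n) ltac:(lra).
have e0 : 0 <= Num.sqrt rho ^+ absz n by rewrite exprn_ge0 // ltW.
apply: le_trans (ler_wpM2l (ler0n _ _) hn) _.
have -> : (absz n)%:R * (K * (Num.sqrt rho ^+ absz n * Num.sqrt rho ^+ absz n)) =
  (K * Num.sqrt rho ^+ absz n) * ((absz n)%:R * Num.sqrt rho ^+ absz n) by ring.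
have -> : K / (1 - Num.sqrt rho) * Num.sqrt rho ^+ absz n =
  (K * Num.sqrt rho ^+ absz n) / (1 - Num.sqrt rho) by ring.
by apply: ler_wpM2l => //; exact: mulr_ge0.
Qed.

(** Sums over the windows [[-N, N)] telescope to [phi (- N) - phi N], and these windows are cofinal
    among finite subsets. *)
Lemma has_sum_tel1 (phi : int -> C) (d A B : C) :
  has_sum (fun n => phi n - phi (n + 1)) d ->
  (forall e : R, 0 < e -> exists N, forall n, (N <= n)%N -> cmod (phi (- n%:Z) - A) <= e) ->
  (forall e : R, 0 < e -> exists N, forall n, (N <= n)%N -> cmod (phi n%:Z - B) <= e) ->
  d = A - B.
Proof.
move=> hs hA hB.
apply/eqP; rewrite -subr_eq0; apply/eqP/cmod_small => e e0.
pose W N : seq int := [seq i%:Z - N%:Z | i <- index_iota 0 (N + N)].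
have uW N : uniq (W N).
  by rewrite map_inj_uniq ?iota_uniq // => i j /(can_inj (subrK _)) [].
have W_ex (i : int) : exists n0, forall n, (n0 <= n)%N -> i \in W n.
  exists (absz i).+1 => n hn; apply/mapP; exists (absz (i + n%:Z)).
    by rewrite mem_index_iota; lia.
  by lia.
have sW N : \sum_(i <- W N) (phi i - phi (i + 1)) = phi (- N%:Z) - phi N%:Z.
  rewrite big_map.
  have -> : \sum_(j <- index_iota 0 (N + N)) (phi (j%:Z - N%:Z) - phi (j%:Z - N%:Z + 1))
     = - \sum_(0 <= j < N + N) (phi (j.+1%:Z - N%:Z) - phi (j%:Z - N%:Z)).
    rewrite -sumrN; apply: eq_bigr => j _; rewrite opprB.
    by congr (_ - phi _); lia.
  rewrite telescope_sumr // opprB; congr (phi _ - phi _); lia.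
have [N1 h1] := has_sum_seqlim hs uW W_ex (e := e / 3) ltac:(lra).
have [N2 h2] := hA (e / 3) ltac:(lra); have [N3 h3] := hB (e / 3) ltac:(lra).
pose N := maxn N1 (maxn N2 N3).
have {}h1 := h1 N ltac:(by rewrite /N; lia).
have {}h2 := h2 N ltac:(by rewrite /N; lia).
have {}h3 := h3 N ltac:(by rewrite /N; lia).
rewrite sW in h1.
have -> : d - (A - B) = - (phi (- N%:Z) - phi N%:Z - d) + (phi (- N%:Z) - A) - (phi N%:Z - B) by ring.
apply: le_trans (cmodD _ _) _; rewrite cmodN.
by apply: le_trans (lerD (cmodD _ _) (lexx _)) _; rewrite cmodN; lra.
Qed.

Lemma has_sum_shift (a : int -> C) s k : has_sum a s -> has_sum (fun n => a (n + k)) s.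
Proof.
by apply: (@has_sum_bij R int int (fun n => n + k) (fun n => n - k)) => n; rewrite ?addrK ?subrK.
Qed.

Lemma has_sum_opp (a : int -> C) s : has_sum a s -> has_sum (fun n => a (- n)) s.
Proof. by apply: (@has_sum_bij R int int -%R -%R) => n; rewrite opprK. Qed.

(** A difference of step [k] is a sum of [k] shifted differences of step one, each with sum [d];
    negative steps are shifts of positive ones. *)
Lemma has_sum_tel (phi : int -> C) (d : C) (k : int) :
  has_sum (fun n => phi n - phi (n + 1)) d ->
  has_sum (fun n => phi n - phi (n + k)) (k%:~R * d).
Proof.
move=> h.
have hn (m : nat) : has_sum (fun n => phi n - phi (n + m%:Z)) (m%:R * d).
  elim: m => [|m IH].
    by rewrite mul0r; apply: eq_has_sum (@has_sum0 R int) => n; rewrite addr0 subrr.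
  rewrite -natr1 mulrDl mul1r; apply: eq_has_sum (has_sumD IH (has_sum_shift m%:Z h)) => n.
  by rewrite addrA subrK; congr (_ - phi _); lia.
case: k => m; first by rewrite -pmulrn; exact: hn.
rewrite NegzE mulrNz -pmulrn mulNr.
apply: eq_has_sum (has_sumN (has_sum_shift (- m.+1%:Z) (hn m.+1))) => n.
by rewrite opprB subrK.
Qed.

End IntSums.

(** * Series in the nome *)

Section Elementary.
Variable F : fieldType.
Implicit Types x y : F.

Definition ff x := x / (1 - x) ^+ 2.
Definition gg y := y / (1 - y ^+ 2).
(** The simple pole serving as primitive in the telescoping sums: for [|q| < 1] and [x] nonzero,
    [pp (x * q ^ n)] tends to 0 as [n] goes to minus infinity and to 1 as [n] goes to plus
    infinity. *)
Definition pp x := (1 - x)^-1.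
(* gx y = (y / 2) gg'(y). *)
Definition gx y := y * (1 + y ^+ 2) / (2 * (1 - y ^+ 2) ^+ 2).

Lemma ffV x : ff x^-1 = ff x.
Proof.
rewrite /ff; have [->|x0] := eqVneq x 0; first by rewrite invr0.
have [->|x1] := eqVneq x 1; first by rewrite invr1.
have h1 : 1 - x != 0 by rewrite subr_eq0 eq_sym.
have h2 : x - 1 != 0 by rewrite subr_eq0.
by field; rewrite x0 h1 h2.
Qed.

Lemma ggV y : gg y^-1 = - gg y.
Proof.
rewrite /gg; have [->|x0] := eqVneq y 0; first by rewrite invr0 mul0r oppr0.
have [e|x1] := eqVneq (y ^+ 2) 1.
  by rewrite exprVn e invr1 subrr invr0 !mulr0 oppr0.
have h1 : 1 - y ^+ 2 != 0 by rewrite subr_eq0 eq_sym.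
have h2 : y ^+ 2 - 1 != 0 by rewrite subr_eq0.
by field; rewrite x0 h1 h2.
Qed.

Lemma ggN y : gg (- y) = - gg y.
Proof. by rewrite /gg sqrrN mulNr. Qed.

Lemma gg_sqr y : gg y ^+ 2 = ff (y ^+ 2).
Proof. by rewrite /gg /ff expr_div_n. Qed.

Lemma ffD x : x != 1 -> x != -1 -> ff x + ff (- x) = 4 * ff (x ^+ 2).
Proof.
move=> h1 h2; rewrite /ff.
have d1 : 1 - x != 0 by rewrite subr_eq0 eq_sym.
have d2 : 1 + x != 0 by rewrite addrC addr_eq0.
have d3 : 1 - x ^+ 2 != 0.
  by rewrite (_ : _ - _ = (1 - x) * (1 + x)); [rewrite mulf_neq0 | ring].
by field; rewrite opprK d1 d2 d3.
Qed.

(** With [y] replaced by [y r^n] and [rho = r^k], the product of two terms of the g-sum becomes a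
    difference of step [k], which telescopes in [n]. *)
Lemma gg_mul y rho : y ^+ 2 != 1 -> (rho * y) ^+ 2 != 1 -> rho ^+ 2 != 1 ->
  gg y * gg (rho * y) = gg rho * (pp (y ^+ 2) - pp ((rho * y) ^+ 2)).
Proof.
move=> h1 h2 h3; rewrite /gg /pp.
have d1 : 1 - y ^+ 2 != 0 by rewrite subr_eq0 eq_sym.
have d2 : 1 - (rho * y) ^+ 2 != 0 by rewrite subr_eq0 eq_sym.
have d3 : 1 - rho ^+ 2 != 0 by rewrite subr_eq0 eq_sym.
by field; rewrite d1 d2 d3 ?h0.
Qed.

(** Companion of [gg_mul] for the derivative [gx]. It is summed in [sg_theta] with [y = i r^n] and
    [rho = t r^(m-n)], so that [rho y] depends on [m] alone. *)
Lemma gx_mul y rho : (2 : F) != 0 -> y ^+ 2 != 1 -> (rho * y) ^+ 2 != 1 -> rho ^+ 2 != 1 ->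
  gx y * (pp ((rho * y) ^+ 2) - pp (rho ^+ 2)) =
  - (gg y * ff ((rho * y) ^+ 2)) - gg rho * gx (rho * y).
Proof.
move=> h0 h1 h2 h3; rewrite /gg /pp /gx /ff.
have d1 : 1 - y ^+ 2 != 0 by rewrite subr_eq0 eq_sym.
have d2 : 1 - (rho * y) ^+ 2 != 0 by rewrite subr_eq0 eq_sym.
have d3 : 1 - rho ^+ 2 != 0 by rewrite subr_eq0 eq_sym.
by field; rewrite d1 d2 d3 ?h0.
Qed.

Lemma pp_opp z : z != 1 -> z != -1 -> pp (- z) - pp z = - 2 * gg z.
Proof.
move=> h1 h2; rewrite /pp /gg.
have d1 : 1 - z != 0 by rewrite subr_eq0 eq_sym.
have d2 : 1 + z != 0 by rewrite addrC addr_eq0.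
have d3 : 1 - z ^+ 2 != 0.
  by rewrite (_ : _ - _ = (1 - z) * (1 + z)); [rewrite mulf_neq0 | ring].
by field; rewrite ?opprK d1 d2 d3.
Qed.

End Elementary.

Section QSums.
Variable R : realType.
Local Notation C := R[i].
Implicit Types q r x y z t : C.

(** No term [x q^n] meets the pole 1 of [ff]; for [x = ex (z / (2 w1))] this says that [z] is off
    the period lattice. *)
Definition regular q x : Prop := forall n : int, x * q ^ n != 1.

Lemma cmodXz z (n : int) : cmod (z ^ n) = cmod z ^ n.
Proof. by case: n => n; rewrite ?NegzE -?exprnN ?cmodV cmodX. Qed.

Lemma two_neq0 : (2 : C) != 0. Proof. by rewrite pnatr_eq0. Qed.

Section Nome.
Variable q : C.
Hypotheses (q0 : q != 0) (q1 : cmod q < 1).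

Let a (n : int) : R := cmod q ^ n.

Let rho0 : 0 < cmod q. Proof. by rewrite cmod_gt0. Qed.
Let a_gt0 n : 0 < a n. Proof. by rewrite /a exprz_gt0. Qed.
Let cE n : cmod (q ^ n) = a n. Proof. exact: cmodXz. Qed.
Let a_nat (n : nat) : a n%:Z = cmod q ^+ n. Proof. by []. Qed.
Let a_opp n : a (- n) = (a n)^-1. Proof. by rewrite /a -invr_expz. Qed.

(** [a / (1 + a)^2] is invariant under [a -> 1 / a], so it decays geometrically in [|n|] at both
    ends. *)
Lemma nome_geo_le n : a n / (1 + a n) ^+ 2 <= cmod q ^+ absz n.
Proof.
have h := a_gt0 n; have h1 : 0 < (1 + a n) ^+ 2 by rewrite exprn_gt0 //; lra.
rewrite ler_pdivrMr //.
have [n0|n0] := leP 0 n.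
  have -> : cmod q ^+ absz n = a n by rewrite -a_nat; congr a; lia.
  by nra.
have -> : cmod q ^+ absz n = (a n)^-1 by rewrite -a_opp -a_nat; congr a; lia.
rewrite mulrC ler_pdivlMr //; nra.
Qed.

Lemma nome_eq1 n : cmod (q ^ n) = 1 -> n = 0.
Proof.
rewrite cE /a => h; apply/eqP; case: n h => n.
  rewrite -exprnP => h; case: n h => // n h.
  have : cmod q ^+ n.+1 < 1 by rewrite exprn_ilt1 // ltW.
  by rewrite h ltxx.
rewrite NegzE -exprnN => h.
have : cmod q ^+ n.+1 < 1 by rewrite exprn_ilt1 // ltW.
by rewrite -[_ ^+ _]invrK h invr1 ltxx.
Qed.

Lemma finite_lower_bound (I : eqType) (s : seq I) (h : I -> R) :
  (forall i, 0 < h i) -> exists2 c : R, 0 < c & forall i, i \in s -> c <= h i.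
Proof.
move=> h0; elim: s => [|i s [c c0 hc]]; first by exists 1.
exists (Num.min c (h i)); first by rewrite lt_min c0 h0.
move=> j; rewrite inE ge_min => /orP[/eqP ->|/hc ->] //; by rewrite lexx orbT.
Qed.

(** For large positive [n] the term 1 dominates, for large negative [n] the term [x q^n] does; the
    finitely many remaining [n] have a positive minimum by regularity. The factor [1 + a n] lets one
    bound serve both ends. *)
Lemma nome_lower_bound x : x != 0 -> regular q x ->
  exists2 c : R, 0 < c & forall n : int, c * (1 + a n) <= cmod (1 - x * q ^ n).
Proof.
move=> x0 hx.
have X0 : 0 < cmod x by rewrite cmod_gt0.
have hq : 0 <= cmod q < 1 by rewrite ltW //=.
have [N1 h1] := @geo_small R (cmod q) (cmod x) 2^-1 hq ltac:(lra).
have [N2 h2] := @geo_small R (cmod q) 1 (Num.min 2^-1 (cmod x / 2)) hq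
  ltac:(by rewrite lt_min; apply/andP; split; lra).
pose N := maxn N1 N2.
have hpos n : 0 < cmod (1 - x * q ^ n) / (1 + a n).
  apply: divr_gt0; last by have := a_gt0 n; lra.
  by rewrite cmod_gt0 subr_eq0 eq_sym hx.
have [c1 c10 hc1] := finite_lower_bound
  ([seq i%:Z | i <- iota 0 N] ++ [seq - i%:Z | i <- iota 0 N]) hpos.
exists (Num.min c1 (Num.min 4^-1 (cmod x / 4))).
  by rewrite !lt_min c10 /=; apply/andP; split; lra.
move=> n; have an := a_gt0 n.
set c := Num.min _ _.
have [cc1 cc2 cc3] : [/\ c <= c1, c <= 4^-1 & c <= cmod x / 4].
  by split; rewrite /c !ge_min ?lexx ?orbT.
have [nN|nN] := ltnP (absz n) N.
  apply: (@le_trans _ _ (c1 * (1 + a n))); first by apply: ler_wpM2r => //; lra.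
  rewrite -ler_pdivlMr; last lra.
  apply: hc1; rewrite mem_cat; apply/orP.
  have [n0|n0] := leP 0 n.
    by left; apply/mapP; exists (absz n); rewrite ?mem_iota //; move: nN n0; clear; lia.
  by right; apply/mapP; exists (absz n); rewrite ?mem_iota //; move: nN n0; clear; lia.
have {h1 h2} [h1 h2] : cmod x * cmod q ^+ absz n <= 2^-1 /\
    1 * cmod q ^+ absz n <= Num.min 2^-1 (cmod x / 2).
  by split; [apply: h1 | apply: h2]; move: nN; rewrite /N; clear; lia.
rewrite le_min mul1r in h2; case/andP: h2 => h2 h3.
have [n0|n0] := leP 0 n.
  have E : a n = cmod q ^+ absz n by rewrite -{1}(gez0_abs n0) a_nat.
  rewrite -E in h1 h2 h3.
  have := cmodB 1 (x * q ^ n); rewrite cmod1 cmodM cE; nra.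
have E : a n = (cmod q ^+ absz n)^-1.
  by rewrite -a_nat -a_opp; congr a; move: n0; clear; lia.
have E' : cmod q ^+ absz n = (a n)^-1 by rewrite E invrK.
rewrite E' in h1 h2 h3.
have h4 : 2 <= a n by rewrite -[a n]invrK -[2]invrK lef_pV2 ?posrE ?invr_gt0 //; lra.
have h5 : 2 <= cmod x * a n.
  by rewrite -(ler_pM2r an) mulVf ?gt_eqF // in h3; lra.
have := cmodB (x * q ^ n) 1; rewrite cmod1 cmodM cE cmodC; nra.
Qed.

End Nome.
End QSums.

Section QSums2.
Variable R : realType.
Local Notation C := R[i].
Implicit Types q r x y z t : C.

Lemma sqrXz r (n : int) : (r ^ n) ^+ 2 = (r ^+ 2) ^ n.
Proof. by rewrite exprnP exprzAC. Qed.

Lemma sqrMXz y r (n : int) : (y * r ^ n) ^+ 2 = y ^+ 2 * (r ^+ 2) ^ n.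
Proof. by rewrite exprMn sqrXz. Qed.

Definition fsum q x := tsum (fun n : int => ff (x * q ^ n)).
Definition gsum r y := tsum (fun n : int => gg (y * r ^ n)).

Lemma fsumP q x s : has_sum (fun n : int => ff (x * q ^ n)) s -> fsum q x = s.
Proof. exact: tsumP. Qed.
Lemma gsumP r y s : has_sum (fun n : int => gg (y * r ^ n)) s -> gsum r y = s.
Proof. exact: tsumP. Qed.

Lemma gsumN r y : gsum r (- y) = - gsum r y.
Proof.
rewrite /gsum; case: (pselect (exists s, has_sum (fun n : int => gg (y * r ^ n)) s)) => [[s hs]|h].
  rewrite (tsumP hs); apply: tsumP; apply: eq_has_sum (has_sumN hs) => n.
  by rewrite mulNr ggN.
rewrite /tsum; case: xgetP => [s _ hs|_].
  by case: h; exists (- s); apply: eq_has_sum (has_sumN hs) => n; rewrite mulNr ggN opprK.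
by case: xgetP => [s _ hs|_]; [case: h; exists s | rewrite oppr0].
Qed.

Lemma geob_ff q x : q != 0 -> cmod q < 1 -> x != 0 -> regular q x ->
  geob (fun n : int => ff (x * q ^ n)).
Proof.
move=> q0 q1 x0 /(nome_lower_bound q0 q1 x0) [c c0 hc].
exists (cmod q), (cmod x / c ^+ 2); rewrite cmod_gt0 q0; split => // n.
have a0 : 0 < cmod q ^ n by rewrite exprz_gt0 // cmod_gt0.
have := nome_geo_le q0 q1 n; have := hc n.
set a := cmod q ^ n in a0 *; set d := cmod (1 - _) => h1 h2.
rewrite /ff cmodM cmodV cmodX cmodM cmodXz -/a -/d.
have d0 : 0 < d by nra.
apply: le_trans (ler_wpM2l _ h2); last by rewrite divr_ge0 ?cmod_ge0 ?exprn_ge0 // ltW.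
have -> : cmod x / c ^+ 2 * (a / (1 + a) ^+ 2) = cmod x * a / (c * (1 + a)) ^+ 2.
  by field; rewrite !gt_eqF //; lra.
apply: ler_wpM2l; first by rewrite mulr_ge0 ?cmod_ge0 // ltW.
have h3 : 0 < c * (1 + a) by nra.
by rewrite lef_pV2 ?posrE ?exprn_gt0 // lerXn2r // nnegrE ltW.
Qed.

Lemma has_fsum q x : q != 0 -> cmod q < 1 -> x != 0 -> regular q x ->
  has_sum (fun n : int => ff (x * q ^ n)) (fsum q x).
Proof. by move=> *; apply/has_tsum/geob_summable/geob_ff. Qed.

Lemma nome_sqr r : r != 0 -> cmod r < 1 -> r ^+ 2 != 0 /\ cmod (r ^+ 2) < 1.
Proof. by move=> r0 r1; rewrite expf_neq0 // cmodX exprn_ilt1 // cmod_ge0. Qed.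

Lemma geob_gg r y : r != 0 -> cmod r < 1 -> y != 0 -> regular (r ^+ 2) (y ^+ 2) ->
  geob (fun n : int => gg (y * r ^ n)).
Proof.
move=> r0 r1 y0 hy; have [q0 q1] := nome_sqr r0 r1.
have [c c0 hc] := nome_lower_bound q0 q1 (expf_neq0 2 y0) hy.
exists (cmod r), (2 * cmod y / c); rewrite cmod_gt0 r0; split => // n.
have a0 : 0 < cmod r ^ n by rewrite exprz_gt0 // cmod_gt0.
have := nome_geo_le r0 r1 n; have := hc n.
have -> : cmod (r ^+ 2) ^ n = (cmod r ^ n) ^+ 2.
  by rewrite -cmodXz -sqrXz cmodX cmodXz.
set a := cmod r ^ n in a0 *; set d := cmod (1 - _) => h1 h2.
rewrite /gg sqrMXz cmodM cmodV cmodM cmodXz -/a -/d.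
have d0 : 0 < d by nra.
apply: le_trans (ler_wpM2l _ h2); last by rewrite divr_ge0 ?mulr_ge0 ?cmod_ge0 // ltW.
have -> : 2 * cmod y / c * (a / (1 + a) ^+ 2) = cmod y * a * (2 / (c * (1 + a) ^+ 2)).
  by field; rewrite !gt_eqF //; lra.
apply: ler_wpM2l; first by rewrite mulr_ge0 ?cmod_ge0 // ltW.
rewrite ler_pdivlMr; last by rewrite mulr_gt0 ?exprn_gt0 //; lra.
rewrite mulrC ler_pdivrMr //.
have : (1 + a) ^+ 2 <= 2 * (1 + a ^+ 2) by have := sqr_ge0 (1 - a); nra.
by nra.
Qed.

Lemma has_gsum r y : r != 0 -> cmod r < 1 -> y != 0 -> regular (r ^+ 2) (y ^+ 2) ->
  has_sum (fun n : int => gg (y * r ^ n)) (gsum r y).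
Proof. by move=> *; apply/has_tsum/geob_summable/geob_gg. Qed.

Lemma geob_gx r y : r != 0 -> cmod r < 1 -> y != 0 -> regular (r ^+ 2) (y ^+ 2) ->
  geob (fun n : int => gx (y * r ^ n)).
Proof.
move=> r0 r1 y0 hy; have [q0 q1] := nome_sqr r0 r1.
have [c c0 hc] := nome_lower_bound q0 q1 (expf_neq0 2 y0) hy.
pose k := 1 + cmod y ^+ 2.
have k0 : 0 < k by rewrite /k; have := sqr_ge0 (cmod y); lra.
exists (cmod r), (cmod y * k / c ^+ 2); rewrite cmod_gt0 r0; split => // n.
have a0 : 0 < cmod r ^ n by rewrite exprz_gt0 // cmod_gt0.
have := nome_geo_le r0 r1 n; have := hc n.
have -> : cmod (r ^+ 2) ^ n = (cmod r ^ n) ^+ 2.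
  by rewrite -cmodXz -sqrXz cmodX cmodXz.
set a := cmod r ^ n in a0 *; set d := cmod (1 - _) => h1 h2.
have E2 : cmod (1 + (y * r ^ n) ^+ 2) <= k * (1 + a ^+ 2).
  apply: le_trans (cmodD _ _) _; rewrite cmod1 cmodX cmodM cmodXz -/a /k exprMn.
  by have := sqr_ge0 (cmod y); have := sqr_ge0 a; nra.
rewrite /gx cmodM cmodV (cmodM 2) cmodX (cmodM (y * _)) (cmodM y) sqrMXz -/d cmodXz -/a cmod_nat.
rewrite sqrMXz in E2; set u := cmod (1 + _) in E2 *.
have d0 : 0 < d by nra.
apply: le_trans (ler_wpM2l _ h2); last by rewrite divr_ge0 ?mulr_ge0 ?exprn_ge0 ?cmod_ge0 // ltW.
have u0 : 0 <= u by exact: cmod_ge0.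
have -> : cmod y * k / c ^+ 2 * (a / (1 + a) ^+ 2) = cmod y * a * (k / (c ^+ 2 * (1 + a) ^+ 2)).
  by field; rewrite !gt_eqF //; lra.
rewrite -mulrA; apply: ler_wpM2l; first by rewrite mulr_ge0 ?cmod_ge0 // ltW.
rewrite ler_pdivlMr; last by rewrite mulr_gt0 ?exprn_gt0 //; lra.
rewrite mulrAC ler_pdivrMr; last by rewrite mulr_gt0 ?exprn_gt0.
have h3 : (1 + a) ^+ 2 <= 2 * (1 + a ^+ 2) by have := sqr_ge0 (1 - a); nra.
have h4 : (c * (1 + a ^+ 2)) ^+ 2 <= d ^+ 2.
  by rewrite lerXn2r // nnegrE ?ltW //; have := sqr_ge0 a; nra.
have h5 : 0 < 1 + a ^+ 2 by have := sqr_ge0 a; lra.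
apply: (@le_trans _ _ (k * (1 + a ^+ 2) * (c ^+ 2 * (2 * (1 + a ^+ 2))))).
  apply: ler_pM => //; first by rewrite mulr_ge0 ?exprn_ge0 //; lra.
  by apply: ler_wpM2l => //; rewrite exprn_ge0 // ltW.
have -> : k * (1 + a ^+ 2) * (c ^+ 2 * (2 * (1 + a ^+ 2))) = k * (2 * (c * (1 + a ^+ 2)) ^+ 2) by ring.
by apply: ler_wpM2l; [exact: ltW | lra].
Qed.

Lemma has_sum_pp q x : q != 0 -> cmod q < 1 -> x != 0 -> regular q x ->
  has_sum (fun n : int => pp (x * q ^ n) - pp (x * q ^ (n + 1))) (-1).
Proof.
move=> q0 q1 x0 hx; have [c c0 hc] := nome_lower_bound q0 q1 x0 hx.
have q0' : 0 < cmod q by rewrite cmod_gt0.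
have sm : summable (fun n : int => pp (x * q ^ n) - pp (x * q ^ (n + 1))).
  apply: geob_summable; exists (cmod q), (cmod (1 - q) * cmod x / (c ^+ 2 * cmod q)).
  rewrite q0'; split => // n.
  have a0 : 0 < cmod q ^ n by rewrite exprz_gt0.
  have := nome_geo_le q0 q1 n; have := hc n; have := hc (n + 1).
  rewrite !(expfzDr _ _ q0) (expfzDr _ _ (negbT (gt_eqF q0'))) !expr1z.
  have -> : pp (x * q ^ n) - pp (x * (q ^ n * q)) =
     (1 - q) * (x * q ^ n) / ((1 - x * q ^ n) * (1 - x * (q ^ n * q))).
    rewrite /pp; field.
    have := hx (n + 1); have := hx n; rewrite expfzDr // expr1z mulrA.
    by rewrite ![_ == 1]eq_sym -![1 == _]subr_eq0 => -> ->.
  rewrite !cmodM cmodV !cmodM cmodXz.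
  set a := cmod q ^ n in a0 *; set d := cmod (1 - x * q ^ n); set d' := cmod (1 - x * _).
  move=> h1 h2 h3.
  have d0 : 0 < d by nra.
  have d0' : 0 < d' by apply: lt_le_trans h1; rewrite mulr_gt0 // addr_gt0 ?mulr_gt0.
  apply: le_trans (ler_wpM2l _ h3); last first.
    by rewrite divr_ge0 ?mulr_ge0 ?exprn_ge0 ?cmod_ge0 // ltW.
  have -> : cmod (1 - q) * cmod x / (c ^+ 2 * cmod q) * (a / (1 + a) ^+ 2) =
     (cmod (1 - q) * (cmod x * a)) / ((c * (1 + a)) * (c * (cmod q * (1 + a)))).
    by field; rewrite !gt_eqF //; lra.
  apply: ler_wpM2l; first by rewrite !mulr_ge0 ?cmod_ge0 // ltW.
  have h4 : c * (cmod q * (1 + a)) <= d'.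
    by apply: le_trans h1; apply: ler_wpM2l; [exact: ltW | nra].
  have p1 : 0 < c * (1 + a) by nra.
  have p2 : 0 < c * (cmod q * (1 + a)) by rewrite !mulr_gt0 //; lra.
  rewrite lef_pV2 ?posrE; [|exact: mulr_gt0 ..].
  by apply: ler_pM => //; exact: ltW.
have [d hd] := summable_has_sum sm.
suff -> : -1 = d by [].
rewrite -[-1]add0r; symmetry.
have hq : 0 <= cmod q < 1 by rewrite ltW.
apply: (has_sum_tel1 hd) => e e0.
  have [N hN] := geo_small c^-1 hq e0.
  exists N => n /hN; apply: le_trans; rewrite subr0 /pp cmodV.
  have := hc (- n%:Z); rewrite -invr_expz -exprnP => h.
  have u0 : 0 < cmod q ^+ n by rewrite exprn_gt0.
  rewrite -[cmod q ^+ n]invrK -invfM lef_pV2 ?posrE.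
  - by apply: le_trans h; apply: ler_wpM2l; [exact: ltW | lra].
  - apply: lt_le_trans h; rewrite mulr_gt0 // addr_gt0 // invr_gt0 //.
  - by rewrite mulr_gt0 // invr_gt0.
have [N hN] := geo_small (cmod x / c) hq e0.
exists N => n /hN; apply: le_trans.
have h := hc n%:Z; have u0 : 0 < cmod q ^+ n by rewrite exprn_gt0.
rewrite -exprnP in h.
have d0 : 0 < cmod (1 - x * q ^+ n) by apply: lt_le_trans h; nra.
have -> : pp (x * q ^ n%:Z) - 1 = x * q ^+ n / (1 - x * q ^+ n).
  rewrite /pp -exprnP; field; by rewrite -cmod_gt0.
rewrite !cmodM cmodV cmodX mulrAC; apply: ler_wpM2r; first exact: ltW.
apply: ler_wpM2l; first exact: cmod_ge0.
by rewrite lef_pV2 ?posrE //; nra.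
Qed.

Lemma has_sum_pp_tel q x (k : int) : q != 0 -> cmod q < 1 -> x != 0 -> regular q x ->
  has_sum (fun n : int => pp (x * q ^ n) - pp (x * q ^ (n + k))) (- k%:~R).
Proof.
by move=> *; rewrite -mulrN1; apply: (@has_sum_tel R (fun n => pp (x * q ^ n))); exact: has_sum_pp.
Qed.

(* gg Y * gg (rho Y) splits into simple fractions, so that the products of the
   terms n and n + k of the g-sum telescope in n; the part of the square left
   over depends on r alone. *)
Lemma gsum_sqr_const r : r != 0 -> cmod r < 1 ->
  exists c, forall y, y != 0 -> regular (r ^+ 2) (y ^+ 2) ->
    gsum r y ^+ 2 = fsum (r ^+ 2) (y ^+ 2) - c.
Proof.
move=> r0 r1; exists (tsum (fun k : int => k%:~R * gg (r ^ k))) => y y0 hy.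
have [q0 q1] := nome_sqr r0 r1.
have sg := geob_summable (geob_gg r0 r1 y0 hy).
have hg := has_gsum r0 r1 y0 hy.
have hf := has_fsum q0 q1 (expf_neq0 2 y0) hy.
have h2 := has_sumM sg sg hg hg.
(* The index pair [(n, n + k)] is now read as column [n] of row [k]. *)
have {}h2 : has_sum (fun p : int * int => gg (y * r ^ p.2) * gg (y * r ^ (p.2 + p.1)))
    (gsum r y * gsum r y).
  apply: (@has_sum_bij R _ _ (fun p : int * int => (p.2, p.2 + p.1))
    (fun p : int * int => (p.2 - p.1, p.1))) h2 => -[n k] /=; congr pair; lia.
have rows (k : int) : has_sum (fun n => gg (y * r ^ n) * gg (y * r ^ (n + k)))
    (if k == 0 then fsum (r ^+ 2) (y ^+ 2) else - (k%:~R * gg (r ^ k))).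
  have [->|k0] := eqVneq k 0.
    apply: eq_has_sum hf => n; rewrite addr0 -expr2 gg_sqr sqrMXz //.
  have hpp := has_sum_pp_tel k q0 q1 (expf_neq0 2 y0) hy.
  rewrite mulrC -mulrN; apply: eq_has_sum (has_sumZ (gg (r ^ k)) hpp) => n.
  have -> : y * r ^ (n + k) = r ^ k * (y * r ^ n) by rewrite expfzDr //; ring.
  rewrite gg_mul ?sqrMXz ?hy //.
  - congr (_ * (_ - pp _)); rewrite exprMn sqrMXz.
    rewrite sqrXz.
    by rewrite expfzDr //; ring.
  - rewrite exprMn sqrMXz.
    rewrite sqrXz.
    by rewrite mulrCA -expfzDr // hy.
  - apply: contra k0 => /eqP h.
    have := congr1 (@cmod R) h; rewrite cmodX cmod1 => /eqP.
    by rewrite sqrp_eq1 ?cmod_ge0 // => /eqP /(nome_eq1 r0 r1) ->.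
have h3 := has_sum_fubini h2 rows.
(* Row [k = 0] is the f-sum; subtracting the rows from it shows that the family defining the
   constant has a sum, and identifies it. *)
have h4 := has_sumB (has_sum_point (0 : int) (fsum (r ^+ 2) (y ^+ 2))) h3.
rewrite -expr2 in h4.
have -> : tsum (fun k : int => k%:~R * gg (r ^ k)) = fsum (r ^+ 2) (y ^+ 2) - gsum r y ^+ 2.
  apply: tsumP; apply: eq_has_sum h4 => k /=.
  by case: eqP => [->|_]; rewrite ?mul0r ?subrr // sub0r opprK.
by ring.
Qed.

Lemma regular_opp_sqr q : q != 0 -> cmod q < 1 -> regular q (-1).
Proof.
move=> q0 q1 n; apply/eqP => h.
have := congr1 (@cmod R) h; rewrite cmodM cmodN cmod1 mul1r => /(nome_eq1 q0 q1) n0.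
move: h; rewrite n0 expr0z mulr1 => /eqP.
by rewrite -subr_eq0 -opprD oppr_eq0 -[1 + 1]/(2%:R) pnatr_eq0.
Qed.

Lemma regular_nome r x : r != 0 -> cmod r < 1 -> cmod x = 1 -> regular (r ^+ 2) (x * r).
Proof.
move=> r0 r1 x1 n; apply/eqP => h.
have := congr1 (@cmod R) h.
have -> : x * r * (r ^+ 2) ^ n = x * r ^ (2 * n + 1).
  by rewrite expfzDr // expr1z -exprz_exp; ring.
by rewrite cmodM x1 mul1r cmod1 => /(nome_eq1 r0 r1); lia.
Qed.

(** The reflection [n -> - 1 - n] sends [t r^n] to its inverse because [t^2 = r], and [gg] is odd
    under inversion; the sum equals its opposite. *)
Lemma gsum_half r t : r != 0 -> cmod r < 1 -> t ^+ 2 = r -> gsum r t = 0.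
Proof.
move=> r0 r1 ht.
have t0 : t != 0 by apply: contraNneq r0 => t0; rewrite -ht t0 expr0n.
have hreg : regular (r ^+ 2) (t ^+ 2).
  by rewrite ht -[X in regular _ X]mul1r; apply: regular_nome => //; rewrite cmod1.
have hg := has_gsum r0 r1 t0 hreg.
have h2 := has_sum_shift 1 (has_sum_opp hg).
have h3 : has_sum (fun n : int => - gg (t * r ^ n)) (gsum r t).
  apply: eq_has_sum (has_sum_bij (phi := fun n : int => - n) (psi := fun n : int => - n) _ _ (has_sum_shift (-1) hg)); [|exact: opprK|exact: opprK].
  move=> n /=; rewrite -ggV; congr gg.
  rewrite expfzDr // -invr_expz -[r ^ -1]invr_expz expr1z -[in r^-1]ht.
  by field; rewrite t0 expfz_neq0.
have := has_sum_unique h3 (has_sumN hg) => /eqP.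
rewrite -subr_eq0 opprK -mulr2n mulrn_eq0 /= => /eqP //.
Qed.

(** The constant of [gsum_sqr_const] is found by evaluation at the zero [t] of [gsum r]. *)
Lemma gsum_sqr r y : r != 0 -> cmod r < 1 -> y != 0 -> regular (r ^+ 2) (y ^+ 2) ->
  gsum r y ^+ 2 = fsum (r ^+ 2) (y ^+ 2) - fsum (r ^+ 2) r.
Proof.
move=> r0 r1 y0 hy; have [c hc] := gsum_sqr_const r0 r1.
rewrite hc //; congr (_ - _).
have [t ht] : exists t : C, t ^+ 2 = r by exists (sqrtC r); exact: sqrtCK.
have t0 : t != 0 by apply: contraNneq r0 => t0; rewrite -ht t0 expr0n.
have := hc t t0; rewrite ht gsum_half // expr0n /= => h.
apply/eqP; rewrite eq_sym -subr_eq0 -h //.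
by rewrite -[X in regular _ X]mul1r; apply: regular_nome => //; rewrite cmod1.
Qed.

End QSums2.
#[global] Opaque fsum gsum tsum.

(** * Duplication of the nome and the arithmetic-geometric mean *)

Section Landen.
Variable R : realType.
Local Notation C := R[i].
Local Notation I := ('i%C : C).
Implicit Types q r x y z t : C.

Lemma has_sum_even_odd (a : int -> C) s t :
  has_sum (fun n => a (2 * n)) s -> has_sum (fun n => a (2 * n + 1)) t ->
  has_sum a (s + t).
Proof.
move=> hs ht.
pose ae (n : int) := if odd (absz n) then 0 else a n.
pose ao (n : int) := if odd (absz n) then a n else 0.
have he : has_sum ae s.
  apply: (@has_sum_ext R int int (fun n => 2 * n)).
  - by move=> m n /= ?; lia.
  - move=> n hn; rewrite /ae; case: ifPn => // /negP h.
    by case: (hn (n %/ 2)%Z); lia.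
  - by apply: eq_has_sum hs => n; rewrite /= /ae; case: ifP => //; lia.
have ho : has_sum ao t.
  apply: (@has_sum_ext R int int (fun n => 2 * n + 1)).
  - by move=> m n /= ?; lia.
  - move=> n hn; rewrite /ao; case: ifPn => // h.
    by case: (hn (n %/ 2)%Z); lia.
  - by apply: eq_has_sum ht => n; rewrite /= /ao; case: ifPn => //; lia.
by apply: eq_has_sum (has_sumD he ho) => n; rewrite /ae /ao; case: ifP; rewrite ?addr0 ?add0r.
Qed.

Lemma regular_even r x : r != 0 -> regular r x -> regular (r ^+ 2) x.
Proof. by move=> r0 h n; rewrite exprnP exprz_exp. Qed.

Lemma regular_odd r x : r != 0 -> regular r x -> regular (r ^+ 2) (x * r).
Proof.
move=> r0 h n; have := h (2 * n + 1).
by rewrite expfzDr // expr1z -exprz_exp -exprnP mulrA mulrAC.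
Qed.

Lemma fsum_split r x : r != 0 -> cmod r < 1 -> x != 0 -> regular r x ->
  fsum r x = fsum (r ^+ 2) x + fsum (r ^+ 2) (x * r).
Proof.
move=> r0 r1 x0 hx; have [q0 q1] := nome_sqr r0 r1.
apply: fsumP; apply: has_sum_even_odd.
  apply: eq_has_sum (has_fsum q0 q1 x0 (regular_even r0 hx)) => n.
  by rewrite -exprz_exp -exprnP.
apply: eq_has_sum (has_fsum q0 q1 (mulf_neq0 x0 r0) (regular_odd r0 hx)) => n.
by rewrite expfzDr // expr1z -exprz_exp -exprnP mulrA mulrAC.
Qed.

Lemma gsum_split t y : t != 0 -> cmod t < 1 -> y != 0 -> regular (t ^+ 2) (y ^+ 2) ->
  gsum t y = gsum (t ^+ 2) y + gsum (t ^+ 2) (y * t).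
Proof.
move=> t0 t1 y0 hy; have [r0 r1] := nome_sqr t0 t1.
apply: gsumP; apply: has_sum_even_odd.
  apply: eq_has_sum (has_gsum r0 r1 y0 (regular_even r0 hy)) => n.
  by rewrite -exprz_exp -exprnP.
have hy' : regular ((t ^+ 2) ^+ 2) ((y * t) ^+ 2) by rewrite (exprMn 2 y t); exact: (regular_odd r0 hy).
apply: eq_has_sum (has_gsum r0 r1 (mulf_neq0 y0 t0) hy') => n.
by rewrite expfzDr // expr1z -exprz_exp -exprnP mulrA mulrAC.
Qed.

Lemma fsum_double q x : q != 0 -> cmod q < 1 -> x != 0 ->
  regular (q ^+ 2) (x ^+ 2) ->
  fsum q x + fsum q (- x) = 4 * fsum (q ^+ 2) (x ^+ 2).
Proof.
move=> q0 q1 x0 hx; have [p0 p1] := nome_sqr q0 q1.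
have h (e : C) : e ^+ 2 = 1 -> regular q (e * x).
  move=> he n; apply: contraNneq (hx n) => /(congr1 (fun z => z ^+ 2)).
  by rewrite sqrMXz exprMn he mul1r expr1n => ->.
have h1 : regular q x by rewrite -[x]mul1r; apply: h; rewrite expr1n.
have h2 : regular q (- x) by rewrite -mulN1r; apply: h; rewrite sqrrN expr1n.
apply: (@has_sum_unique R int (fun n => 4 * ff (x ^+ 2 * (q ^+ 2) ^ n))).
  apply: eq_has_sum (has_sumD (has_fsum q0 q1 x0 h1) (has_fsum q0 q1 _ h2)); last by rewrite oppr_eq0.
  move=> n; rewrite mulNr ffD ?h1 ?sqrMXz //.
  by have := h2 n; rewrite mulNr -(inj_eq oppr_inj) opprK.
by apply: has_sumZ; apply: has_fsum; rewrite ?expf_neq0.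
Qed.

(** The argument [r] is a square root of the lattice nome [r^2]: the translation [tau -> tau + 1]
    becomes [r -> - r] and exchanges [b2] and [b3]. *)
Definition b1 r := fsum (r ^+ 2) (-1).
Definition b2 r := fsum (r ^+ 2) r.
Definition b3 r := fsum (r ^+ 2) (- r).
Definition sg r := gsum r I.

Lemma I2 : I ^+ 2 = -1. Proof. exact: sqr_i. Qed.
Lemma I_neq0 : I != 0.
Proof. by apply/eqP => h; have := I2; rewrite h expr0n => /eqP; rewrite eq_sym oppr_eq0 oner_eq0. Qed.

Lemma b1E r : b1 r = fsum (r ^+ 2) (-1). Proof. by []. Qed.
Lemma b2E r : b2 r = fsum (r ^+ 2) r. Proof. by []. Qed.
Lemma b3E r : b3 r = fsum (r ^+ 2) (- r). Proof. by []. Qed.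
Lemma sgE r : sg r = gsum r I. Proof. by []. Qed.

Lemma b1N r : b1 (- r) = b1 r. Proof. by rewrite /b1 sqrrN. Qed.
Lemma b2N r : b2 (- r) = b3 r. Proof. by rewrite /b2 /b3 sqrrN. Qed.
Lemma b3N r : b3 (- r) = b2 r. Proof. by rewrite /b2 /b3 sqrrN opprK. Qed.

Section Nome.
Variable r : C.
Hypotheses (r0 : r != 0) (r1 : cmod r < 1).

Let q0 : r ^+ 2 != 0. Proof. by case: (nome_sqr r0 r1). Qed.
Let q1 : cmod (r ^+ 2) < 1. Proof. by case: (nome_sqr r0 r1). Qed.

Lemma sg_sqr : sg r ^+ 2 = b1 r - b2 r.
Proof.
by rewrite /sg gsum_sqr ?I_neq0 ?I2 //; exact: regular_opp_sqr.
Qed.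

Lemma sgN_sqr : sg (- r) ^+ 2 = b1 r - b3 r.
Proof.
rewrite -b2N -b1N /sg gsum_sqr ?I_neq0 ?I2 ?oppr_eq0 ?cmodN //.
by rewrite sqrrN; exact: regular_opp_sqr.
Qed.

Let regr : regular (r ^+ 2) r.
Proof. by rewrite -[X in regular _ X]mul1r; apply: regular_nome => //; rewrite cmod1. Qed.
Let regNr : regular (r ^+ 2) (- r).
Proof. by rewrite -[X in regular _ X]mulN1r; apply: regular_nome => //; rewrite cmodN cmod1. Qed.

(** By parity the g-sum of nome [t] is [gsum r y + gsum r (y t)]. Squaring this relation and
    applying [gsum_sqr] for the nomes [t] and [r] gives the cross term, in which [y] cancels by
    [fsum_split]. *)
Lemma gsum_half_const : exists K, (forall t y, t ^+ 2 = r -> y != 0 -> regular r (y ^+ 2) ->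
    gsum r y * gsum r (y * t) = K t) /\
  forall t, t ^+ 2 = r -> K t ^+ 2 = (b2 r - b1 r) * (b2 r - b3 r).
Proof.
exists (fun t => (2 * b2 r - b2 t) / 2).
have main t y : t ^+ 2 = r -> y != 0 -> regular r (y ^+ 2) ->
    gsum r y * gsum r (y * t) = (2 * b2 r - b2 t) / 2.
  move=> ht y0 hy.
  have t0 : t != 0 by apply: contraNneq r0 => t0; rewrite -ht t0 expr0n.
  have t1 : cmod t < 1.
    by rewrite ltNge; apply/negP => h; move: r1; rewrite -ht cmodX ltNge exprn_ege1.
  have hy' : regular (t ^+ 2) (y ^+ 2) by rewrite ht.
  have hyt : regular (r ^+ 2) ((y * t) ^+ 2) by rewrite (exprMn 2 y t) ht; exact: (regular_odd r0 hy).
  have e1 := gsum_split t0 t1 y0 hy'.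
  have e2 := gsum_sqr t0 t1 y0 hy'.
  have e3 := gsum_sqr r0 r1 y0 (regular_even r0 hy).
  have e4 := gsum_sqr r0 r1 (mulf_neq0 y0 t0) hyt.
  have e5 := fsum_split r0 r1 (expf_neq0 2 y0) hy.
  rewrite e1 ht in e2; rewrite (exprMn 2 y t) ht in e4.
  have E : 2 * (gsum r y * gsum r (y * t)) = 2 * b2 r - b2 t.
    rewrite /b2 ht; move: e2 e3 e4 e5.
    move: (gsum r y) (gsum r (y * t)) (fsum _ (y ^+ 2)) => A B f1.
    move: (fsum _ (y ^+ 2)) (fsum _ (y ^+ 2 * r)) (fsum _ r) (fsum r t) => f2 f3 f4 f5 e2 e3 e4 e5.
    have -> : 2 * (A * B) = (A + B) ^+ 2 - A ^+ 2 - B ^+ 2 by ring.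
    by rewrite e2 e3 e4 e5; ring.
  by rewrite -E mulrAC divff ?mul1r // two_neq0.
split=> // t ht.
(* Evaluation at [y = i] gives the square of the constant: [gsum r i] and [gsum r (i t)] have
   squares [b1 - b2] and [b3 - b2]. *)
have hI : regular r (I ^+ 2) by rewrite I2; exact: regular_opp_sqr.
have t0 : t != 0 by apply: contraNneq r0 => t0; rewrite -ht t0 expr0n.
have It0 : I * t != 0 by rewrite mulf_neq0 ?I_neq0.
have hIt : regular (r ^+ 2) ((I * t) ^+ 2) by rewrite (exprMn 2 I t) I2 ht mulN1r.
have s1 := gsum_sqr r0 r1 I_neq0 (regular_even r0 hI).
have s2 := gsum_sqr r0 r1 It0 hIt.
rewrite (exprMn 2 I t) I2 ht mulN1r in s2; rewrite I2 in s1.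
transitivity ((gsum r I * gsum r (I * t)) ^+ 2); first by apply: (congr1 (fun z => z ^+ 2)); symmetry; exact: (main t I ht I_neq0 hI).
rewrite (exprMn 2 (gsum r I)) s1 s2 -/(b1 r) -/(b2 r) -/(b3 r).
by move: (b1 r) (b2 r) (b3 r) => u v w; ring.
Qed.

(** Arithmetic step of the mean: the even-indexed parts at [r] and [- r] coincide, the odd-indexed
    parts are opposite. *)
Lemma sg_arith : sg r + sg (- r) = 2 * sg (r ^+ 2).
Proof.
have h : regular (r ^+ 2) (I ^+ 2) by rewrite I2; exact: regular_opp_sqr.
have Nr0 : - r != 0 by rewrite oppr_eq0.
have Nr1 : cmod (- r) < 1 by rewrite cmodN.
have h' : regular ((- r) ^+ 2) (I ^+ 2) by rewrite sqrrN.
rewrite /sg (gsum_split r0 r1 I_neq0 h) (gsum_split Nr0 Nr1 I_neq0 h').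
by rewrite sqrrN mulrN gsumN; ring.
Qed.

Lemma b2_double : 4 * b2 (r ^+ 2) = b2 r + b3 r.
Proof.
rewrite /b3 /b2; symmetry; apply: (fsum_double q0 q1 r0).
rewrite -[X in regular _ X]mul1r; apply: regular_nome => //; by rewrite cmod1.
Qed.

Lemma b1_double : b1 r = b1 (r ^+ 2) + b3 (r ^+ 2).
Proof.
rewrite /b1 /b3 (fsum_split q0 q1) ?mulN1r ?oppr_eq0 ?oner_eq0 //.
exact: regular_opp_sqr.
Qed.

End Nome.

(** Geometric step: twice the product is the square of the sum minus both squares, all known through
    [b1], [b2], [b3] and their duplication formulas. In theta constants it reads
    [theta_3(r) theta_4(r) = theta_4(r^2)^2], up to squaring. *)
Lemma sg_geom r : r != 0 -> cmod r < 1 -> sg r * sg (- r) = sg (- r ^+ 2) ^+ 2.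
Proof.
move=> r0 r1; have [q0 q1] := nome_sqr r0 r1.
apply: (mulfI (two_neq0 R)).
have e1 := sg_arith r0 r1; have e2 := sg_sqr r0 r1; have e3 := sgN_sqr r0 r1.
have e4 := sg_sqr q0 q1; have e5 := sgN_sqr q0 q1.
have e6 := b2_double r0 r1; have e7 := b1_double r0 r1.
move: e1 e2 e3 e4 e5 e6 e7.
move: (sg r) (sg (- r)) (sg (r ^+ 2)) (sg (- r ^+ 2)) => s3 s2 s3' s2'.
move: (b1 r) (b2 r) (b3 r) (b1 (r ^+ 2)) (b2 (r ^+ 2)) (b3 (r ^+ 2)).
move=> c1 c2 c3 c1' c2' c3' e1 e2 e3 e4 -> e6 e7.
have -> : 2 * (s3 * s2) = (s3 + s2) ^+ 2 - s3 ^+ 2 - s2 ^+ 2 by ring.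
rewrite e1 e2 e3 exprMn e4.
have -> : 2 ^+ 2 * (c1' - c2') = 4 * c1' - 4 * c2' by ring.
by rewrite e6 e7; ring.
Qed.

(* The telescoping of gx Y * (pp (rho Y)^2 - pp rho^2), summed over all pairs. *)
Lemma sg_theta r : r != 0 -> cmod r < 1 ->
  has_sum (fun n : int => n%:~R * gx (I * r ^ n)) (- (sg r * b3 r)).
Proof.
move=> r0 r1; have [q0 q1] := nome_sqr r0 r1.
have [t ht] : exists t : C, t ^+ 2 = r by exists (sqrtC r); exact: sqrtCK.
have t0 : t != 0 by apply: contraNneq r0 => t0; rewrite -ht t0 expr0n.
have regI : regular (r ^+ 2) (I ^+ 2) by rewrite I2; exact: regular_opp_sqr.
have regr : regular (r ^+ 2) r.
  by rewrite -[X in regular _ X]mul1r; apply: regular_nome => //; rewrite cmod1.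
have regNr : regular (r ^+ 2) (- r).
  by rewrite -[X in regular _ X]mulN1r; apply: regular_nome => //; rewrite cmodN cmod1.
have Nr0 : - r != 0 by rewrite oppr_eq0.
have s_g := geob_summable (geob_gg r0 r1 I_neq0 regI).
have h_g := has_gsum r0 r1 I_neq0 regI.
have s_f := geob_summable (geob_ff q0 q1 Nr0 regNr).
have h_f := has_fsum q0 q1 Nr0 regNr.
have H2 := has_sumM s_g s_f h_g h_f.
have regt : regular (r ^+ 2) (t ^+ 2) by rewrite ht.
have s_t := geob_summable (geob_gg r0 r1 t0 regt).
have h_t := has_gsum r0 r1 t0 regt.
have It0 : I * t != 0 by rewrite mulf_neq0 ?I_neq0.
have regIt : regular (r ^+ 2) ((I * t) ^+ 2) by rewrite exprMn I2 ht mulN1r.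
have s_x := geob_summable (geob_gx r0 r1 It0 regIt).
(* This double series vanishes, its first factor being the g-sum at the half point [t]; it accounts
   for the second term on the right of [gx_mul]. *)
have H3 := has_sumM s_t s_x h_t (has_tsum s_x).
rewrite (gsum_half r0 r1 ht) mul0r in H3.
have {}H3 : has_sum (fun p : int * int => gg (t * r ^ (p.2 - p.1)) * gx (I * t * r ^ p.2)) 0.
  apply: (@has_sum_bij R _ _ (fun p : int * int => (p.2 - p.1, p.2))
    (fun p : int * int => (p.2 - p.1, p.2))) H3 => -[n k] /=; congr pair; lia.
have H1 := has_sumN (has_sumD H2 H3); rewrite addr0 in H1.
apply: has_sum_fubini H1 _ => n /=.
(* [pp (- z) - pp z] is [- 2 gg z], whose sum over [z = r q^m], [q = r^2], vanishes because [r] is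
   the half point for the nome [q]; the remaining shift by [- n] telescopes to [n]. *)
have e1 : has_sum (fun m : int => pp (- r * (r ^+ 2) ^ m) - pp (r * (r ^+ 2) ^ (m - n))) n%:~R.
  have z0 : has_sum (fun m : int => gg (r * (r ^+ 2) ^ m)) 0.
    have rq : regular ((r ^+ 2) ^+ 2) (r ^+ 2).
      by rewrite -[X in regular _ X]mul1r; apply: regular_nome => //; rewrite cmod1.
    by have := has_gsum q0 q1 r0 rq; rewrite (gsum_half q0 q1).
  have h1 := has_sum_pp_tel (- n) q0 q1 r0 regr.
  have := has_sumD (has_sumZ (-2) z0) h1.
  rewrite mulr0 add0r mulrNz opprK; apply: eq_has_sum => m.
  rewrite (mulNr r) -pp_opp ?regr //; first by rewrite addrA subrK.
  by have := regNr m; rewrite mulNr -(inj_eq oppr_inj) opprK.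
have {}e1 := has_sumZ (gx (I * r ^ n)) e1.
rewrite [n%:~R * _]mulrC; apply: eq_has_sum e1 => m.
have eqs : t * r ^ (m - n) * (I * r ^ n) = I * t * r ^ m.
  by rewrite mulrACA -expfzDr // subrK; ring.
have h1 : (I * r ^ n) ^+ 2 = -1 * (r ^+ 2) ^ n by rewrite sqrMXz I2.
have h2 : (t * r ^ (m - n)) ^+ 2 = r * (r ^+ 2) ^ (m - n) by rewrite sqrMXz ht.
have h3 : (I * t * r ^ m) ^+ 2 = - r * (r ^+ 2) ^ m.
  by rewrite sqrMXz (exprMn 2 I t) I2 ht mulN1r.
have := @gx_mul _ (I * r ^ n) (t * r ^ (m - n)) (two_neq0 R).
rewrite eqs h1 h2 h3 opprD; apply; [|exact: regNr|exact: regr].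
exact: regular_opp_sqr.
Qed.

End Landen.
#[global] Opaque b1 b2 b3 sg.

(** * One-sided series, limits at nome 0 and Lambert series *)

Section NatSums.
Variable R : realType.
Local Notation C := R[i].
Local Notation I := ('i%C : C).
Implicit Types q r x y z t : C.

Lemma has_sum_natS (a : nat -> C) c :
  has_sum (fun n => a n.+1) c -> has_sum a (a 0%N + c).
Proof.
move=> hc.
have h1 : has_sum (fun n => if n is 0%N then 0 else a n) c.
  apply: (@has_sum_ext R nat nat S); [exact: succn_inj | | exact: hc].
  by case=> // n /(_ n).
apply: eq_has_sum (has_sumD (has_sum_point 0%N (a 0%N)) h1) => -[|n] /=.
  by rewrite addr0.
by rewrite add0r.
Qed.

Lemma has_sum_even_int (a : int -> C) c : (forall n, a (- n) = a n) ->
  has_sum (fun n : nat => a n.+1%:Z) c -> has_sum a (a 0 + 2 * c).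
Proof.
move=> ha hc.
have -> : a 0 + 2 * c = (a 0 + c) + c by ring.
apply: has_sum_int; first exact: (has_sum_natS (a := fun n => a n%:Z)).
by apply: eq_has_sum hc => n; rewrite NegzE ha.
Qed.

(** Folding a sum over [int] onto positive exponents gives terms that vanish at nome 0, the form
    suited to limits and to termwise differentiation. *)
Definition nomesum (phi : C -> C) r := tsum (fun n : nat => phi (r ^+ n.+1)).

Lemma has_nomesum (phi : C -> C) M (rho : R) r : rho < 1 -> cmod r <= rho ->
  (forall z, cmod z <= rho -> cmod (phi z) <= M * cmod z) ->
  has_sum (fun n : nat => phi (r ^+ n.+1)) (nomesum phi r) /\
  cmod (nomesum phi r) <= M * cmod r / (1 - cmod r).
Proof.
move=> rho1 hr hphi.
have h0 : 0 <= cmod r < 1 by rewrite cmod_ge0 (le_lt_trans hr).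
have hs : summable_by (fun n : nat => phi (r ^+ n.+1)) (M * cmod r / (1 - cmod r)).
  apply: summable_geo_nat => // n.
  have -> : M * cmod r * cmod r ^+ n = M * cmod (r ^+ n.+1) by rewrite cmodX exprS mulrA.
  apply: hphi; rewrite cmodX exprS; apply: le_trans hr; apply: ler_piMr; first exact: cmod_ge0.
  by apply: exprn_ile1; [exact: cmod_ge0 | case/andP: h0 => _ /ltW].
have h := has_tsum (ex_intro _ _ hs).
by split=> //; exact: has_sum_le hs h.
Qed.

Lemma ff_le (rho : R) z : rho < 1 -> cmod z <= rho ->
  cmod (ff z) <= ((1 - rho) ^+ 2)^-1 * cmod z.
Proof.
move=> h1 hz; rewrite /ff cmodM cmodV cmodX mulrC; apply: ler_wpM2r; first exact: cmod_ge0.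
have h := cmodB 1 z; rewrite cmod1 in h.
rewrite lef_pV2 ?posrE ?exprn_gt0 //; try lra.
by rewrite lerXn2r ?nnegrE; lra.
Qed.

Lemma ggI_le (rho : R) z : rho < 1 -> cmod z <= rho ->
  cmod (gg (I * z)) <= (1 - rho)^-1 * cmod z.
Proof.
move=> h1 hz; rewrite /gg cmodM cmodV mulrC exprMn I2 mulN1r opprK.
have -> : cmod (I * z) = cmod z by rewrite cmodM (_ : cmod I = 1) ?mul1r // /cmod /= expr0n expr1n add0r sqrtr1.
apply: ler_wpM2r; first exact: cmod_ge0.
have h := cmodD_ge 1 (z ^+ 2); rewrite cmod1 cmodX in h.
have z0 := cmod_ge0 z.
have h2 : cmod z ^+ 2 <= rho by rewrite expr2; nra.
by rewrite lef_pV2 ?posrE; lra.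
Qed.

Lemma sg_nomesum r : r != 0 -> cmod r < 1 ->
  sg r = I / 2 + 2 * nomesum (fun z => gg (I * z)) r.
Proof.
move=> r0 r1.
have [h _] := has_nomesum r1 (lexx _) (fun z => @ggI_le _ z r1).
rewrite sgE; apply: gsumP.
have -> : I / 2 = gg (I * r ^ (0 : int)) by rewrite expr0z mulr1 /gg I2 opprK.
apply: (has_sum_even_int (a := fun n : int => gg (I * r ^ n))) => [n|].
  rewrite -invr_expz.
  have -> : I * (r ^ n)^-1 = - (I * r ^ n)^-1.
    rewrite invfM -mulNr; congr (_ * _).
    by apply: (mulfI (I_neq0 R)); rewrite mulrN divff ?I_neq0 // -expr2 I2.
  by rewrite ggN ggV opprK.
exact: h.
Qed.

Lemma fsumN1_nomesum q : q != 0 -> cmod q < 1 ->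
  fsum q (-1) = - 4^-1 + 2 * nomesum (fun z => ff (- z)) q.
Proof.
move=> r0 r1.
have hb z : cmod z <= cmod q -> cmod (ff (- z)) <= ((1 - cmod q) ^+ 2)^-1 * cmod z.
  by move=> hz; have := @ff_le _ (- z) r1; rewrite cmodN; apply.
have [h _] := has_nomesum r1 (lexx _) hb.
apply: fsumP.
have -> : - 4^-1 = ff (-1 * q ^ (0 : int)).
  rewrite expr0z mulr1 /ff opprK mulNr mul1r; congr (- _^-1); ring.
apply: (has_sum_even_int (a := fun n : int => ff (-1 * q ^ n))) => [n|].
  by rewrite -invr_expz !mulN1r -invrN ffV.
by apply: eq_has_sum h => n; rewrite mulN1r.
Qed.

Lemma gxV y : gx y^-1 = gx y.
Proof.
rewrite /gx; have [->|x0] := eqVneq y 0; first by rewrite invr0.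
have [e|x1] := eqVneq (y ^+ 2) 1.
  by rewrite exprVn e invr1 subrr expr0n /= mulr0 invr0 !mulr0.
have h1 : 1 - y ^+ 2 != 0 by rewrite subr_eq0 eq_sym.
have h2 : y ^+ 2 - 1 != 0 by rewrite subr_eq0.
by field; rewrite x0 h1 h2.
Qed.

Lemma gxN y : gx (- y) = - gx y.
Proof. by rewrite /gx sqrrN !mulNr. Qed.

(** As [gx y = (y / 2) gg'(y)], the quantity [2 c] is half of [r sg'(r)]: this is the series that
    appears when [sg] is differentiated term by term. *)
Lemma sg_theta_nat r c : r != 0 -> cmod r < 1 ->
  has_sum (fun n : nat => n.+1%:R * gx (I * r ^+ n.+1)) c -> 2 * c = - (sg r * b3 r).
Proof.
move=> r0 r1 hc.
have h := sg_theta r0 r1.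
rewrite -(has_sum_unique (has_sum_even_int (a := fun n : int => n%:~R * gx (I * r ^ n)) _ hc) h).
  by rewrite mul0r add0r.
move=> n; rewrite mulrNz -invr_expz.
have -> : I * (r ^ n)^-1 = - (I * r ^ n)^-1.
  rewrite invfM -mulNr; congr (_ * _).
  by apply: (mulfI (I_neq0 R)); rewrite mulrN divff ?I_neq0 // -expr2 I2.
by rewrite gxN gxV mulrNN.
Qed.

Lemma sg_near r (d : R) : r != 0 -> d <= 2^-1 -> cmod r <= d ->
  cmod (sg r - I / 2) <= 8 * d.
Proof.
move=> r0 d2 hr; have r1 : cmod r < 1 by lra.
rewrite sg_nomesum // addrC addKr cmodM cmod_nat.
have h1 : 2^-1 < (1 : R) by lra.
have [_ h] := has_nomesum (M := (1 - 2^-1)^-1) h1 (le_trans hr d2) (fun z => @ggI_le _ z h1).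
have : (1 - 2^-1)^-1 * cmod r / (1 - cmod r) <= 4 * d.
  rewrite ler_pdivrMr; last lra.
  have -> : (1 - 2^-1)^-1 = 2 :> R by field.
  by have := cmod_ge0 r; nra.
by lra.
Qed.

(** By [sg_geom] a zero at [r] gives a zero at [- r^2]; iterating, zeros would occur at nomes
    tending to 0, where [sg] is close to [i / 2]. *)
Lemma sg_neq0 r : r != 0 -> cmod r < 1 -> sg r != 0.
Proof.
move=> r0 r1; apply/eqP => s0.
pose u (k : nat) := iter k (fun z : C => - z ^+ 2) r.
have hu k : [/\ u k != 0, sg (u k) = 0 & cmod (u k) <= cmod r ^+ k.+1].
  elim: k => [|k [h1 h2 h3]]; first by rewrite expr1.
  have h4 : cmod (u k) <= cmod r.
    apply: le_trans h3 _; rewrite exprS; apply: ler_piMr; first exact: cmod_ge0.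
    by apply: exprn_ile1; [exact: cmod_ge0 | exact: ltW].
  split; rewrite /u iterS -/(u k).
  - by rewrite oppr_eq0 expf_neq0.
  - have : sg (- u k ^+ 2) ^+ 2 = 0.
      by rewrite -(sg_geom h1 (le_lt_trans h4 r1)) h2 mul0r.
    by move/eqP; rewrite expf_eq0 => /eqP.
  - rewrite cmodN cmodX expr2 exprS; apply: ler_pM => //; exact: cmod_ge0.
have hr : 0 <= cmod r < 1 by rewrite cmod_ge0.
(* With [d = 1/32] the bound [8 d] of [sg_near] is [1/4], below the modulus [1/2] of [i / 2]. *)
have [N /(_ N (leqnn N)) hN] := geo_small (cmod r) hr (e := 32^-1) ltac:(lra).
have [h1 h2 h3] := hu N.
have h4 : cmod (u N) <= 32^-1 by rewrite exprS in h3; lra.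
have := sg_near h1 (d := 32^-1) ltac:(lra) h4.
rewrite h2 sub0r cmodN cmodM cmodV cmod_nat.
rewrite (_ : cmod I = 1); last by rewrite /cmod /= expr0n expr1n add0r sqrtr1.
by lra.
Qed.

(** Dropping the first term and factoring out [z] gives a linear equation for the first sum, then
    one for the second in which the first appears. *)
Lemma has_sum_geom z : cmod z < 1 ->
  has_sum (fun n : nat => z ^+ n.+1) (z / (1 - z)) /\
  has_sum (fun n : nat => n.+1%:R * z ^+ n.+1) (ff z).
Proof.
move=> z1.
have d0 : 1 - z != 0.
  by rewrite subr_eq0; apply: contraTneq z1 => <-; rewrite cmod1 ltxx.
have hz : 0 <= cmod z < 1 by rewrite cmod_ge0.
have s1 : summable (fun n : nat => z ^+ n.+1).
  exists (cmod z / (1 - cmod z)); apply: summable_geo_nat => // n.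
  by rewrite cmodX exprS.
have [S hS] := summable_has_sum s1.
have E : S = z / (1 - z).
  have h : has_sum (fun n : nat => z ^+ n.+2) (z * S).
    by apply: eq_has_sum (has_sumZ z hS) => n; rewrite [RHS]exprS.
  have {}h := has_sum_unique hS (has_sum_natS (a := fun n : nat => z ^+ n.+1) h).
  rewrite expr1 in h.
  have e : S * (1 - z) = z by rewrite mulrBr mulr1 {1}h; ring.
  by apply: (mulIf d0); rewrite e divfK.
rewrite E in hS; split=> //.
have s2 : summable (fun n : nat => n.+1%:R * z ^+ n.+1).
  have g : geob (fun n : int => n%:~R * (if n is Posz m then z ^+ m else 0)).
    have z0 := cmod_ge0 z.
    apply: geob_natmul; exists ((cmod z + 1) / 2), 1; split; first lra.
    case=> n; rewrite mul1r ?cmod0 ?cmodX; last by rewrite exprn_ge0 //; lra.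
    by apply: lerXn2r; rewrite ?nnegrE; lra.
  have := summable_inj (phi := fun n : nat => n.+1%:Z) _ (geob_summable g).
  move=> /(_ ltac:(by move=> m n [])); apply: eq_summable => n /=.
  by rewrite -pmulrn.
have [T hT] := summable_has_sum s2.
suff -> : ff z = T by [].
have h : has_sum (fun n : nat => n.+2%:R * z ^+ n.+2) (z * T + z * (z / (1 - z))).
  apply: eq_has_sum (has_sumD (has_sumZ z hT) (has_sumZ z hS)) => n.
  by rewrite -[n.+2]addn1 natrD [z ^+ (n + 1).+1]exprS addn1; ring.
have {}h := has_sum_unique hT (has_sum_natS (a := fun n : nat => n.+1%:R * z ^+ n.+1) h).
rewrite mul1r expr1 in h.
apply: (mulIf d0); rewrite /ff.
have -> : T * (1 - z) = z + z * (z / (1 - z)) by rewrite mulrBr mulr1 {1}h; ring.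
by field.
Qed.

(* Both sides are iterated sums of (d+1) q^((n+1)(d+1)). *)
Lemma lambert q : q != 0 -> cmod q < 1 ->
  has_sum (fun d : nat => d.+1%:R * q ^+ d.+1 / (1 - q ^+ d.+1)) (nomesum (@ff C) q).
Proof.
move=> q0 q1.
have pw n : cmod (q ^+ n.+1) < 1.
  by rewrite cmodX exprn_ilt1 // cmod_ge0.
pose a (p : nat * nat) : C := p.2.+1%:R * (q ^+ p.1.+1) ^+ p.2.+1.
have sa : summable a.
  have s1 : summable (fun n : nat => q ^+ n).
    exists (1 / (1 - cmod q)); apply: summable_geo_nat => [|n]; first by rewrite cmod_ge0.
    by rewrite mul1r cmodX.
  have s2 : summable (fun n : nat => n.+1%:R * q ^+ n).
    have h := (has_sum_geom q1).2.
    have g : geob (fun n : int => n%:~R * (if n is Posz m then q ^+ m else 0)).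
      apply: geob_natmul; exists (cmod q), 1; rewrite cmod_gt0 q0 q1; split => //.
      by case=> n; rewrite ?cmod0 ?mul1r ?exprn_ge0 ?cmodX ?cmod_ge0.
    have := summableZ q^-1 (summable_inj (phi := fun n : nat => n.+1%:Z) _ (geob_summable g)).
    move=> /(_ ltac:(by move=> m n [])); apply: eq_summable => n /=.
    by rewrite -pmulrn exprS; field.
  have [M hM] := summableM s1 s2; exists M; apply: summable_le hM => -[n d] /=.
  rewrite /a /= -exprM !cmodM mulrCA; apply: ler_wpM2l; first exact: cmod_ge0.
  rewrite -cmodM -exprD !cmodX; apply: ler_wiXn2l; rewrite ?cmod_ge0 ?ltW //; lia.
have [S hS] := summable_has_sum sa.
have h1 := has_sum_fubini hS (fun n => (has_sum_geom (pw n)).2).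
have -> : nomesum (@ff C) q = S by exact: tsumP.
have hS' : has_sum (a \o (fun p : nat * nat => (p.2, p.1))) S.
  by apply: (has_sum_bij (psi := fun p : nat * nat => (p.2, p.1))) hS => -[].
apply: has_sum_fubini hS' _ => d /=.
rewrite -mulrA; apply: eq_has_sum (has_sumZ _ (has_sum_geom (pw d)).1) => n.
by rewrite /a /= -!exprM mulnC.
Qed.

Lemma has_sum_ff_nome q : q != 0 -> cmod q < 1 ->
  has_sum (fun n : int => ff (q ^ n)) (2 * nomesum (@ff C) q).
Proof.
move=> r0 r1.
have [h _] := has_nomesum r1 (lexx _) (fun z => @ff_le _ z r1).
rewrite -[2 * _]add0r.
have {1}-> : 0 = ff (q ^ (0 : int)) by rewrite expr0z /ff subrr expr0n invr0 mulr0.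
apply: (has_sum_even_int (a := fun n : int => ff (q ^ n))) => [n|].
  by rewrite -invr_expz ffV.
exact: h.
Qed.

(** With [A(q) = nomesum ff q] and [q = r^2], parity gives [2 A(q) = 2 A(q^2) + b2 q], and
    [ff x + ff (- x) = 4 ff (x^2)] gives [b1 r + 2 A(q) = - 1/4 + 8 A(q^2)]. Since
    [b2 r + b3 r = 4 b2 q], [A(q^2)] cancels. *)
Lemma b_sum r : r != 0 -> cmod r < 1 ->
  b1 r + b2 r + b3 r = - 4^-1 + 6 * nomesum (@ff C) (r ^+ 2).
Proof.
move=> r0 r1; have [q0 q1] := nome_sqr r0 r1; have [p0 p1] := nome_sqr q0 q1.
rewrite -addrA -(b2_double r0 r1); set q := r ^+ 2 in q0 q1 p0 p1 *.
have e1 : 2 * nomesum (@ff C) q = 2 * nomesum (@ff C) (q ^+ 2) + b2 q.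
  apply: has_sum_unique (has_sum_ff_nome q0 q1) _; apply: has_sum_even_odd.
    by apply: eq_has_sum (has_sum_ff_nome p0 p1) => n; rewrite -exprz_exp -exprnP.
  have rq : regular (q ^+ 2) q.
    by rewrite -[X in regular _ X]mul1r; apply: regular_nome => //; rewrite cmod1.
  rewrite b2E; apply: eq_has_sum (has_fsum p0 p1 q0 rq) => n.
  by rewrite expfzDr // expr1z -exprz_exp -exprnP mulrC.
have e2 : b1 r + 2 * nomesum (@ff C) q = - 4^-1 + 4 * (2 * nomesum (@ff C) (q ^+ 2)).
  have rN := regular_opp_sqr q0 q1.
  have N0 : (-1 : C) != 0 by rewrite oppr_eq0 oner_eq0.
  have h1 := has_sumD (has_fsum q0 q1 N0 rN) (has_sum_ff_nome q0 q1).
  (* At [n = 0] the termwise identity fails: [ff 1] is 0 by the convention on division while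
     [ff (-1) = - 1/4], hence the point mass. *)
  have h2 := has_sumD (has_sum_point (0 : int) (- 4^-1 : C)) (has_sumZ 4 (has_sum_ff_nome p0 p1)).
  rewrite b1E -/q; apply: has_sum_unique (h1) _; apply: eq_has_sum h2 => n /=.
  case: eqP => [->|n0]; rewrite mulN1r.
    rewrite !expr0z /ff subrr expr0n /= invr0 !mulr0 !addr0 opprK mulNr mul1r.
    by congr (- _^-1); ring.
  rewrite add0r [RHS]addrC ffD ?sqrXz //.
    by apply/eqP => h; apply: n0; apply: (nome_eq1 q0 q1); rewrite h cmod1.
  by apply/eqP => h; apply: n0; apply: (nome_eq1 q0 q1); rewrite h cmodN cmod1.
move: e1 e2.
move: (nomesum (@ff C) q) (nomesum (@ff C) (q ^+ 2)) (b2 q) (b1 r) => A A' c2 c1 e1 e2.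
have -> : c1 = - 4^-1 + 4 * (2 * A') - 2 * A by rewrite -e2 addrK.
have -> : c2 = 2 * A - 2 * A' by rewrite e1; ring.
by ring.
Qed.

End NatSums.
#[global] Opaque nomesum.

(** * Complex derivatives *)

Section Bridge.
Variable R : realType.
Local Notation C := R[i].

Lemma ltcR (a b : R) : (a%:C%C < b%:C%C :> C) = (a < b).
Proof. by rewrite ltcE /= eqxx. Qed.

Lemma pos_complexP (e : C) : 0 < e -> exists2 a : R, 0 < a & e = a%:C%C.
Proof. by case: e => a b; rewrite ltcE /= => /andP[/eqP -> a0]; exists a. Qed.

Lemma cvg_cmodP (T : Type) (F : set_system T) (FF : Filter F) (f : T -> C) (l : C) :
  f @ F --> l <-> forall e : R, 0 < e -> \forall x \near F, cmod (f x - l) < e.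
Proof.
split.
  move=> /cvgrPdist_lt h e e0; have := h e%:C%C; rewrite ltcR => /(_ e0).
  by apply: filterS => x; rewrite distrC cmod_normE ltcR.
move=> h; apply/cvgrPdist_lt => _ /pos_complexP [e e0 ->].
by apply: filterS (h e e0) => x; rewrite distrC cmod_normE ltcR.
Qed.

Lemma near_cmodP (a : C) (P : C -> Prop) :
  (\forall z \near a, P z) <-> exists2 e : R, 0 < e & forall z, cmod (z - a) < e -> P z.
Proof.
split.
  move=> /nbhs_normP [_ /= /pos_complexP [e e0 ->] h]; exists e => // z hz.
  by apply: h; rewrite /= distrC cmod_normE ltcR.
move=> [e e0 h]; apply/nbhs_normP; exists e%:C%C; first by rewrite /= ltcR.
by move=> z /=; rewrite distrC cmod_normE ltcR; exact: h.
Qed.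

(** A quadratic remainder is an estimate that can be summed over the terms of a series; the
    derivatives of [nomesum] and [gsum] are obtained through it. *)
Lemma is_derive_quad (f : C -> C) (z d : C) (K del : R) : 0 < del ->
  (forall h, cmod h < del -> cmod (f (z + h) - f z - d * h) <= K * cmod h ^+ 2) ->
  is_derive z 1 f d.
Proof.
move=> del0 H.
suff h : (fun h : C => h^-1 *: ((f \o shift z) (h *: (1 : C)) - f z)) @ 0^' --> d.
  by apply: DeriveDef; [apply/cvgP; exact: h | exact: cvg_lim h].
apply/cvg_cmodP => e e0.
pose K' := `|K| + 1.
have K0 : 0 < K' by rewrite /K'; have := normr_ge0 K; lra.
have m0 : 0 < Num.min del (e / K') by rewrite lt_min del0 divr_gt0.
have near1 : \forall h \near (0 : C)^', cmod h < Num.min del (e / K').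
  have := @dnbhs0_lt C C (Num.min del (e / K'))%:C%C; rewrite ltcR => /(_ m0).
  by apply: filterS => h; rewrite cmod_normE ltcR.
have near2 := nbhs_dnbhs_neq (0 : C).
near=> h.
have h0 : h != 0 by near: h.
have : cmod h < Num.min del (e / K') by near: h.
rewrite lt_min => /andP[hd he].
rewrite /= -[h *: 1]/(h * 1) mulr1 [h + z]addrC -[_ *: _]/(h^-1 * _).
have -> : h^-1 * (f (z + h) - f z) - d = h^-1 * (f (z + h) - f z - d * h) by field.
rewrite cmodM cmodV mulrC ltr_pdivrMr ?cmod_gt0 //.
apply: le_lt_trans (H h hd) _.
have c0 : 0 < cmod h by rewrite cmod_gt0.
rewrite ltr_pdivlMr // in he.
have : K <= K' by rewrite /K'; have := ler_norm K; lra.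
by nra.
Unshelve. all: by end_near.
Qed.

Lemma is_derive_cmod (f : C -> C) (z d : C) : is_derive z 1 f d ->
  forall e : R, 0 < e -> exists2 del : R, 0 < del & forall h, cmod h < del ->
    cmod (f (z + h) - f z - d * h) <= e * cmod h.
Proof.
move=> [dv dE] e e0.
have : (fun h : C => h^-1 *: ((f \o shift z) (h *: (1 : C)) - f z)) @ 0^' --> d.
  by rewrite -dE; exact: dv.
move=> /cvg_cmodP /(_ e e0); rewrite near_withinE => /near_cmodP [del del0 h].
exists del => // k hk; have [->|k0] := eqVneq k 0.
  by rewrite addr0 subrr sub0r mulr0 cmodN cmod0 mulr0.
have := h k; rewrite subr0 => /(_ hk k0).
rewrite /= -[k *: 1]/(k * 1) mulr1 [k + z]addrC -[_ *: _]/(k^-1 * _) => /ltW.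
have -> : k^-1 * (f (z + k) - f z) - d = k^-1 * (f (z + k) - f z - d * k) by field.
by rewrite cmodM cmodV mulrC ler_pdivrMr ?cmod_gt0.
Qed.

End Bridge.

(** * Elementary bounds for the real exponential, sine and cosine *)

Section RealBounds.
Variable R : realType.

(** [1 + a <= exp a] is taken at [a] and at [- a]; the latter gives the upper bound
    [1 / (1 - a)]. *)
Lemma expR_quad (a : R) : `|a| <= 2^-1 -> `|expR a - 1 - a| <= 2 * a ^+ 2.
Proof.
rewrite ler_norml => /andP[h1 h2].
have e1 := expR_ge1Dx a; have e2 := expR_ge1Dx (- a).
have : expR a <= (1 - a)^-1.
  by rewrite -[a in expR a]opprK expRN lef_pV2 ?posrE ?expR_gt0 //; lra.
have -> : (1 - a)^-1 = 1 + a + a ^+ 2 / (1 - a) by field; lra.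
have : a ^+ 2 / (1 - a) <= 2 * a ^+ 2.
  by rewrite ler_pdivrMr; [have := sqr_ge0 a; nra | lra].
by move=> ? ?; rewrite ler_norml; apply/andP; split; have := sqr_ge0 a; lra.
Qed.

Lemma sin_mvt (b : R) : 0 <= b -> exists2 c, 0 <= c <= b & sin b = cos c * b.
Proof.
move=> b0.
have [c hc] := MVT_segment b0 (fun x _ => is_derive_sin x)
  (continuous_subspaceT (@continuous_sin R)).
by rewrite sin0 !subr0 => h; exists c => //; move: hc; rewrite in_itv.
Qed.

Lemma sin_le_norm (b : R) : `|sin b| <= `|b|.
Proof.
wlog b0 : b / 0 <= b.
  move=> H; have [/H //|/ltW b0] := leP 0 b.
  by have := H (- b); rewrite sinN !normrN; apply; lra.
have [c _ ->] := sin_mvt b0.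
by rewrite normrM; apply: ler_piMl => //; exact: cos_max.
Qed.

Lemma cos_quad (b : R) : `|cos b - 1| <= b ^+ 2.
Proof.
have -> : cos b = cos ((b / 2) *+ 2) by congr cos; rewrite -mulr_natr divfK ?pnatr_eq0.
rewrite cos_mulr2n cos2sin2.
have h := sin_le_norm (b / 2).
have : sin (b / 2) ^+ 2 <= (b / 2) ^+ 2.
  by rewrite -[leLHS]real_normK ?num_real // -[leRHS]real_normK ?num_real // lerXn2r ?nnegrE.
have := sqr_ge0 (sin (b / 2)); have := sqr_ge0 b => ? ? ?.
by rewrite ler_norml; apply/andP; split; rewrite mulr2n; lra.
Qed.

Lemma sin_quad (b : R) : `|b| <= 1 -> `|sin b - b| <= b ^+ 2.
Proof.
wlog b0 : b / 0 <= b.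
  move=> H hb; have [b0|/ltW b0] := leP 0 b; first exact: H.
  have := H (- b); rewrite sinN normrN sqrrN.
  have -> : - sin b - - b = - (sin b - b) by ring.
  by rewrite normrN; apply => //; lra.
move=> hb; have [c /andP[c0 cb] ->] := sin_mvt b0.
have -> : cos c * b - b = (cos c - 1) * b by ring.
rewrite normrM (ger0_norm b0) expr2; apply: ler_wpM2r => //.
rewrite ger0_norm // in hb.
apply: le_trans (cos_quad c) _; nra.
Qed.

(** [sin b = 2 cos (b/2) sin (b/2)] and [sin (b/2) = cos c * (b/2)]; both cosines are at least
    [cos (pi/4)], whose square is [1/2]. *)
Lemma sin_ge_half (b : R) : `|b| <= pi / 2 -> `|b| / 2 <= `|sin b|.
Proof.
wlog b0 : b / 0 <= b.
  move=> H hb; have [b0|/ltW b0] := leP 0 b; first exact: H.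
  by have := H (- b); rewrite sinN !normrN; apply => //; lra.
rewrite (ger0_norm b0) => hb.
have pi0 := pi_gt0 R.
set c0 := cos (pi / 4 : R).
have c0E : c0 ^+ 2 = 2^-1.
  have := cos_pihalf R; have -> : pi / 2 = (pi / 4) *+ 2 :> R by rewrite -mulr_natr; field.
  by rewrite cos_mulr2n -/c0 mulr2n => h; lra.
have c0p : 0 < c0 by apply: cos_gt0_pihalf; apply/andP; split; lra.
have cge x : 0 <= x <= pi / 4 -> c0 <= cos x.
  move=> /andP[x0 x1]; rewrite /c0.
  have mono := ltr_cos (R := R).
  rewrite leNgt; apply/negP; rewrite mono ?in_itv /=; first by rewrite ltNge x1.
    by apply/andP; split; lra.
  by apply/andP; split; lra.
have h2 : 0 <= b / 2 <= pi / 4 by apply/andP; split; lra.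
have [c /andP[d0 d1] hs] := @sin_mvt (b / 2) ltac:(lra).
have s1 : sin b = 2 * (cos (b / 2) * (cos c * (b / 2))).
  by rewrite -hs -[b in LHS](divfK (x := 2)) ?pnatr_eq0 // mulr_natr sin_mulr2n mulr2n; ring.
have k1 := cge _ h2; have k2 := cge c ltac:(apply/andP; split; lra).
have k3 : c0 ^+ 2 <= cos (b / 2) * cos c by rewrite expr2; apply: ler_pM => //; exact: ltW.
rewrite s1 ger0_norm; first nra.
rewrite !mulr_ge0 //; lra.
Qed.

Lemma sinh_ge (a : R) : a ^+ 2 <= (expR a - expR (- a)) ^+ 2.
Proof.
wlog a0 : a / 0 <= a.
  move=> H; have [a0|/ltW a0] := leP 0 a; first exact: H.
  by have := H (- a); rewrite opprK sqrrN -[_ - expR a]opprB sqrrN; apply; lra.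
rewrite lerXn2r ?nnegrE //.
  have h1 := expR_ge1Dx a; have : expR (- a) <= 1 by rewrite expR_le1; lra.
  by lra.
have h1 := expR_ge1Dx a; have : expR (- a) <= 1 by rewrite expR_le1; lra.
by lra.
Qed.

End RealBounds.

(** * The complex exponential *)

Section Cexp.
Variable R : realType.
Local Notation C := R[i].
Implicit Types z w : C.

Lemma cexpE z : cexp z = Complex (expR (complex.Re z) * cos (complex.Im z))
                                 (expR (complex.Re z) * sin (complex.Im z)).
Proof. by apply/eqP; rewrite eq_complex /= !mul0r subr0 addr0 !eqxx. Qed.

Lemma cexpD z w : cexp (z + w) = cexp z * cexp w.
Proof.
case: z => a b; case: w => c d; rewrite !cexpE /=.
by apply/eqP; rewrite eq_complex /= expRD cosD sinD; apply/andP; split; apply/eqP; ring.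
Qed.

Lemma cexp0 : cexp (0 : C) = 1.
Proof. by rewrite cexpE /= expR0 cos0 sin0 mulr0 mulr1. Qed.

Lemma cexpN_mul z : cexp (- z) * cexp z = 1.
Proof. by rewrite -cexpD addNr cexp0. Qed.

Lemma cexp_neq0 z : cexp z != 0.
Proof.
apply/eqP => h; have := cexpN_mul z; rewrite h mulr0 => /eqP.
by rewrite eq_sym oner_eq0.
Qed.

Lemma cexpN z : cexp (- z) = (cexp z)^-1.
Proof. by apply: (mulIf (cexp_neq0 z)); rewrite cexpN_mul mulVf ?cexp_neq0. Qed.

Lemma cmod_cexp z : cmod (cexp z) = expR (complex.Re z).
Proof.
apply/eqP; rewrite -(@eqrXn2 _ 2) ?cmod_ge0 ?expR_ge0 // cmod_sqr cexpE /=.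
by rewrite !exprMn -mulrDr cos2Dsin2 mulr1.
Qed.

Lemma cexp_nat (n : nat) z : cexp (n%:R * z) = cexp z ^+ n.
Proof.
elim: n => [|n IH]; first by rewrite mul0r cexp0 expr0.
by rewrite -natr1 mulrDl mul1r cexpD IH exprSr.
Qed.

Lemma cexp_int (n : int) z : cexp (n%:~R * z) = cexp z ^ n.
Proof.
case: n => n; first by rewrite -pmulrn cexp_nat.
by rewrite NegzE mulrNz -pmulrn mulNr cexpN cexp_nat -exprnN.
Qed.

Lemma cexp_quad z : cmod z <= 2^-1 -> cmod (cexp z - 1 - z) <= 16 * cmod z ^+ 2.
Proof.
case: z => a b hz.
have ha := le_trans (cmod_ge_Re (Complex a b)) hz.
have hb := le_trans (cmod_ge_Im (Complex a b)) hz.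
rewrite /= in ha hb.
have ea := expR_quad ha; have eb := cos_quad b.
have es : `|sin b - b| <= b ^+ 2 by apply: sin_quad; lra.
apply: le_trans (cmod_leD _) _; rewrite cmod_sqr cexpE /=.
have sa := sqr_ge0 a; have sb := sqr_ge0 b.
move: ea eb es ha hb; rewrite !ler_norml => /andP[? ?] /andP[? ?] /andP[? ?] /andP[? ?] /andP[? ?].
have a2 : a ^+ 2 <= 4^-1 by nra.
have E2 : expR a <= 2 by lra.
have E0 := expR_ge0 a.
have k1 : `|expR a * cos b - 1 - a| <= 2 * a ^+ 2 + 2 * b ^+ 2.
  have -> : expR a * cos b - 1 - a = (expR a - 1 - a) + expR a * (cos b - 1) by ring.
  by rewrite ler_norml; apply/andP; split; nra.
have k2 : `|expR a * sin b - b| <= 2 * b ^+ 2 + (4 * a ^+ 2 + b ^+ 2).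
  have -> : expR a * sin b - b = expR a * (sin b - b) + (expR a - 1 - a) * b + a * b by ring.
  have ab1 : a * b <= a ^+ 2 + b ^+ 2 by have := sqr_ge0 (a - b); have := sqr_ge0 (a + b); nra.
  have ab2 : - (a ^+ 2 + b ^+ 2) <= a * b by have := sqr_ge0 (a - b); have := sqr_ge0 (a + b); nra.
  have q1 : expR a * (sin b - b) <= 2 * b ^+ 2 by nra.
  have q2 : - (2 * b ^+ 2) <= expR a * (sin b - b) by nra.
  have q3 : (expR a - 1 - a) * b <= 2 * a ^+ 2 by nra.
  have q4 : - (2 * a ^+ 2) <= (expR a - 1 - a) * b by nra.
  by rewrite ler_norml; apply/andP; split; lra.
rewrite ?oppr0 ?addr0 ?subr0 in k1 k2 *.
by lra.
Qed.

Lemma is_derive_cexp z : is_derive z 1 (@cexp R) (cexp z).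
Proof.
apply: (@is_derive_quad R _ _ _ (cmod (cexp z) * 16) 2^-1); first lra.
move=> h hh; have -> : cexp (z + h) - cexp z - cexp z * h = cexp z * (cexp h - 1 - h).
  by rewrite cexpD; ring.
by rewrite cmodM -mulrA; apply: ler_wpM2l; [exact: cmod_ge0 | apply: cexp_quad; lra].
Qed.

(** For [z = a + i b] the squared modulus of [2 sinh z] is [(2 sinh a)^2 + 4 (sin b)^2]. This bound
    provides the dominating series in Lipschitz's formula. *)
Lemma cexp_sinh_ge z : `|complex.Im z| <= pi / 2 ->
  cmod z <= cmod (cexp z - cexp (- z)).
Proof.
move=> hz; rewrite -(@ler_pXn2r _ 2) ?nnegrE ?cmod_ge0 // !cmod_sqr !cexpE.
case: z hz => a b /= hb; rewrite cosN sinN.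
have h1 := sinh_ge a; have h2 := sin_ge_half hb.
have h3 : b ^+ 2 <= 4 * sin b ^+ 2.
  have : (`|b| / 2) ^+ 2 <= `|sin b| ^+ 2.
    by rewrite lerXn2r ?nnegrE ?divr_ge0 ?normr_ge0.
  by rewrite exprMn !real_normK ?num_real //; lra.
have e1 : expR a * expR (- a) = 1 by rewrite -expRD subrr expR0.
have cs := cos2Dsin2 b.
set E := expR a in h1 e1 *; set E' := expR (- a) in h1 e1 *.
set c := cos b in cs *; set s := sin b in h3 cs *.
have -> : (E * c - E' * c) ^+ 2 + (E * s - E' * - s) ^+ 2 =
  (E - E') ^+ 2 * (c ^+ 2 + s ^+ 2) + 4 * (E * E') * s ^+ 2 by ring.
by rewrite cs e1 mulr1 mulr1; lra.
Qed.

End Cexp.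

(** * Lattice sums *)

Section Lipschitz.
Variable R : realType.
Local Notation C := R[i].
Implicit Types u v w z : C.

Definition ex v : C := cexp (2 * cpi R * ii R * v).

Lemma ii2 : ii R ^+ 2 = -1. Proof. exact: sqr_i. Qed.
Lemma ii_neq0 : ii R != 0. Proof. exact: I_neq0. Qed.
Lemma cmod_ii : cmod (ii R) = 1.
Proof. by rewrite /cmod /= expr0n expr1n add0r sqrtr1. Qed.
Lemma cpi_neq0 : cpi R != 0.
Proof. by rewrite /cpi -cmod_gt0 cmod_real normr_gt0 gt_eqF ?pi_gt0. Qed.
Lemma twopii_neq0 : 2 * cpi R * ii R != 0.
Proof. by rewrite !mulf_neq0 ?cpi_neq0 ?ii_neq0 ?pnatr_eq0. Qed.

Lemma complexM (a b c d : R) :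
  Complex a b * Complex c d = Complex (a * c - b * d) (a * d + b * c).
Proof. by []. Qed.

Lemma twopiiE : 2 * cpi R * ii R = Complex 0 (pi *+ 2).
Proof.
rewrite /cpi /ii -(rmorph_nat (real_complex R) 2) /real_complex_def !complexM.
by congr Complex; rewrite ?mulr2n; ring.
Qed.

Lemma exD u v : ex (u + v) = ex u * ex v.
Proof. by rewrite /ex mulrDr cexpD. Qed.
Lemma ex0 : ex 0 = 1. Proof. by rewrite /ex mulr0 cexp0. Qed.
Lemma ex_neq0 v : ex v != 0. Proof. exact: cexp_neq0. Qed.
Lemma exN v : ex (- v) = (ex v)^-1. Proof. by rewrite /ex mulrN cexpN. Qed.
Lemma ex_nat (n : nat) v : ex (n%:R * v) = ex v ^+ n.
Proof. by rewrite /ex mulrCA cexp_nat. Qed.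
Lemma ex_int (n : int) v : ex (n%:~R * v) = ex v ^ n.
Proof. by rewrite /ex mulrCA cexp_int. Qed.
Lemma ex1 : ex 1 = 1.
Proof. by rewrite /ex mulr1 twopiiE cexpE /= expR0 cos2pi sin2pi !mul1r. Qed.
Lemma ex_half : ex 2^-1 = -1.
Proof.
rewrite /ex (_ : _ / 2 = Complex 0 pi).
  by rewrite cexpE /= expR0 cospi sinpi mulr0 mul1r; apply/eqP; rewrite eq_complex /= oppr0 !eqxx.
have -> : 2 * cpi R * ii R / 2 = cpi R * ii R by field.
rewrite /cpi /ii /real_complex_def complexM.
by congr Complex; ring.
Qed.
Lemma exDint v (n : int) : ex (v + n%:~R) = ex v.
Proof. by rewrite exD -[n%:~R]mulr1 ex_int ex1 exp1rz mulr1. Qed.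
Lemma cmod_ex v : cmod (ex v) = expR (- (pi *+ 2) * complex.Im v).
Proof.
rewrite /ex cmod_cexp twopiiE; case: v => a b /=; congr expR.
by rewrite mul0r sub0r mulNr.
Qed.

(** [ff (x^2) = (x - 1/x)^-2] with [x = exp (pi i w)]; the condition on [Re w] is the strip of
    [cexp_sinh_ge]. *)
Lemma ff_ex_le w : `|complex.Re w| <= 2^-1 ->
  cmod (ff (ex w)) <= cmod ((cpi R ^+ 2 * w ^+ 2)^-1).
Proof.
move=> hw; pose z := cpi R * ii R * w.
have Ez : ex w = cexp z ^+ 2 by rewrite -cexp_nat /ex /z; congr cexp; ring.
have [h0|h0] := eqVneq (ex w) 1.
  by rewrite h0 /ff subrr expr0n invr0 mulr0 cmod0 cmod_ge0.
have c0 := cexp_neq0 z.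
have d0 : 1 - cexp z ^+ 2 != 0 by rewrite -Ez subr_eq0 eq_sym.
have -> : ff (ex w) = ((cexp z - cexp (- z)) ^+ 2)^-1.
  rewrite Ez cexpN /ff; field; rewrite c0 d0 /= andbT.
  by rewrite -[_ - 1]opprB oppr_eq0.
rewrite !cmodV -exprMn !cmodX.
have zE : cmod z = cmod (cpi R * w) by rewrite /z !cmodM cmod_ii mulr1.
have pi0 := pi_gt0 R.
have hz : `|complex.Im z| <= pi / 2.
  have -> : complex.Im z = pi * complex.Re w.
    rewrite /z /cpi /ii /real_complex_def; case: (w) => a b.
    by rewrite !complexM /=; ring.
  by rewrite normrM (gtr0_norm pi0); apply: ler_wpM2l => //; exact: ltW.
have hs := cexp_sinh_ge hz.
rewrite zE in hs.
have w0 : w != 0 by apply: contraNneq h0 => ->; rewrite ex0.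
have p0 : 0 < cmod (cpi R * w) by rewrite cmod_gt0; apply: mulf_neq0 => //; exact: cpi_neq0.
rewrite lef_pV2 ?posrE ?exprn_gt0 //; last exact: lt_le_trans hs.
by rewrite lerXn2r ?nnegrE ?cmod_ge0.
Qed.

(** Iterates [ff x + ff (- x) = 4 ff (x^2)]: the numbers [ex ((v + j) / 2^K)] are the [2^K]-th roots
    of [ex v]. *)
Lemma ex_window v K : ex v != 1 ->
  \sum_(0 <= j < 2 ^ K) ff (ex ((v + j%:R) / 2 ^+ K)) = 4 ^+ K * ff (ex v).
Proof.
move=> hv; elim: K => [|K IH].
  by rewrite big_nat1 addr0 divr1 mul1r.
rewrite (exprS 4 K) -mulrA -IH mulr_sumr expnS mul2n -addnn.
rewrite (big_cat_nat (n := (2 ^ K)%N)) ?leq_addr //=.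
rewrite -{2}[(2 ^ K)%N]add0n big_addn addnK -big_split /=.
apply: eq_bigr => j _.
have t0 : (2 : C) ^+ K != 0 by rewrite expf_neq0 ?pnatr_eq0.
set x := ex ((v + j%:R) / 2 ^+ K.+1).
have x2 : x ^+ 2 = ex ((v + j%:R) / 2 ^+ K).
  by rewrite /x -ex_nat; congr ex; rewrite exprS; field.
have -> : ex ((v + (j + 2 ^ K)%:R) / 2 ^+ K.+1) = - x.
  have -> : (v + (j + 2 ^ K)%:R) / 2 ^+ K.+1 = (v + j%:R) / 2 ^+ K.+1 + 2^-1.
    by rewrite natrD natrX exprS; field.
  by rewrite exD ex_half mulrN1.
have x21 : x ^+ 2 != 1.
  rewrite x2; apply: contra hv => /eqP h.
  have := congr1 (fun z => z ^+ (2 ^ K)) h; rewrite expr1n -ex_nat natrX mulrC divfK // => e.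
  by rewrite -(exDint v j%:Z) -pmulrn e.
rewrite ffD ?x2 //.
  by apply: contra x21 => /eqP ->; rewrite expr1n.
by apply: contra x21 => /eqP ->; rewrite sqrrN expr1n.
Qed.

Lemma cexp_ff_lim (e : R) : 0 < e -> exists2 del : R, 0 < del &
  forall z, z != 0 -> cmod z < del -> cmod (z ^+ 2 * ff (cexp z) - 1) < e.
Proof.
move=> e0.
have [dv dE] := is_derive_cexp (0 : C).
have h1 : (fun h : C => h^-1 *: ((@cexp R \o shift 0) (h *: (1 : C)) - cexp 0)) @ 0^' --> (1 : C).
  suff : (fun h : C => h^-1 *: ((@cexp R \o shift 0) (h *: (1 : C)) - cexp 0)) @ 0^' --> 'D_1 (@cexp R) 0.
    by rewrite dE cexp0.
  exact: dv.
have h2 : (@cexp R) @ 0^' --> (1 : C).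
  rewrite -[X in _ --> X]cexp0; apply: cvg_within_filter; apply: differentiable_continuous.
  exact: (proj1 (derivable1_diffP _ _) dv).
have h3 := cvgM h2 (cvgM (cvgV (oner_neq0 C) h1) (cvgV (oner_neq0 C) h1)).
have FF : Filter (0 : C)^' by exact: _.
have {}h3 := h3 FF FF FF FF; rewrite invr1 !mulr1 in h3.
move/cvg_cmodP: h3 => /(_ e e0); rewrite near_withinE => /near_cmodP [del del0 h].
exists del => // z z0 hz; have := h z; rewrite subr0 => /(_ hz z0).
rewrite /= -[z *: 1]/(z * 1) mulr1 addr0 cexp0 -[_ *: _]/(z^-1 * _).
suff -> : z ^+ 2 * ff (cexp z) =
  cexp z * ((z^-1 * (cexp z - 1))^-1 * (z^-1 * (cexp z - 1))^-1) by [].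
move: (cexp z) => X; rewrite /ff; have [->|X1] := eqVneq X 1.
  by rewrite subrr expr0n /= !(invr0, mulr0).
have d1 : 1 - X != 0 by rewrite subr_eq0 eq_sym.
have d2 : X - 1 != 0 by rewrite subr_eq0.
by field; rewrite z0 d1 d2.
Qed.

(** The weight [(1 + |m|)^(-3/2)]: it is summable over [int], and the product of two such weights
    dominates the inverse cube of [|m| + |n|] up to a constant. *)
Definition w32 (m : int) : R := ((1 + (absz m)%:R) * Num.sqrt (1 + (absz m)%:R))^-1.

Lemma w32_gt0 m : 0 < w32 m.
Proof.
have : 0 < 1 + (absz m)%:R :> R by have := ler0n R (absz m); lra.
by move=> h; rewrite invr_gt0 mulr_gt0 // sqrtr_gt0.
Qed.

Lemma w32_summable : summable (fun m => (w32 m)%:C%C).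
Proof.
have H : summable (fun n : nat => ((n.+1%:R * Num.sqrt n.+1%:R)^-1 : R)%:C%C).
  exists 3; apply: summable_nat => N.
  have E (n : nat) : cmod ((n.+1%:R * Num.sqrt n.+1%:R)^-1 : R)%:C%C = (n.+1%:R * Num.sqrt n.+1%:R)^-1.
    by rewrite cmod_real ger0_norm // invr_ge0 mulr_ge0 ?sqrtr_ge0.
  case: N => [|N]; first by rewrite big_geq.
  (* The increment of [- 2 / sqrt n] dominates the next term, so this sharper bound passes through
     the induction. *)
  suff : \sum_(0 <= i < N.+1) cmod ((i.+1%:R * Num.sqrt i.+1%:R)^-1 : R)%:C%C <= 3 - 2 / Num.sqrt N.+1%:R.
    have : 0 <= 2 / Num.sqrt N.+1%:R :> R by rewrite divr_ge0 ?sqrtr_ge0.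
    by move: (\sum_(_ <= _ < _) _) => S; lra.
  elim: N => [|N IH]; first by rewrite big_nat1 E sqrtr1 mulr1 invr1; lra.
  rewrite big_nat_recr // E.
  apply: le_trans (lerD IH (lexx _)) _.
  set s := Num.sqrt N.+1%:R; set t := Num.sqrt N.+2%:R.
  have s0 : 0 < s by rewrite sqrtr_gt0 ltr0n.
  have st : s <= t by rewrite ler_wsqrtr // ler_nat.
  have t2 : t ^+ 2 = N.+2%:R by rewrite sqr_sqrtr.
  have s2 : s ^+ 2 = t ^+ 2 - 1 by rewrite t2 sqr_sqrtr // -natr1; ring.
  rewrite -t2.
  have t0 : 0 < t by lra.
  have e1 : 2 / s - 2 / t = 2 * (t ^+ 2 - s ^+ 2) / (s * t * (s + t)) by field; rewrite !gt_eqF //; lra.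
  have e2 : (t ^+ 2 * t)^-1 <= 2 / s - 2 / t.
    rewrite e1 s2 (_ : t ^+ 2 - (t ^+ 2 - 1) = 1); last ring.
    rewrite mulr1 ler_pdivlMr; last by rewrite !mulr_gt0 //; lra.
    rewrite mulrC ler_pdivrMr; last by rewrite mulr_gt0 ?exprn_gt0.
    have : s * t <= t ^+ 2 by rewrite expr2; apply: ler_wpM2r => //; exact: ltW.
    have : 0 < s * t by exact: mulr_gt0.
    have : 0 < t ^+ 2 by exact: exprn_gt0.
    nra.
  lra.
apply: summable_int.
  by apply: eq_summable H => n; rewrite /w32 /= nat1r.
apply: eq_summable (summable_inj succn_inj H) => n.
by rewrite /w32 /= nat1r.
Qed.

Lemma w32_ge m : ((1 + (absz m)%:R) ^+ 2)^-1 <= w32 m.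
Proof.
have h : 1 <= 1 + (absz m)%:R :> R by have := ler0n R (absz m); lra.
have h0 : 0 < 1 + (absz m)%:R :> R by lra.
rewrite /w32 lef_pV2 ?posrE ?exprn_gt0 ?mulr_gt0 ?sqrtr_gt0 // expr2.
apply: ler_wpM2l; first exact: ltW.
set x := 1 + _ in h h0 *.
have : Num.sqrt x <= Num.sqrt (x ^+ 2) by rewrite ler_wsqrtr // expr2; nra.
by rewrite sqrtr_sqr ger0_norm // ltW.
Qed.

Lemma int_near (N : nat) (m : int) : m \notin [seq i%:Z - N%:Z | i <- iota 0 (N + N)] ->
  (N <= absz m)%N.
Proof.
move=> h; rewrite leqNgt; apply: contra h => h; apply/mapP.
by exists (absz (m + N%:Z)); rewrite ?mem_iota; lia.
Qed.

Lemma cmod_int (m : int) : cmod (m%:~R : C) = (absz m)%:R.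
Proof. by case: m => n; rewrite ?NegzE ?mulrNz ?cmodN -pmulrn cmod_nat. Qed.

Lemma summable_inv_sqr v : summable (fun m : int => ((v + m%:~R) ^+ 2)^-1).
Proof.
pose N := (Num.truncn (2 * cmod v + 1)).+1.
apply: (summable_off (r := [seq i%:Z - N%:Z | i <- iota 0 (N + N)]) _ (summableZ 4 w32_summable)).
move=> m /int_near hm.
have h1 : 2 * cmod v + 1 <= (absz m)%:R.
  by apply: le_trans (ltW (truncnS_gt _)) _; rewrite ler_nat.
rewrite cmodM cmod_nat cmod_real gtr0_norm ?w32_gt0 // cmodV cmodX.
have h2 : (1 + (absz m)%:R) / 2 <= cmod (v + m%:~R).
  by have := cmodD_ge (m%:~R) v; rewrite cmod_int [m%:~R + v]addrC; lra.
have a0 : 0 < 1 + (absz m)%:R :> R by have := ler0n R (absz m); lra.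
apply: (@le_trans _ _ (4 * ((1 + (absz m)%:R) ^+ 2)^-1)); last first.
  by apply: ler_wpM2l => //; exact: w32_ge.
rewrite -[4]invrK -invfM lef_pV2 ?posrE ?mulr_gt0 ?exprn_gt0 //; try lra.
have -> : 4^-1 * (1 + (absz m)%:R) ^+ 2 = ((1 + (absz m)%:R) / 2) ^+ 2 :> R by field.
by rewrite lerXn2r ?nnegrE; lra.
Qed.

(** [ex_window] writes [ff (ex v)] as a sum over [m] of [4^-(K+1) ff (ex ((v + m) / 2^(K+1)))]. By
    the double pole of [ff (cexp z)] at 0 the terms tend to multiples of [(v + m)^-2]; [ff_ex_le]
    dominates them, and the total is the same for all [K]. *)
Lemma lipschitz_strip v : ex v != 1 -> 0 <= complex.Re v < 1 ->
  has_sum (fun m : int => ((v + m%:~R) ^+ 2)^-1) (- 4 * cpi R ^+ 2 * ff (ex v)).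
Proof.
move=> hv /andP[v0 v1].
have four0 : - 4 * cpi R ^+ 2 != 0.
  by rewrite mulf_neq0 ?expf_neq0 ?cpi_neq0 // oppr_eq0 pnatr_eq0.
have vm m : v + m%:~R != 0.
  apply: contra hv; rewrite addr_eq0 => /eqP ->.
  by rewrite -mulrNz -[_%:~R]add0r exDint ex0.
suff h : has_sum (fun m : int => (- 4 * cpi R ^+ 2 * (v + m%:~R) ^+ 2)^-1) (ff (ex v)).
  apply: eq_has_sum (has_sumZ (- 4 * cpi R ^+ 2) h) => m.
  by rewrite invfM mulrA divff // mul1r.
pose W K : seq int := [seq j%:Z - (2 ^ K)%N%:Z | j <- index_iota 0 (2 ^ K.+1)].
have memW K m : (m \in W K) = (- (2 ^ K)%N%:Z <= m < (2 ^ K)%N%:Z).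
  apply/mapP/idP => [[j]|hm].
    by rewrite mem_index_iota expnS => hj ->; lia.
  exists (absz (m + (2 ^ K)%N%:Z)); last by lia.
  by rewrite mem_index_iota expnS; lia.
pose a K m : C := if m \in W K then (4 ^+ K.+1)^-1 * ff (ex ((v + m%:~R) / 2 ^+ K.+1)) else 0.
have two0 K : (2 : C) ^+ K != 0 by rewrite expf_neq0 ?pnatr_eq0.
have four_pow K : (4 : C) ^+ K = (2 ^+ K) ^+ 2 by rewrite -exprM mulnC exprM; congr (_ ^+ K); ring.
have fourn0 K : (4 : C) ^+ K != 0 by rewrite expf_neq0 ?pnatr_eq0.
apply: (has_sum_tannery (a := a) (b := fun m => (cpi R ^+ 2 * (v + m%:~R) ^+ 2)^-1)).
- apply: eq_summable (summableZ (cpi R ^+ 2)^-1 (summable_inv_sqr v)) => m.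
  by rewrite [RHS]invfM.
- move=> K m; rewrite /a; case: ifPn => [|_]; last by rewrite cmod0 cmod_ge0.
  rewrite memW => hm; rewrite cmodM.
  (* The window [[-2^K, 2^K)] together with [0 <= Re v < 1] keeps the scaled point in the strip of
     [ff_ex_le]. *)
  have hre : `|complex.Re ((v + m%:~R) / 2 ^+ K.+1)| <= 2^-1.
    have -> : complex.Re ((v + m%:~R) / 2 ^+ K.+1) = (complex.Re v + m%:~R) / 2 ^+ K.+1.
      have -> : (m%:~R : C) = (m%:~R : R)%:C%C by rewrite rmorph_int.
      have -> : (2 ^+ K.+1 : C)^-1 = ((2 ^+ K.+1 : R)^-1)%:C%C by rewrite fmorphV rmorphXn rmorph_nat.
      by case: (v) => x y /=; rewrite mulr0 subr0.
    have p0 : 0 < (2 : R) ^+ K.+1 by rewrite exprn_gt0.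
    rewrite normrM normfV (gtr0_norm p0) ler_pdivrMr // exprS mulrA mulVf ?pnatr_eq0 // mul1r.
    have {hm} : (- (2 ^ K)%N%:~R <= m%:~R :> R) && (m%:~R + 1 <= (2 ^ K)%N%:~R :> R).
      have -> : m%:~R + 1 = (m + 1)%:~R :> R by rewrite intrD.
      by rewrite -mulrNz !ler_int; lia.
    rewrite -pmulrn natrX => /andP[? ?].
    by rewrite ler_norml; apply/andP; split; lra.
  apply: le_trans (ler_wpM2l (cmod_ge0 _) (ff_ex_le hre)) _.
  rewrite -cmodM -invfM four_pow.
  have -> : (2 ^+ K.+1) ^+ 2 * (cpi R ^+ 2 * ((v + m%:~R) / 2 ^+ K.+1) ^+ 2) = cpi R ^+ 2 * (v + m%:~R) ^+ 2 by field; exact: two0.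
  by [].
- move=> m e e0; pose u := 2 * cpi R * ii R * (v + m%:~R).
  have u0 : u != 0 by rewrite mulf_neq0 ?twopii_neq0.
  have uc : 0 < cmod u by rewrite cmod_gt0.
  have [del del0 hdel] := @cexp_ff_lim (e * cmod u ^+ 2) ltac:(by rewrite mulr_gt0 ?exprn_gt0).
  have half : 0 <= (2^-1 : R) < 1 by apply/andP; split; lra.
  have [N1 hN1] := geo_small (cmod u) half (e := del / 2) ltac:(lra).
  exists (maxn N1 (absz m).+1) => K; rewrite geq_max => /andP[K1 K2].
  have mW : m \in W K.
    rewrite memW; have : (absz m < 2 ^ K)%N by apply: leq_trans K2 (ltnW (ltn_expl _ _)).
    by lia.
  rewrite /a mW; pose z := u / 2 ^+ K.+1.
  have z0 : z != 0 by rewrite mulf_neq0 ?invr_neq0.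
  have hz : cmod z < del.
    have -> : cmod z = cmod u * 2^-1 ^+ K.+1 by rewrite /z cmodM cmodV cmodX cmod_nat exprVn.
    by apply: le_lt_trans (hN1 K.+1 (leqW K1)) _; lra.
  have := hdel z z0 hz.
  have -> : ex ((v + m%:~R) / 2 ^+ K.+1) = cexp z by rewrite /ex /z /u; congr cexp; rewrite mulrA.
  have -> : (4 ^+ K.+1)^-1 * ff (cexp z) - (- 4 * cpi R ^+ 2 * (v + m%:~R) ^+ 2)^-1 =
     (z ^+ 2 * ff (cexp z) - 1) / u ^+ 2.
    have -> : - 4 * cpi R ^+ 2 * (v + m%:~R) ^+ 2 = u ^+ 2.
      by rewrite /u !exprMn ii2; ring.
    rewrite four_pow /z; move: (ff _) => X; field; rewrite u0 /=; exact: two0.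
  by rewrite cmodM cmodV cmodX ltr_pdivrMr ?exprn_gt0.
move=> K; have h := @has_sum_seq R int (W K) (fun m : int => (4 ^+ K.+1)^-1 * ff (ex ((v + m%:~R) / 2 ^+ K.+1))).
have uW : uniq (W K) by rewrite map_inj_uniq ?iota_uniq // => i j /(can_inj (subrK _)) [].
have {}h := h uW.
suff E : ff (ex v) = \sum_(i <- W K) (4 ^+ K.+1)^-1 * ff (ex ((v + i%:~R) / 2 ^+ K.+1)).
  by rewrite E; exact: h.
rewrite big_map -mulr_sumr.
(* [ex_window] starts at [j = 0]; shifting [v] by the integer [- 2^K] centres the window without
   changing [ex v]. *)
pose v' := v + (- (2 ^ K)%N%:Z)%:~R.
have v'E : ex v' = ex v by rewrite exDint.
have := @ex_window v' K.+1; rewrite v'E => /(_ hv) hw.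
apply: (mulfI (fourn0 K.+1)); rewrite [RHS]mulrA divff ?fourn0 // mul1r -hw.
have E j : v' + j%:R = v + (j%:Z - (2 ^ K)%N%:Z)%:~R.
  by rewrite /v' intrD -[j%:Z%:~R]pmulrn -addrA [_%:~R + j%:R]addrC.
apply: eq_bigr => j _; rewrite E.
reflexivity.
Qed.

Lemma lipschitz v : ex v != 1 ->
  has_sum (fun m : int => ((v + m%:~R) ^+ 2)^-1) (- 4 * cpi R ^+ 2 * ff (ex v)).
Proof.
move=> hv; pose n := Num.floor (complex.Re v).
have e1 : ex (v + (- n)%:~R) = ex v by rewrite exDint.
have := @lipschitz_strip (v + (- n)%:~R); rewrite e1 => /(_ hv) h.
have hR : complex.Re (v + (- n)%:~R) = complex.Re v - n%:~R.
  have -> : ((- n)%:~R : C) = (- n%:~R : R)%:C%C by rewrite mulrNz rmorphN rmorph_int.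
  by case: (v) => x y.
have {}h := h ltac:(rewrite hR; have := floor_le (complex.Re v); have := lt_succ_floor (complex.Re v); rewrite intrD -/n; lra).
apply: eq_has_sum (has_sum_shift n h) => m /=.
by rewrite -addrA -intrD addrCA addNr addr0.
Qed.

End Lipschitz.

(** * Lattice sums: [wp] and [wzeta] as series in the nome *)

Section Lattice.
Variable R : realType.
Local Notation C := R[i].
Implicit Types u v w z : C.

Definition lat (w1 w2 : C) (p : int * int) : C :=
  2 * w1 * p.1%:~R + 2 * w2 * p.2%:~R.

Definition latfam (w1 w2 : C) (f : C -> C) (p : int * int) : C :=
  if p == 0 then 0 else f (lat w1 w2 p).

Lemma lattice_sumP (w1 w2 : C) f S :
  has_sum (latfam w1 w2 f) S -> lattice_sum w1 w2 f = S.
Proof.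
move=> hs; apply: cvg_lim => //; apply/cvg_cmodP => e e0.
pose W N : seq (int * int) := [seq (i%:Z - N%:Z, j%:Z - N%:Z) |
  i <- index_iota 0 N.*2.+1, j <- index_iota 0 N.*2.+1].
have uW N : uniq (W N).
  apply: allpairs_uniq; rewrite ?iota_uniq // => -[i j] [i' j'] _ _ /= [h1 h2].
  by congr pair; lia.
have [|n0 hn0] := has_sum_seqlim hs uW _ e0.
  move=> [i j]; exists (absz i + absz j)%N => n hn; apply/allpairsP.
  exists (absz (i + n%:Z), absz (j + n%:Z)); rewrite !mem_index_iota /=.
  by split; [lia | lia | congr pair; lia].
exists n0 => // n /= /hn0; congr (cmod (_ - _) < _).
rewrite /W big_allpairs_dep /= big_mkord; apply: eq_bigr => i _.
rewrite [LHS]big_mkord [RHS]big_mkcond /=; apply: eq_bigr => j _.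
rewrite /latfam /lat /= !intrD !mulrNz -!pmulrn.
have -> : ((i%:Z - n%:Z, j%:Z - n%:Z) == 0) = (i == n :> nat) && (j == n :> nat).
  by rewrite -[0]/((0 : int), (0 : int)) xpair_eqE !subr_eq0.
by case: (_ == _); case: (_ == _).
Qed.

Lemma summable_cmod (I : eqType) (a : I -> C) :
  summable a -> summable (fun i => (cmod (a i))%:C%C).
Proof.
by move=> [M hM]; exists M; apply: summable_le hM => i; rewrite cmod_real ger0_norm ?cmod_ge0.
Qed.

Lemma summable_le_sum (I : eqType) (a b c : I -> C) :
  (forall i, cmod (a i) <= cmod (b i) + cmod (c i)) ->
  summable b -> summable c -> summable a.
Proof.
move=> h /summable_cmod sb /summable_cmod sc.
have [M hM] := summableD sb sc; exists M; apply: summable_le hM => i.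
by rewrite -rmorphD cmod_real ger0_norm ?addr_ge0 ?cmod_ge0.
Qed.

Section Fixed.
Variables w1 w2 : C.
Hypotheses (w10 : w1 != 0) (tau0 : 0 < complex.Im (w2 / w1)).
Let tau := w2 / w1.
Let q := ex tau.

Lemma latE p : lat w1 w2 p = 2 * w1 * (p.1%:~R + p.2%:~R * tau).
Proof. by rewrite /lat /tau; field. Qed.

Lemma tau_lower (m n : int) :
  (absz n)%:R * complex.Im tau <= cmod (m%:~R + n%:~R * tau).
Proof.
apply: le_trans (cmod_ge_Im _).
have -> : complex.Im (m%:~R + n%:~R * tau) = n%:~R * complex.Im tau.
  have -> : (m%:~R : C) = (m%:~R : R)%:C%C by rewrite rmorph_int.
  have -> : (n%:~R : C) = (n%:~R : R)%:C%C by rewrite rmorph_int.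
  rewrite /real_complex_def; case: (tau) => a b; rewrite complexM ImD /=; ring.
rewrite normrM (gtr0_norm tau0); apply: ler_wpM2r; first exact: ltW.
by case: n => n; rewrite ?NegzE ?mulrNz ?normrN -pmulrn normr_nat.
Qed.

(** The imaginary part bounds [|n|] by a multiple of [|m + n tau|], and then
    [m = (m + n tau) - n tau] bounds [|m|]. *)
Lemma lat_lower : exists2 c : R, 0 < c &
  forall p, c * ((absz p.1)%:R + (absz p.2)%:R) <= cmod (lat w1 w2 p).
Proof.
have t0 := tau0; rewrite -/tau in t0; set t := complex.Im tau in t0 *.
have tc : 0 <= cmod tau by exact: cmod_ge0.
have wc : 0 < cmod w1 by rewrite cmod_gt0.
pose k := t^-1 + 1 + cmod tau / t.
have k0 : 0 < k by rewrite /k; have := divr_ge0 tc (ltW t0); have := invr_gt0 t; lra.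
exists (2 * cmod w1 / k); first by rewrite divr_gt0 //; lra.
move=> [m n] /=; rewrite latE !cmodM cmod_nat /= -mulrA; apply: ler_wpM2l; first lra.
rewrite mulrC ler_pdivrMr //.
set d := cmod _.
have h1 := tau_lower m n; rewrite -/d -/t in h1.
have h2 : (absz n)%:R <= d / t by rewrite ler_pdivlMr.
have h3 : (absz m)%:R <= d + (absz n)%:R * cmod tau.
  have := cmodD (m%:~R + n%:~R * tau) (- (n%:~R * tau)).
  by rewrite addrK cmodN cmodM !cmod_int.
have : (absz n)%:R * cmod tau <= d / t * cmod tau by exact: ler_wpM2r.
have -> : d * k = d / t + d + d / t * cmod tau by rewrite /k; ring.
lra.
Qed.

(** With [s = |m| + |n| >= 1], both [1 + |m|] and [1 + |n|] are at most [2 s], so [w32 m * w32 n] is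
    at least [(2 s)^-3]; hence the factor 8. *)
Lemma summable_lat (F : int * int -> C) (K L : R) : 0 <= K ->
  (forall p, p != 0 -> L <= cmod (lat w1 w2 p) ->
     cmod (F p) <= K / cmod (lat w1 w2 p) ^+ 3) ->
  summable F.
Proof.
move=> K0 hF; have [c c0 hc] := lat_lower.
pose N := (Num.truncn (L / c)).+1.
pose r := (0 : int * int) :: [seq (i%:Z - N%:Z, j%:Z - N%:Z) | i <- iota 0 (N + N), j <- iota 0 (N + N)].
have sw := summableZ (K * 8 / c ^+ 3)%:C%C (summableM (@w32_summable R) (@w32_summable R)).
apply: (summable_off (r := r) _ sw) => -[m n]; rewrite inE negb_or => /andP[p0 hp].
have hmn : (N <= absz m + absz n)%N.
  rewrite leqNgt; apply: contra hp => h; apply/allpairsP.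
  exists (absz (m + N%:Z), absz (n + N%:Z)); rewrite !mem_iota /=.
  by split; [lia | lia | congr pair; lia].
pose s : R := (absz m)%:R + (absz n)%:R.
have s1 : 1 <= s by rewrite /s -natrD ler1n; move: hmn; rewrite /N; lia.
have hL : L <= cmod (lat w1 w2 (m, n)).
  apply: le_trans (hc (m, n)); rewrite /= -/s mulrC -ler_pdivrMr //.
  apply: le_trans (ltW (truncnS_gt _)) _; rewrite /s -natrD ler_nat //.
have cs : 0 < c * s by rewrite mulr_gt0 //; lra.
have dl := hc (m, n); rewrite /= -/s in dl.
apply: le_trans (hF _ p0 hL) _.
rewrite cmodM cmodM !cmod_real /= !(gtr0_norm (w32_gt0 _ _)).
rewrite ger0_norm; last by rewrite divr_ge0 ?mulr_ge0 ?exprn_ge0 // ltW.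
apply: (@le_trans _ _ (K / (c * s) ^+ 3)).
  apply: ler_wpM2l => //; rewrite lef_pV2 ?posrE ?exprn_gt0 //; last exact: lt_le_trans dl.
  by rewrite lerXn2r ?nnegrE ?cmod_ge0 // ltW.
have -> : K / (c * s) ^+ 3 = K / c ^+ 3 * (s ^+ 3)^-1 by rewrite exprMn invfM; ring.
have -> : K * 8 / c ^+ 3 * (w32 R m * w32 R n) = K / c ^+ 3 * (8 * (w32 R m * w32 R n)) by ring.
apply: ler_wpM2l; first by rewrite divr_ge0 ?exprn_ge0 // ltW.
rewrite /w32 -invfM.
set a := 1 + (absz m)%:R; set b := 1 + (absz n)%:R.
have a1 : 1 <= a by rewrite /a lerDl ler0n.
have b1' : 1 <= b by rewrite /b lerDl ler0n.
have ab : a * b <= (2 * s) ^+ 2.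
  have : a <= 2 * s by rewrite /a /s; have := ler0n R (absz n); rewrite /s in s1; lra.
  have : b <= 2 * s by rewrite /b /s; have := ler0n R (absz m); rewrite /s in s1; lra.
  rewrite expr2 => ? ?; apply: ler_pM => //; lra.
have sab : Num.sqrt a * Num.sqrt b <= 2 * s.
  rewrite -sqrtrM; last lra.
  rewrite -[leRHS]ger0_norm; last lra.
  by rewrite -sqrtr_sqr ler_wsqrtr.
have e0 : 0 < Num.sqrt a * Num.sqrt b by rewrite mulr_gt0 // sqrtr_gt0; lra.
have ab0 : 0 < a * b by rewrite mulr_gt0 //; lra.
have -> : a * Num.sqrt a * (b * Num.sqrt b) = (a * b) * (Num.sqrt a * Num.sqrt b) by ring.
have p1 : 0 < s ^+ 3 by rewrite exprn_gt0 //; lra.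
have p2 : 0 < 8^-1 * (a * b * (Num.sqrt a * Num.sqrt b)) by apply: mulr_gt0; [lra | exact: mulr_gt0].
rewrite -[8]invrK -invfM lef_pV2 ?posrE //.
have : (a * b) * (Num.sqrt a * Num.sqrt b) <= (2 * s) ^+ 2 * (2 * s).
  by apply: ler_pM => //; exact: ltW.
have -> : (2 * s) ^+ 2 * (2 * s) = 8 * s ^+ 3 by ring.
lra.
Qed.

Lemma lat_neq0 p : p != 0 -> lat w1 w2 p != 0.
Proof.
move=> p0; have [c c0 hc] := lat_lower; rewrite -cmod_gt0.
apply: lt_le_trans (hc p); apply: mulr_gt0 => //.
case: p p0 => m n; rewrite -[0]/((0 : int), (0 : int)) xpair_eqE => h /=.
by rewrite -natrD ltr0n; move: h; lia.
Qed.

Definition wp_term z (l : C) := ((z - l) ^+ 2)^-1 - (l ^+ 2)^-1.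
Definition wzeta_term z (l : C) := (z - l)^-1 + l^-1 + z / l ^+ 2.

Lemma far_bound z l : 2 * cmod z + 1 <= cmod l ->
  [/\ l != 0, z - l != 0, 0 < cmod l & cmod l / 2 <= cmod (z - l)].
Proof.
move=> hl; have z0 := cmod_ge0 z.
have l0 : 0 < cmod l by lra.
have h : cmod l / 2 <= cmod (z - l) by have := cmodB l z; rewrite cmodC; lra.
split=> //; first by rewrite -cmod_gt0.
by rewrite -cmod_gt0; lra.
Qed.

Lemma summable_wp z : summable (latfam w1 w2 (wp_term z)).
Proof.
apply: (@summable_lat _ (10 * cmod z) (2 * cmod z + 1)); first by rewrite mulr_ge0 ?cmod_ge0.
move=> p p0; rewrite /latfam (negPf p0); set l := lat w1 w2 p => hl.
have [l0 d0 lp h] := far_bound hl.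
have -> : wp_term z l = z * (2 * l - z) / (l ^+ 2 * (z - l) ^+ 2).
  by rewrite /wp_term; field; rewrite l0 d0.
have z0 := cmod_ge0 z.
have n1 : cmod (2 * l - z) <= 5 / 2 * cmod l.
  by apply: le_trans (cmodD _ _) _; rewrite cmodN cmodM cmod_nat; lra.
have n2 : 4^-1 * cmod l ^+ 2 <= cmod (z - l) ^+ 2.
  have -> : 4^-1 * cmod l ^+ 2 = (cmod l / 2) ^+ 2 by field.
  by rewrite lerXn2r ?nnegrE ?cmod_ge0 // divr_ge0 // ltW.
rewrite cmodM cmodV (cmodM z) (cmodM (l ^+ 2)) !cmodX.
rewrite ler_pdivrMr; last by rewrite mulr_gt0 ?exprn_gt0 // cmod_gt0.
have -> : 10 * cmod z / cmod l ^+ 3 * (cmod l ^+ 2 * cmod (z - l) ^+ 2) =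
  cmod z * (10 / cmod l * cmod (z - l) ^+ 2) by field; rewrite gt_eqF.
apply: ler_wpM2l => //; apply: le_trans n1 _.
apply: (@le_trans _ _ (10 / cmod l * (4^-1 * cmod l ^+ 2))).
  by rewrite le_eqVlt; apply/orP; left; apply/eqP; field; rewrite gt_eqF.
by apply: ler_wpM2l => //; rewrite divr_ge0 // ltW.
Qed.

Lemma summable_wzeta z : summable (latfam w1 w2 (wzeta_term z)).
Proof.
apply: (@summable_lat _ (2 * cmod z ^+ 2) (2 * cmod z + 1)).
  by rewrite mulr_ge0 ?exprn_ge0 ?cmod_ge0.
move=> p p0; rewrite /latfam (negPf p0); set l := lat w1 w2 p => hl.
have [l0 d0 lp h] := far_bound hl.
have -> : wzeta_term z l = z ^+ 2 / (l ^+ 2 * (z - l)).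
  by rewrite /wzeta_term; field; rewrite l0 d0.
rewrite cmodM cmodV (cmodM (l ^+ 2)) !cmodX.
rewrite ler_pdivrMr; last by rewrite mulr_gt0 ?exprn_gt0 // cmod_gt0.
have -> : 2 * cmod z ^+ 2 / cmod l ^+ 3 * (cmod l ^+ 2 * cmod (z - l)) =
  cmod z ^+ 2 * (2 / cmod l * cmod (z - l)) by field; rewrite gt_eqF.
rewrite -[leLHS]mulr1; apply: ler_wpM2l; first by rewrite exprn_ge0 ?cmod_ge0.
by rewrite mulrAC ler_pdivlMr // mul1r; lra.
Qed.

(** Lipschitz's formula at [1/2] gives the odd terms, [pi^2 / 4]; the even terms are a quarter of
    the total [B], so [3 B = pi^2]. *)
Lemma basel : has_sum (fun m : int => ((m%:~R : C) ^+ 2)^-1) (cpi R ^+ 2 / 3).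
Proof.
have [B hB] : exists B, has_sum (fun m : int => ((m%:~R : C) ^+ 2)^-1) B.
  apply: summable_has_sum; apply: eq_summable (summable_inv_sqr (0 : C)) => m.
  by rewrite add0r.
have h1 := @lipschitz R 2^-1; rewrite ex_half in h1.
have {}h1 := has_sumZ 4^-1 (h1 ltac:(by rewrite -subr_eq0 -opprD oppr_eq0 -[1 + 1]/(2%:R) pnatr_eq0)).
have h2 : has_sum (fun m : int => (((2 * m + 1)%:~R : C) ^+ 2)^-1) (cpi R ^+ 2 / 4).
  have -> : cpi R ^+ 2 / 4 = 4^-1 * (- 4 * cpi R ^+ 2 * ff (-1)).
    have -> : ff (-1 : C) = - 4^-1.
      by rewrite /ff opprK mulNr mul1r; congr (- _^-1); ring.
    by field.
  apply: eq_has_sum h1 => m; rewrite -invfM; congr (_^-1).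
  by rewrite intrD intrM; field.
have h3 : has_sum (fun m : int => (((2 * m)%:~R : C) ^+ 2)^-1) (4^-1 * B).
  apply: eq_has_sum (has_sumZ 4^-1 hB) => m; rewrite -invfM; congr (_^-1).
  by rewrite intrM; ring.
have h := has_sum_unique hB (has_sum_even_odd (a := fun m : int => ((m%:~R : C) ^+ 2)^-1) h3 h2).
suff -> : cpi R ^+ 2 / 3 = B by [].
have : 3 * B = cpi R ^+ 2.
  have -> : 3 * B = 4 * (B - 4^-1 * B) by field.
  by rewrite {1}h addrAC subrr add0r; field.
by move=> <-; field.
Qed.

Lemma q_neq0 : q != 0. Proof. exact: ex_neq0. Qed.
Lemma q_lt1 : cmod q < 1.
Proof.
rewrite cmod_ex expR_lt1 mulNr oppr_lt0 mulr_gt0 // mulrn_wgt0 //; exact: pi_gt0.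
Qed.

Lemma qn_neq1 (n : int) : n != 0 -> q ^ n != 1.
Proof.
move=> n0; apply: contra n0 => /eqP h; apply/eqP; apply: (nome_eq1 q_neq0 q_lt1).
by rewrite h cmod1.
Qed.

Lemma row_inv_sqr (n : int) : n != 0 ->
  has_sum (fun m : int => (lat w1 w2 (m, n) ^+ 2)^-1) (- (cpi R / w1) ^+ 2 * ff (q ^ n)).
Proof.
move=> n0; have h := @lipschitz R (n%:~R * tau); rewrite ex_int in h.
have {}h := has_sumZ ((2 * w1) ^+ 2)^-1 (h (qn_neq1 n0)).
have -> : - (cpi R / w1) ^+ 2 * ff (q ^ n) =
  ((2 * w1) ^+ 2)^-1 * (- 4 * cpi R ^+ 2 * ff (q ^ n)) by move: (ff _) => X; field.
by apply: eq_has_sum h => m; rewrite latE /= addrC [in RHS](exprMn 2 (2 * w1)) [in RHS]invfM.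
Qed.

Lemma row_zero : has_sum (fun m : int => (lat w1 w2 (m, 0) ^+ 2)^-1)
  ((cpi R / w1) ^+ 2 / 12).
Proof.
have -> : (cpi R / w1) ^+ 2 / 12 = ((2 * w1) ^+ 2)^-1 * (cpi R ^+ 2 / 3) by field.
apply: eq_has_sum (has_sumZ _ basel) => m.
by rewrite latE /= mul0r addr0 [in RHS]exprMn -invfM.
Qed.

(** Each row of fixed [n] is summed by Lipschitz's formula, then the rows are added. The constant
    [- 1/12] is the row [n = 0] of the inverse squares, given by [basel]. *)
Lemma wp_fsum z : regular q (ex (z / (2 * w1))) ->
  wp w1 w2 z = - (cpi R / w1) ^+ 2 *
    (fsum q (ex (z / (2 * w1))) - (- 12^-1 + 2 * nomesum (@ff C) q)).
Proof.
set v := z / (2 * w1) => hx.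
have q0 := q_neq0; have q1 := q_lt1.
have zE : z = 2 * w1 * v by rewrite /v; field.
have [S hS] := summable_has_sum (summable_wp z).
rewrite /wp (lattice_sumP hS).
have hS' : has_sum (fun p : int * int => latfam w1 w2 (wp_term z) (p.2, p.1)) S.
  by apply: (has_sum_bij (phi := fun p : int * int => (p.2, p.1)) (psi := fun p : int * int => (p.2, p.1))) hS => -[].
have rowz (n : int) : has_sum (fun m : int => ((z - lat w1 w2 (m, n)) ^+ 2)^-1)
    (- (cpi R / w1) ^+ 2 * ff (ex v * q ^ (- n))).
  have E : ex (v + (- n)%:~R * tau) = ex v * q ^ (- n) by rewrite exD ex_int.
  have h := @lipschitz R (v + (- n)%:~R * tau); rewrite E in h.
  have {}h := has_sumZ ((2 * w1) ^+ 2)^-1 (has_sum_opp (h (hx (- n)))).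
  have -> : - (cpi R / w1) ^+ 2 * ff (ex v * q ^ (- n)) =
    ((2 * w1) ^+ 2)^-1 * (- 4 * cpi R ^+ 2 * ff (ex v * q ^ (- n))) by move: (ff _) => X; field.
  apply: eq_has_sum h => m; rewrite latE /= zE -mulrBr [in RHS](exprMn 2 (2 * w1)) [in RHS]invfM.
  by congr (_ * (_ ^+ 2)^-1); rewrite !mulrNz; ring.
(* For [n = 0] the value [ff 1] is 0 by the convention on division, so the value from [row_zero] is
   entered separately, together with [- z^-2] for the omitted origin. *)
have rows (n : int) : has_sum (fun m : int => latfam w1 w2 (wp_term z) (m, n))
    (- (cpi R / w1) ^+ 2 * (ff (ex v * q ^ (- n)) - ff (q ^ n)) +
     (if n == 0 then - (z ^+ 2)^-1 - (cpi R / w1) ^+ 2 / 12 else 0)).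
  have [->|n0] := eqVneq n 0; last first.
    rewrite addr0 mulrBr.
    apply: eq_has_sum (has_sumB (rowz n) (row_inv_sqr n0)) => m.
    by rewrite /latfam -[0]/((0 : int), (0 : int)) xpair_eqE (negPf n0) andbF.
  have -> : - (cpi R / w1) ^+ 2 * (ff (ex v * q ^ (- 0)) - ff (q ^ (0 : int))) +
     (- (z ^+ 2)^-1 - (cpi R / w1) ^+ 2 / 12) =
     - (cpi R / w1) ^+ 2 * ff (ex v * q ^ (- 0)) - (cpi R / w1) ^+ 2 / 12 - (z ^+ 2)^-1.
    rewrite [ff (q ^ (0 : int))]/ff expr0z subrr expr0n invr0 mulr0 subr0.
    by move: (ff _) (cpi R / w1) (_^-1) => a b c; ring.
  apply: eq_has_sum (has_sumB (has_sumB (rowz 0) row_zero) (has_sum_point (0 : int) (z ^+ 2)^-1)) => m.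
  rewrite /latfam -[0 : int * int]/((0 : int), (0 : int)) xpair_eqE eqxx andbT.
  case: eqP => [->|_]; last by rewrite subr0.
  by rewrite latE /= mul0r addr0 mulr0 subr0 expr0n invr0 subr0 subrr.
have hg := has_sum_fubini hS' rows.
have hf := has_sum_opp (has_fsum q0 q1 (ex_neq0 v) hx).
have hA := has_sum_ff_nome q0 q1.
have h2 := has_sumD (has_sumZ (- (cpi R / w1) ^+ 2) (has_sumB hf hA))
  (has_sum_point (0 : int) (- (z ^+ 2)^-1 - (cpi R / w1) ^+ 2 / 12)).
rewrite (has_sum_unique hg h2).
by move: (fsum _ _) (nomesum _ _) (_^-1) (cpi R / w1) => a b c d; field.
Qed.

(** Averaging over [l] and [- l] leaves [w1 / l^2] plus half of [1/(w1 - l) + 1/(w1 + l)]. Since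
    [w1] is half of the period [2 w1], this last part is a difference of consecutive terms along
    each row and sums to 0. *)
Lemma wzeta_nomesum : wzeta w1 w2 w1 =
  - (cpi R ^+ 2 / w1) * (- 12^-1 + 2 * nomesum (@ff C) q).
Proof.
have q0 := q_neq0; have q1 := q_lt1.
have [S hS] := summable_has_sum (summable_wzeta w1).
rewrite /wzeta (lattice_sumP hS).
have hS1 : has_sum (fun p : int * int => latfam w1 w2 (wzeta_term w1) (p.2, p.1)) S.
  by apply: (has_sum_bij (phi := fun p : int * int => (p.2, p.1)) (psi := fun p : int * int => (p.2, p.1))) hS => -[].
have hS2 : has_sum (fun p : int * int => latfam w1 w2 (wzeta_term w1) (- p.2, - p.1)) S.
  by apply: (has_sum_bij (phi := fun p : int * int => (- p.2, - p.1)) (psi := fun p : int * int => (- p.2, - p.1))) hS => -[a b] /=; rewrite !opprK.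
have hS3 := has_sumZ 2^-1 (has_sumD hS1 hS2).
have SE : 2^-1 * (S + S) = S by field.
rewrite SE in hS3.
pose phi u (m : int) : C := (u + m%:~R)^-1.
have tel u : (forall m : int, u + m%:~R != 0) -> has_sum (fun m => phi u m - phi u (m + 1)) 0.
  move=> hu.
  have s1 := summable_inv_sqr u.
  have s2 : summable (fun m : int => ((u + (m + 1)%:~R) ^+ 2)^-1).
    by apply: (summable_inj (phi := fun m : int => m + 1) _ s1) => m n /addIr.
  have s3 : summable (fun m => phi u m - phi u (m + 1)).
    apply: summable_le_sum s1 s2 => m.
    have h1 := hu m; have h2 := hu (m + 1).
    have -> : phi u m - phi u (m + 1) = (u + m%:~R)^-1 * (u + (m + 1)%:~R)^-1.
      by rewrite /phi intrD in h2 *; rewrite addrA in h2 *; field; rewrite h1 h2.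
    rewrite cmodM !cmodV !cmodX -!exprVn.
    move: (cmod_ge0 (u + m%:~R)) (cmod_ge0 (u + (m + 1)%:~R)).
    rewrite -!(invr_ge0 (cmod _)); set a := (cmod _)^-1; set b := (cmod _)^-1 => ? ?.
    by have := sqr_ge0 (a - b); nra.
  have [d hd] := summable_has_sum s3.
  have lim (s : int) (e : R) : absz s = 1%N -> 0 < e -> exists N, forall n, (N <= n)%N -> cmod (phi u (s * n%:Z) - 0) <= e.
    move=> s0 e0; exists (Num.truncn (cmod u + e^-1)).+1 => n hn.
    have hN : cmod u + e^-1 <= n%:R by apply: le_trans (ltW (truncnS_gt _)) _; rewrite ler_nat.
    rewrite subr0 /phi cmodV -[e]invrK.
    have hc : e^-1 <= cmod (u + (s * n%:Z)%:~R).
      have := cmodD_ge ((s * n%:Z)%:~R) u; rewrite cmod_int abszM s0 mul1n [_%:~R + u]addrC absz_nat; lra.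
    have e1 : 0 < e^-1 by rewrite invr_gt0.
    by rewrite lef_pV2 ?posrE //; exact: lt_le_trans hc.
  suff -> : 0 = d by [].
  rewrite -(subrr 0); symmetry; apply: (has_sum_tel1 hd) => e e0.
    have [N hN] := lim (-1) e erefl e0; exists N => n /hN; by rewrite mulN1r.
  have [N hN] := lim 1 e erefl e0; exists N => n /hN; by rewrite mul1r.
have half0 (n m : int) : 2^-1 + n%:~R * tau + m%:~R != 0.
  have := @lat_neq0 (2 * m + 1, 2 * n); rewrite -[0 : int * int]/((0 : int), (0 : int)) xpair_eqE.
  move=> /(_ ltac:(by lia)); apply: contraNneq => h; rewrite latE /= intrD !intrM.
  have -> : 2 * w1 * (2%:~R * m%:~R + 1%:~R + 2%:~R * n%:~R * tau) =
    4 * w1 * (2^-1 + n%:~R * tau + m%:~R) by field.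
  by rewrite h mulr0.
have rows (n : int) : has_sum (fun m : int => 2^-1 * (latfam w1 w2 (wzeta_term w1) (m, n) +
      latfam w1 w2 (wzeta_term w1) (- m, - n)))
    (- (cpi R ^+ 2 / w1) * ff (q ^ n) +
     (if n == 0 then cpi R ^+ 2 / w1 / 12 - w1^-1 else 0)).
  have h0 := has_sumN (has_sum_shift (-1) (tel _ (half0 n))).
  have h1 := has_sumZ (4 * w1)^-1 h0.
  rewrite oppr0 mulr0 in h1.
  have pt (m : int) : w1 - lat w1 w2 (m, n) = - (2 * w1 * (2^-1 + n%:~R * tau + (m + -1)%:~R)) /\
      w1 + lat w1 w2 (m, n) = 2 * w1 * (2^-1 + n%:~R * tau + m%:~R).
    by rewrite latE /= intrD; split; field.
  have E (m : int) : (4 * w1)^-1 * - (phi (2^-1 + n%:~R * tau) (m + -1) - phi (2^-1 + n%:~R * tau) (m + -1 + 1)) =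
     2^-1 * ((w1 - lat w1 w2 (m, n))^-1 + (w1 + lat w1 w2 (m, n))^-1).
    rewrite addrNK; have [-> ->] := pt m; rewrite /phi.
    have := half0 n (m + -1); have := half0 n m.
    set a := 2^-1 + n%:~R * tau + m%:~R; set b := 2^-1 + n%:~R * tau + (m + -1)%:~R.
    by move: (a) (b) => {}a {}b a0 b0; field; rewrite a0 b0 w10.
  have T (m : int) : ((m, n) == 0) = false ->
      2^-1 * (latfam w1 w2 (wzeta_term w1) (m, n) + latfam w1 w2 (wzeta_term w1) (- m, - n)) =
      w1 * (lat w1 w2 (m, n) ^+ 2)^-1 +
      2^-1 * ((w1 - lat w1 w2 (m, n))^-1 + (w1 + lat w1 w2 (m, n))^-1).
    move=> h; have h' : ((- m, - n) == 0) = false.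
      by move: h; rewrite -[0 : int * int]/((0 : int), (0 : int)) !xpair_eqE !oppr_eq0.
    have lN : lat w1 w2 (- m, - n) = - lat w1 w2 (m, n) by rewrite /lat /= !mulrNz; ring.
    rewrite /latfam h h' lN /wzeta_term opprK sqrrN invrN.
    move: (lat _ _ _) => l; move: (w1 - l)^-1 (w1 + l)^-1 (l ^+ 2)^-1 l^-1 => a b c d.
    by field.
  have [n0|n0] := eqVneq n 0; last first.
    rewrite addr0.
    have -> : - (cpi R ^+ 2 / w1) * ff (q ^ n) = w1 * (- (cpi R / w1) ^+ 2 * ff (q ^ n)) + 0.
      by move: (ff _) => X; field.
    apply: eq_has_sum (has_sumD (has_sumZ w1 (row_inv_sqr n0)) h1) => m.
    by rewrite E T // -[0 : int * int]/((0 : int), (0 : int)) xpair_eqE (negPf n0) andbF.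
  have -> : - (cpi R ^+ 2 / w1) * ff (q ^ n) + (cpi R ^+ 2 / w1 / 12 - w1^-1) =
      w1 * ((cpi R / w1) ^+ 2 / 12) + 0 - w1^-1.
    by rewrite n0 /ff expr0z subrr expr0n invr0 !mulr0; field.
  have hz := row_zero; rewrite -n0 in hz.
  apply: eq_has_sum (has_sumB (has_sumD (has_sumZ w1 hz) h1) (has_sum_point (0 : int) w1^-1)) => m.
  (* At the origin the averaged expression has the value [w1^-1], whereas [latfam] is 0 there; the
     point mass makes up for it. *)
  rewrite E; case: eqP => [->|m0].
    rewrite n0; have -> : latfam w1 w2 (wzeta_term w1) (0, 0) = 0 by [].
    have -> : lat w1 w2 (0, 0) = 0 by rewrite /lat /= !mulr0 addr0.
    by rewrite expr0n invr0 subr0 !addr0 !mulr0; field.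
  rewrite subr0 T // -[0 : int * int]/((0 : int), (0 : int)) xpair_eqE.
  by case: eqP m0.
have hg := has_sum_fubini hS3 rows.
have h2 := has_sumD (has_sumZ (- (cpi R ^+ 2 / w1)) (has_sum_ff_nome q0 q1))
  (has_sum_point (0 : int) (cpi R ^+ 2 / w1 / 12 - w1^-1)).
rewrite (has_sum_unique hg h2).
by move: (nomesum _ _) => b; field.
Qed.

End Fixed.

Lemma lattice_sum_basis w1 w2 w1' w2' (f : C -> C) (phi psi : int * int -> int * int) :
  summable (latfam w1 w2 f) -> cancel phi psi -> cancel psi phi -> phi 0 = 0 ->
  (forall p, lat w1' w2' p = lat w1 w2 (phi p)) ->
  lattice_sum w1' w2' f = lattice_sum w1 w2 f.
Proof.
move=> /summable_has_sum [S hS] k1 k2 phi0 hl.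
rewrite (lattice_sumP hS); apply: lattice_sumP.
apply: eq_has_sum (has_sum_bij k1 k2 hS) => p; rewrite /= /latfam hl.
by rewrite -{1}phi0 (can_eq k1).
Qed.

(** The basis [(- w2, w1)] has [w1] as second half period, so a statement proved at the second half
    period transfers to the first. *)
Lemma wp_swap w1 w2 z : w1 != 0 -> 0 < complex.Im (w2 / w1) ->
  wp (- w2) w1 z = wp w1 w2 z.
Proof.
move=> h1 h2; congr (_ + _).
apply: (lattice_sum_basis (phi := fun p => (p.2, - p.1)) (psi := fun p => (- p.2, p.1))).
- exact: summable_wp.
- by move=> [a b] /=; rewrite opprK.
- by move=> [a b] /=; rewrite opprK.
- by rewrite /= oppr0.
by move=> [a b]; rewrite /lat /= mulrNz; ring.
Qed.

(** The second half period of this basis is [w1 + w2], the third one of the original basis. *)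
Lemma wp_shear w1 w2 z : w1 != 0 -> 0 < complex.Im (w2 / w1) ->
  wp w1 (w1 + w2) z = wp w1 w2 z.
Proof.
move=> h1 h2; congr (_ + _).
apply: (lattice_sum_basis (phi := fun p => (p.1 + p.2, p.2)) (psi := fun p => (p.1 - p.2, p.2))).
- exact: summable_wp.
- by move=> [a b] /=; rewrite addrK.
- by move=> [a b] /=; rewrite subrK.
- by rewrite /= addr0.
by move=> [a b]; rewrite /lat /= intrD; ring.
Qed.

End Lattice.

(** * Directional derivatives of scalar functions *)

Section Calculus.
Variable R : realType.
Local Notation C := R[i].
Variables (V : normedModType C) (x v : V).
Implicit Types f g : V -> C.

Lemma is_deriveP f (d : C) : is_derive x v f d <->
  forall e : R, 0 < e -> exists2 del : R, 0 < del & forall h : C, cmod h < del ->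
    cmod (f (x + h *: v) - f x - d * h) <= e * cmod h.
Proof.
split=> [[dv dE] e e0|H].
  have : (fun h : C => h^-1 *: ((f \o shift x) (h *: v) - f x)) @ 0^' --> d.
    by rewrite -dE; exact: dv.
  move=> /cvg_cmodP /(_ e e0); rewrite near_withinE => /near_cmodP [del del0 h].
  exists del => // k hk; have [->|k0] := eqVneq k 0.
    by rewrite scale0r addr0 subrr sub0r mulr0 cmodN cmod0 mulr0.
  have := h k; rewrite subr0 => /(_ hk k0).
  rewrite /= [k *: v + x]addrC -[_ *: _]/(k^-1 * _) => /ltW.
  have -> : k^-1 * (f (x + k *: v) - f x) - d = k^-1 * (f (x + k *: v) - f x - d * k) by field.
  by rewrite cmodM cmodV mulrC ler_pdivrMr ?cmod_gt0.
suff h : (fun h : C => h^-1 *: ((f \o shift x) (h *: v) - f x)) @ 0^' --> d.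
  by apply: DeriveDef; [apply/cvgP; exact: h | exact: cvg_lim h].
apply/cvg_cmodP => e e0; rewrite near_withinE; apply/near_cmodP.
have [del del0 hd] := H (e / 2) ltac:(lra).
exists del => // k; rewrite subr0 => hk k0.
rewrite /= [k *: v + x]addrC -[_ *: _]/(k^-1 * _).
have -> : k^-1 * (f (x + k *: v) - f x) - d = k^-1 * (f (x + k *: v) - f x - d * k) by field.
have kc : 0 < cmod k by rewrite cmod_gt0.
by rewrite cmodM cmodV mulrC ltr_pdivrMr //; have := hd k hk; nra.
Qed.

Lemma der_unique f d d' : is_derive x v f d -> is_derive x v f d' -> d = d'.
Proof. by move=> [_ <-] [_ <-]. Qed.

Lemma der_eq f d d' : is_derive x v f d -> d = d' -> is_derive x v f d'.
Proof. by move=> h <-. Qed.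

Lemma derD f g a b : is_derive x v f a -> is_derive x v g b ->
  is_derive x v (fun y => f y + g y) (a + b).
Proof. by move=> hf hg; exact: is_deriveD. Qed.

Lemma derB f g a b : is_derive x v f a -> is_derive x v g b ->
  is_derive x v (fun y => f y - g y) (a - b).
Proof. by move=> hf hg; exact: is_deriveB. Qed.

Lemma derM f g a b : is_derive x v f a -> is_derive x v g b ->
  is_derive x v (fun y => f y * g y) (a * g x + f x * b).
Proof.
move=> hf hg; apply: der_eq (is_deriveM hf hg) _.
by rewrite -[_ *: b]/(f x * b) -[_ *: a]/(g x * a) addrC [g x * a]mulrC.
Qed.

Lemma der_cst c : is_derive x v (fun _ => c) (0 : C).
Proof. exact: is_derive_cst. Qed.

Lemma derZ k f a : is_derive x v f a -> is_derive x v (fun y => k * f y) (k * a).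
Proof. by move=> hf; apply: der_eq (derM (der_cst k) hf) _; rewrite mul0r add0r. Qed.

Lemma der_sqr f a : is_derive x v f a -> is_derive x v (fun y => f y ^+ 2) (2 * f x * a).
Proof.
move=> hf; have := derM hf hf => h; apply: der_eq (h) _; ring.
Qed.

(** Of [f] only the derivative along [v] is given, so the chain rule is proved from the two
    remainder estimates, each taking half of [e]. *)
Lemma der_comp f (g : C -> C) a b : is_derive x v f a -> is_derive (f x) 1 g b ->
  is_derive x v (fun y => g (f y)) (b * a).
Proof.
move=> /is_deriveP hf /is_derive_cmod hg; apply/is_deriveP => e e0.
have a0 := cmod_ge0 a; have b0 := cmod_ge0 b.
pose e1 := e / (2 * (cmod a + 1)); pose e2 := Num.min 1 (e / (2 * (cmod b + 1))).
have e10 : 0 < e1 by apply: divr_gt0 => //; lra.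
have e20 : 0 < e2 by rewrite lt_min ltr01; apply: divr_gt0 => //; lra.
have e2l : e2 <= 1 by rewrite /e2 ge_min lexx.
have e2r : e2 * (cmod b + 1) <= e / 2.
  have -> : e / 2 = e / (2 * (cmod b + 1)) * (cmod b + 1) by field; lra.
  by apply: ler_wpM2r; [lra | rewrite /e2 ge_min lexx orbT].
have e1r : e1 * (cmod a + 1) = e / 2 by rewrite /e1; field; lra.
have [d1 d10 h1] := hg e1 e10; have [d2 d20 h2] := hf e2 e20.
exists (Num.min d2 (d1 / (cmod a + 1))).
  by rewrite lt_min d20 divr_gt0 //; lra.
move=> h; rewrite lt_min => /andP[hh1 hh2].
have hc := cmod_ge0 h.
set k := f (x + h *: v) - f x.
have k1 : cmod (k - a * h) <= e2 * cmod h by exact: h2.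
have k2 : cmod k <= (cmod a + 1) * cmod h.
  have -> : k = (k - a * h) + a * h by rewrite subrK.
  by apply: le_trans (cmodD _ _) _; rewrite cmodM; nra.
have k3 : cmod k < d1.
  apply: le_lt_trans k2 _; rewrite mulrC -ltr_pdivlMr //; lra.
have k4 := h1 k k3.
have -> : f (x + h *: v) = f x + k by rewrite /k [RHS]addrC subrK.
have -> : g (f x + k) - g (f x) - b * a * h = (g (f x + k) - g (f x) - b * k) + b * (k - a * h) by ring.
apply: le_trans (cmodD _ _) _; rewrite cmodM.
have : cmod b * cmod (k - a * h) <= cmod b * (e2 * cmod h) by apply: ler_wpM2l.
have : e1 * cmod k <= e1 * ((cmod a + 1) * cmod h) by apply: ler_wpM2l => //; exact: ltW.
have : e1 * ((cmod a + 1) * cmod h) = e / 2 * cmod h by rewrite mulrA e1r.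
have : cmod b * (e2 * cmod h) <= e / 2 * cmod h by rewrite mulrA; apply: ler_wpM2r => //; nra.
lra.
Qed.

Lemma der_near f g d : (exists2 del : R, 0 < del & forall h : C, cmod h < del ->
    f (x + h *: v) = g (x + h *: v)) -> is_derive x v f d -> is_derive x v g d.
Proof.
move=> [d1 d10 h1] /is_deriveP hf; apply/is_deriveP => e e0.
have [d2 d20 h2] := hf e e0; exists (Num.min d1 d2); first by rewrite lt_min d10.
move=> h; rewrite lt_min => /andP[a b]; rewrite -h1 //.
have := h1 0; rewrite cmod0 scale0r addr0 => <- //; exact: h2.
Qed.

End Calculus.

Section Calculus1.
Variable R : realType.
Local Notation C := R[i].
Implicit Types z w : C.

Lemma der_affine z (k c : C) : is_derive z 1 (fun t => k * t + c) k.
Proof.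
apply: (@is_derive_quad R _ _ _ 0 1) => // h _.
by rewrite (_ : _ - _ = 0) ?cmod0 ?mul0r //; ring.
Qed.

Lemma derV z : z != 0 -> is_derive z 1 (fun t => t^-1) (- (z ^+ 2)^-1).
Proof.
move=> z0; have zc : 0 < cmod z by rewrite cmod_gt0.
apply: (@is_derive_quad R _ _ _ (2 / cmod z ^+ 3) (cmod z / 2)); first lra.
move=> h hh; have h1 : cmod z / 2 <= cmod (z + h) by have := cmodD_ge z h; lra.
have zh : z + h != 0 by rewrite -cmod_gt0; lra.
have -> : (z + h)^-1 - z^-1 - - (z ^+ 2)^-1 * h = h ^+ 2 / (z ^+ 2 * (z + h)).
  by field; rewrite z0 zh.
rewrite cmodM cmodV (cmodM (z ^+ 2)) !cmodX mulrC; apply: ler_wpM2r; first by rewrite exprn_ge0 ?cmod_ge0.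
have p1 : 0 < cmod z ^+ 2 * cmod (z + h) by rewrite mulr_gt0 ?exprn_gt0 // cmod_gt0.
rewrite -[leLHS]mul1r ler_pdivrMr // mulrAC ler_pdivlMr ?exprn_gt0 // mul1r.
by have : 0 < cmod z ^+ 2 by [rewrite exprn_gt0]; rewrite exprS; nra.
Qed.

Lemma der_ex z : is_derive z 1 (@ex R) (2 * cpi R * ii R * ex z).
Proof.
have h1 := der_affine z (2 * cpi R * ii R) 0.
have h2 := is_derive_cexp (2 * cpi R * ii R * z + 0).
have h := der_comp h1 h2.
apply: der_near (der_eq h _); last by rewrite addr0 mulrC.
by exists 1 => // k _; rewrite addr0.
Qed.

End Calculus1.

(** * The Halphen system *)

Section NomeDerive.
Variable R : realType.
Local Notation C := R[i].
Implicit Types r z w : C.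

(** One induction carries both bounds: the next remainder is [r0] times the present remainder plus
    [h] times the present increment. *)
Lemma powers_quad (rho : R) r0 h (n : nat) : 0 < rho -> cmod r0 <= rho -> cmod (r0 + h) <= rho ->
  cmod ((r0 + h) ^+ n.+1 - r0 ^+ n.+1) <= n.+1%:R * rho ^+ n * cmod h /\
  cmod ((r0 + h) ^+ n.+1 - r0 ^+ n.+1 - n.+1%:R * r0 ^+ n * h)
    <= n.+1%:R ^+ 2 * rho ^+ n / rho * cmod h ^+ 2.
Proof.
move=> p0 h0 h1; have hc := cmod_ge0 h.
elim: n => [|n [IH1 IH2]].
  rewrite !expr1 !expr0 !mulr1 !mul1r addrAC subrr add0r subrr cmod0; split=> //.
  by rewrite mulr_ge0 ?exprn_ge0 // ?mulr_ge0 ?expr1n ?invr_ge0 // ltW.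
have rn : 0 <= rho ^+ n by rewrite exprn_ge0 // ltW.
set A := _ - _ in IH1 IH2; set B := A - _ in IH2.
have EA : (r0 + h) ^+ n.+2 - r0 ^+ n.+2 = (r0 + h) * A + h * r0 ^+ n.+1.
  by rewrite /A (exprS _ n.+1) (exprS r0 n.+1); ring.
have EB : (r0 + h) ^+ n.+2 - r0 ^+ n.+2 - n.+2%:R * r0 ^+ n.+1 * h = r0 * B + h * A.
  rewrite EA /B -[n.+2]addn1 natrD (exprS r0 n); ring.
have r0n : cmod (r0 ^+ n.+1) <= rho ^+ n.+1.
  by rewrite cmodX lerXn2r ?nnegrE ?cmod_ge0 // ltW.
split.
  rewrite EA; apply: le_trans (cmodD _ _) _; rewrite !cmodM.
  have : cmod (r0 + h) * cmod A <= rho * (n.+1%:R * rho ^+ n * cmod h).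
    by apply: ler_pM; rewrite ?cmod_ge0.
  have : cmod h * cmod (r0 ^+ n.+1) <= cmod h * rho ^+ n.+1 by exact: ler_wpM2l.
  rewrite -[n.+2]addn1 natrD !(exprS rho n); lra.
rewrite EB; apply: le_trans (cmodD _ _) _; rewrite !cmodM.
have k1 : cmod r0 * cmod B <= rho * (n.+1%:R ^+ 2 * rho ^+ n / rho * cmod h ^+ 2).
  by apply: ler_pM; rewrite ?cmod_ge0.
have k2 : cmod h * cmod A <= cmod h * (n.+1%:R * rho ^+ n * cmod h) by exact: ler_wpM2l.
have e1 : rho * (n.+1%:R ^+ 2 * rho ^+ n / rho * cmod h ^+ 2) = n.+1%:R ^+ 2 * (rho ^+ n * cmod h ^+ 2).
  by field; lra.
have e2 : n.+2%:R ^+ 2 * rho ^+ n.+1 / rho * cmod h ^+ 2 = (n.+1%:R + 1) ^+ 2 * (rho ^+ n * cmod h ^+ 2).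
  by rewrite -[n.+2]addn1 natrD (exprS rho n); field; lra.
rewrite e2; rewrite e1 in k1.
have u0 : 0 <= rho ^+ n * cmod h ^+ 2 by rewrite mulr_ge0 // exprn_ge0.
have n0 : 0 <= n.+1%:R :> R by rewrite ler0n.
have e3 : cmod h * (n.+1%:R * rho ^+ n * cmod h) = n.+1%:R * (rho ^+ n * cmod h ^+ 2) by ring.
rewrite e3 in k2; nra.
Qed.

Lemma summable_poly2 (rho : R) : 0 < rho < 1 ->
  summable (fun n : nat => ((n.+1%:R ^+ 2 * rho ^+ n) : R)%:C%C).
Proof.
move=> hr.
have g : geob (fun n : int => n%:~R * (n%:~R * ((rho ^+ absz n) : R)%:C%C)).
  apply: geob_natmul; apply: geob_natmul; exists rho, 1; split => // n.
  by rewrite mul1r cmod_real ger0_norm // exprn_ge0 //; lra.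
have h := summable_inj (phi := fun n : nat => n.+1%:Z) ltac:(by move=> m n []) (geob_summable g).
apply: eq_summable (summableZ (rho^-1)%:C%C h) => n /=.
rewrite -pmulrn -(rmorph_nat (real_complex R)) -!rmorphM; congr (_%:C)%C.
by rewrite exprS; field; lra.
Qed.

(** The Euler operator [r d/dr] applied term by term to [nomesum phi r], with [dphi] in the role of
    the derivative of [phi]. *)
Definition theta_sum (dphi : C -> C) r := tsum (fun n : nat => n.+1%:R * r ^+ n.+1 * dphi (r ^+ n.+1)).

(** The quadratic remainders of [phi] and of the powers combine into a term bounded by a multiple of
    [n^2 rho^n |h|^2], uniformly for small [h], so the remainder of the sum is again quadratic. *)
Lemma der_nomesum (phi dphi : C -> C) (M rho : R) r0 : cmod r0 < rho -> rho < 1 -> r0 != 0 ->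
  (forall z, cmod z <= rho -> cmod (phi z) <= M * cmod z) ->
  (forall z, cmod z <= rho -> cmod (dphi z) <= M) ->
  (forall z w, cmod z <= rho -> cmod w <= rho ->
     cmod (phi z - phi w - dphi w * (z - w)) <= M * cmod (z - w) ^+ 2) ->
  [/\ has_sum (fun n : nat => n.+1%:R * r0 ^+ n.+1 * dphi (r0 ^+ n.+1)) (theta_sum dphi r0) &
      is_derive r0 1 (nomesum phi) (r0^-1 * theta_sum dphi r0)].
Proof.
move=> hr rho1 r00 H1 H2 H3.
have p0 : 0 < rho by have := cmod_ge0 r0; lra.
have M0 : 0 <= M by apply: le_trans (cmod_ge0 _) (H2 0 _); rewrite cmod0 ltW.
have [K hK] := summable_poly2 (rho := rho) ltac:(lra).
have small (r : C) n : cmod r <= rho -> cmod (r ^+ n.+1) <= rho.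
  move=> h; rewrite cmodX exprS; apply: (le_trans _ h); apply: ler_piMr; first exact: cmod_ge0.
  by apply: exprn_ile1; [exact: cmod_ge0 | apply: (le_trans h); exact: ltW].
have cr (n : nat) : cmod (((n.+1%:R ^+ 2 * rho ^+ n) : R)%:C%C) = n.+1%:R ^+ 2 * rho ^+ n.
  by rewrite cmod_real ger0_norm // mulr_ge0 ?exprn_ge0 // ltW.
have sd : summable (fun n : nat => n.+1%:R * r0 ^+ n.+1 * dphi (r0 ^+ n.+1)).
  exists (M * rho * K).
  apply: (summable_le (b := fun n => (M * rho)%:C%C * ((n.+1%:R ^+ 2 * rho ^+ n) : R)%:C%C)).
    move=> n; rewrite !cmodM cr cmod_real cmod_nat ger0_norm ?mulr_ge0 //; last exact: ltW.
    have h1 : cmod (dphi (r0 ^+ n.+1)) <= M by apply: H2; apply: small; exact: ltW.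
    have h2 : cmod (r0 ^+ n.+1) <= rho * rho ^+ n.
      by rewrite -exprS cmodX lerXn2r ?nnegrE ?cmod_ge0 // ltW.
    have h3 : n.+1%:R * cmod (r0 ^+ n.+1) <= n.+1%:R ^+ 2 * (rho * rho ^+ n).
      apply: ler_pM => //; rewrite ?cmod_ge0 // expr2 ler_peMr // ler1n //.
    have := ler_pM (mulr_ge0 (ler0n _ n.+1) (cmod_ge0 _)) (cmod_ge0 _) h3 h1.
    lra.
  have := summable_byZ (M * rho)%:C%C hK.
  by rewrite cmod_real ger0_norm ?mulr_ge0 // ltW.
have hd := has_tsum sd; split; first exact: hd.
apply: (@is_derive_quad R _ _ _ (M * (1 + rho^-1) * K) (rho - cmod r0)); first lra.
move=> h hh.
have hr' : cmod (r0 + h) <= rho by have := cmodD r0 h; lra.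
have [hs0 _] := has_nomesum rho1 (ltW hr) H1.
have [hs1 _] := has_nomesum rho1 hr' H1.
have hrem := has_sumB (has_sumB hs1 hs0) (has_sumZr h (has_sumZ r0^-1 hd)).
have -> : M * (1 + rho^-1) * K * cmod h ^+ 2 = (M * (1 + rho^-1) * cmod h ^+ 2) * K by ring.
have pos : 0 <= M * (1 + rho^-1) * cmod h ^+ 2.
  by rewrite !mulr_ge0 ?exprn_ge0 ?cmod_ge0 // addr_ge0 // invr_ge0 ltW.
apply: has_sum_le hrem.
have := summable_byZ (M * (1 + rho^-1) * cmod h ^+ 2)%:C%C hK.
rewrite cmod_real ger0_norm //; apply: summable_le => n.
rewrite cmodM cr cmod_real ger0_norm //.
have [q1 q2] := powers_quad n p0 (ltW hr) hr'.
set z := (r0 + h) ^+ n.+1 in q1 q2 *; set w := r0 ^+ n.+1 in q1 q2 *.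
have E : phi z - phi w - r0^-1 * (n.+1%:R * w * dphi w) * h =
   (phi z - phi w - dphi w * (z - w)) + dphi w * (z - w - n.+1%:R * r0 ^+ n * h).
  have -> : r0^-1 * (n.+1%:R * w * dphi w) * h = dphi w * (n.+1%:R * r0 ^+ n * h).
    by rewrite /w exprS; move: (dphi _) => X; field.
  by ring.
rewrite E; apply: le_trans (cmodD _ _) _; rewrite cmodM.
have k1 := H3 z w (small _ _ hr') (small _ _ (ltW hr)).
have k2 := H2 w (small _ _ (ltW hr)).
have N0 : 0 <= n.+1%:R :> R by rewrite ler0n.
have rn0 : 0 <= rho ^+ n by rewrite exprn_ge0 // ltW.
have rn1 : rho ^+ n <= 1 by apply: exprn_ile1; lra.
have c2 : 0 <= cmod h ^+ 2 by rewrite exprn_ge0 ?cmod_ge0.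
have k3 : cmod (z - w) ^+ 2 <= n.+1%:R ^+ 2 * rho ^+ n * cmod h ^+ 2.
  apply: (@le_trans _ _ ((n.+1%:R * rho ^+ n * cmod h) ^+ 2)).
    by rewrite lerXn2r ?nnegrE ?cmod_ge0 // !mulr_ge0 ?cmod_ge0.
  rewrite !exprMn; apply: ler_wpM2r => //; apply: ler_wpM2l; first by rewrite exprn_ge0.
  by rewrite expr2; nra.
have k4 := ler_pM (cmod_ge0 _) (cmod_ge0 _) k2 q2.
have k5 : M * cmod (z - w) ^+ 2 <= M * (n.+1%:R ^+ 2 * rho ^+ n * cmod h ^+ 2) by exact: ler_wpM2l.
lra.
Qed.

(** [dgI] and [dfN] are the derivatives of [gg (i z)] and [ff (- z)], the terms of [sg] and of
    [b1]. *)
Definition dgI z : C := 'i%C * (1 - z ^+ 2) / (1 + z ^+ 2) ^+ 2.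
Definition dfN z : C := - (1 - z) / (1 + z) ^+ 3.

(** The three hypotheses of [der_nomesum] with one constant: [|1 + z^2| >= 1 - rho] on the disc, and
    the Taylor remainder is an explicit rational function with factor [(z - w)^2]. *)
Lemma dgI_bounds (rho : R) : 0 < rho < 1 -> exists M : R,
  [/\ forall z, cmod z <= rho -> cmod (gg ('i%C * z)) <= M * cmod z,
      forall z, cmod z <= rho -> cmod (dgI z) <= M &
      forall z w, cmod z <= rho -> cmod w <= rho ->
       cmod (gg ('i%C * z) - gg ('i%C * w) - dgI w * (z - w)) <= M * cmod (z - w) ^+ 2].
Proof.
move=> /andP[p0 p1]; set k := 1 - rho.
have k0 : 0 < k by rewrite /k; lra.
have k1 : k <= 1 by rewrite /k; lra.
have ki : 1 <= k^-1 by rewrite invf_ge1.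
have I1 : cmod ('i%C : C) = 1 by rewrite /cmod /= expr0n expr1n add0r sqrtr1.
have lowz (z : C) : cmod z <= rho -> k <= cmod (1 + z ^+ 2).
  move=> hz; have := cmodD_ge 1 (z ^+ 2); rewrite cmod1 cmodX /k.
  by have : cmod z ^+ 2 <= rho by [rewrite expr2; have := cmod_ge0 z; nra]; lra.
have kn n : k^-1 <= k^-1 ^+ n.+1.
  by rewrite exprS ler_peMr ?invr_ge0 ?(ltW k0) // exprn_ege1.
exists (4 * k^-1 ^+ 3).
have kp n : 0 < k^-1 ^+ n by rewrite exprn_gt0 // invr_gt0.
split.
- move=> z hz; apply: le_trans (ggI_le p1 hz) _; apply: ler_wpM2r; first exact: cmod_ge0.
  by have := kn 2%N; have := kp 3%N; lra.
- move=> z hz; rewrite /dgI cmodM cmodV cmodX (cmodM 'i%C) I1 mul1r.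
  have h1 := lowz z hz.
  have h2 : cmod (1 - z ^+ 2) <= 2.
    apply: le_trans (cmodD _ _) _; rewrite cmod1 cmodN cmodX.
    by have : cmod z ^+ 2 <= 1 by [rewrite expr2; have := cmod_ge0 z; nra]; lra.
  have h3 : (cmod (1 + z ^+ 2) ^+ 2)^-1 <= k^-1 ^+ 3.
    apply: (@le_trans _ _ (k^-1 ^+ 2)); last first.
      by rewrite [leRHS]exprS; apply: ler_peMl => //; exact: ltW.
    rewrite exprVn lef_pV2 ?posrE ?exprn_gt0 //; last exact: lt_le_trans h1.
    by rewrite lerXn2r ?nnegrE ?cmod_ge0 // ltW.
  have := ler_pM (cmod_ge0 _) _ h2 h3; rewrite invr_ge0 exprn_ge0 ?cmod_ge0 // => /(_ isT).
  by have := kp 3%N; lra.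
move=> z w hz hw.
have hz1 := lowz z hz; have hw1 := lowz w hw.
have z0 : 1 + z ^+ 2 != 0 by rewrite -cmod_gt0; lra.
have w0 : 1 + w ^+ 2 != 0 by rewrite -cmod_gt0; lra.
have E : gg ('i%C * z) - gg ('i%C * w) - dgI w * (z - w) =
   'i%C * ((z - w) ^+ 2 * (z * w ^+ 2 - 2 * w - z)) / ((1 + z ^+ 2) * (1 + w ^+ 2) ^+ 2).
  rewrite /gg /dgI !(exprMn 2 ('i%C : C)) I2 !mulN1r !opprK.
  by move: ('i%C : C) => i; field; rewrite z0 w0.
rewrite E cmodM cmodV (cmodM 'i%C) I1 mul1r (cmodM (_ ^+ 2)) (cmodM (1 + _)) !cmodX.
rewrite mulrC mulrCA mulrC; apply: ler_wpM2r; first by rewrite exprn_ge0 ?cmod_ge0.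
have n1 : cmod (z * w ^+ 2 - 2 * w - z) <= 4.
  apply: le_trans (cmodD _ _) _; rewrite cmodN.
  apply: le_trans (lerD (cmodD _ _) (lexx _)) _; rewrite cmodN (cmodM z) (cmodM 2) cmod_nat cmodX.
  have zc := cmod_ge0 z; have wc := cmod_ge0 w.
  have : cmod w ^+ 2 <= 1 by rewrite expr2; nra.
  have : 0 <= cmod w ^+ 2 by rewrite exprn_ge0.
  nra.
rewrite mulrC; apply: ler_pM => //; rewrite ?cmod_ge0 ?invr_ge0 ?mulr_ge0 ?exprn_ge0 ?cmod_ge0 //.
rewrite exprVn lef_pV2 ?posrE ?exprn_gt0 ?mulr_gt0 ?exprn_gt0 ?cmod_gt0 //.
rewrite exprS; apply: ler_pM => //; [exact: ltW | by rewrite exprn_ge0 // ltW | ].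
by rewrite lerXn2r ?nnegrE ?cmod_ge0 // ltW.
Qed.

Lemma dfN_bounds (rho : R) : 0 < rho < 1 -> exists M : R,
  [/\ forall z, cmod z <= rho -> cmod (ff (- z)) <= M * cmod z,
      forall z, cmod z <= rho -> cmod (dfN z) <= M &
      forall z w, cmod z <= rho -> cmod w <= rho ->
       cmod (ff (- z) - ff (- w) - dfN w * (z - w)) <= M * cmod (z - w) ^+ 2].
Proof.
move=> /andP[p0 p1]; set k := 1 - rho.
have k0 : 0 < k by rewrite /k; lra.
have k1 : k <= 1 by rewrite /k; lra.
have ki : 1 <= k^-1 by rewrite invf_ge1.
have lowz (z : C) : cmod z <= rho -> k <= cmod (1 + z).
  by move=> hz; have := cmodD_ge 1 z; rewrite cmod1 /k; lra.
have upz (z : C) : cmod z <= rho -> cmod (1 + z) <= 2.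
  by move=> hz; apply: le_trans (cmodD _ _) _; rewrite cmod1; lra.
have kp n : 0 < k^-1 ^+ n by rewrite exprn_gt0 // invr_gt0.
have kn m n : (m <= n)%N -> k^-1 ^+ m <= k^-1 ^+ n.
  by move=> mn; apply: ler_weXn2l.
exists (10 * k^-1 ^+ 5); split.
- move=> z hz; have := @ff_le R _ (- z) p1; rewrite cmodN => /(_ hz) h.
  apply: le_trans h _; apply: ler_wpM2r; first exact: cmod_ge0.
  by rewrite -/k -exprVn; have := kn 2%N 5%N isT; have := kp 5%N; lra.
- move=> z hz; rewrite /dfN cmodM cmodV cmodX cmodN.
  have h1 := lowz z hz.
  have h2 : cmod (1 - z) <= 2.
    by apply: le_trans (cmodD _ _) _; rewrite cmod1 cmodN; lra.
  have h3 : (cmod (1 + z) ^+ 3)^-1 <= k^-1 ^+ 5.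
    apply: le_trans (kn 3%N 5%N isT); rewrite exprVn lef_pV2 ?posrE ?exprn_gt0 //; last exact: lt_le_trans h1.
    by rewrite lerXn2r ?nnegrE ?cmod_ge0 // ltW.
  have := ler_pM (cmod_ge0 _) _ h2 h3; rewrite invr_ge0 exprn_ge0 ?cmod_ge0 // => /(_ isT).
  by have := kp 5%N; lra.
move=> z w hz hw.
have hz1 := lowz z hz; have hw1 := lowz w hw.
have z0 : 1 + z != 0 by rewrite -cmod_gt0; lra.
have w0 : 1 + w != 0 by rewrite -cmod_gt0; lra.
have E : ff (- z) - ff (- w) - dfN w * (z - w) =
   - ((z - w) ^+ 2 * ((1 + w) * (1 + z) - 2 * (1 + z) - (1 + w))) / ((1 + z) ^+ 2 * (1 + w) ^+ 3).
  by rewrite /ff /dfN !opprK; field; rewrite z0 w0.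
rewrite E cmodM cmodV cmodN (cmodM ((z - w) ^+ 2)) (cmodM ((1 + z) ^+ 2)) !cmodX.
rewrite -mulrA mulrC; apply: ler_wpM2r; first by rewrite exprn_ge0 ?cmod_ge0.
have n1 : cmod ((1 + w) * (1 + z) - 2 * (1 + z) - (1 + w)) <= 10.
  apply: le_trans (cmodD _ _) _; rewrite cmodN.
  apply: le_trans (lerD (cmodD _ _) (lexx _)) _; rewrite cmodN !cmodM cmod_nat.
  have := upz z hz; have := upz w hw; have := cmod_ge0 (1 + z); have := cmod_ge0 (1 + w); nra.
apply: ler_pM => //; rewrite ?cmod_ge0 ?invr_ge0 ?mulr_ge0 ?exprn_ge0 ?cmod_ge0 //.
rewrite exprVn lef_pV2 ?posrE ?exprn_gt0 ?mulr_gt0 ?exprn_gt0 ?cmod_gt0 //.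
rewrite -[5%N]/(2 + 3)%N exprD; apply: ler_pM; [by rewrite exprn_ge0 // ltW | by rewrite exprn_ge0 // ltW | | ].
  by rewrite lerXn2r ?nnegrE ?cmod_ge0 // ltW.
by rewrite lerXn2r ?nnegrE ?cmod_ge0 // ltW.
Qed.

End NomeDerive.

(** * The functions [b_k] on the upper half plane *)

Section Halphen.
Variable R : realType.
Local Notation C := R[i].
Local Notation I := ('i%C : C).
Local Notation tpi := (2 * cpi R * ii R).
Implicit Types t tau : C.

Definition uhp tau : Prop := 0 < complex.Im tau.
Definition rr tau : C := ex (tau / 2).
Definition beta1 tau := b1 (rr tau).
Definition beta2 tau := b2 (rr tau).
Definition beta3 tau := b3 (rr tau).
Definition sigma tau := sg (rr tau).

Lemma rr_neq0 tau : rr tau != 0. Proof. exact: ex_neq0. Qed.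

Lemma rr_sqr tau : rr tau ^+ 2 = ex tau.
Proof. by rewrite /rr -ex_nat; congr ex; field. Qed.

Lemma ex_lt1 tau : uhp tau -> cmod (ex tau) < 1.
Proof.
by move=> h; rewrite cmod_ex expR_lt1 mulNr oppr_lt0 mulr_gt0 // mulrn_wgt0 //; exact: pi_gt0.
Qed.

Lemma rr_lt1 tau : uhp tau -> cmod (rr tau) < 1.
Proof.
move=> h; rewrite ltNge; apply/negP => h1.
by have := ex_lt1 h; rewrite -rr_sqr cmodX ltNge exprn_ege1.
Qed.

Lemma rr_add1 tau : rr (tau + 1) = - rr tau.
Proof. by rewrite /rr mulrDl exD mul1r ex_half mulrN1. Qed.

Lemma rr_double tau : rr (2 * tau) = rr tau ^+ 2.
Proof. by rewrite rr_sqr /rr; congr ex; field. Qed.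

Lemma uhpD1 tau : uhp tau -> uhp (tau + 1).
Proof. by rewrite /uhp ImD /= addr0. Qed.

Lemma uhp_nat n tau : uhp tau -> uhp (n.+1%:R * tau).
Proof.
rewrite /uhp => h; have -> : (n.+1%:R : C) = (n.+1%:R : R)%:C%C by rewrite rmorph_nat.
case: tau h => a b /= b0; rewrite mul0r addr0 mulr_gt0 //.
Qed.

Lemma uhp2 tau : uhp tau -> uhp (2 * tau). Proof. exact: (@uhp_nat 1). Qed.

Lemma uhp_near tau h : cmod h < complex.Im tau -> uhp (tau + h).
Proof.
by rewrite /uhp ImD; have := cmod_ge_Im h; rewrite ler_norml => /andP[]; lra.
Qed.

Lemma der_uhp (f g : C -> C) d tau : uhp tau -> (forall t, uhp t -> f t = g t) ->
  is_derive tau 1 f d -> is_derive tau 1 g d.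
Proof.
move=> h fg; apply: der_near; exists (complex.Im tau) => // k hk.
by rewrite -[k *: 1]/(k * 1) mulr1; apply: fg; exact: uhp_near.
Qed.

Lemma beta1D1 tau : beta1 (tau + 1) = beta1 tau. Proof. by rewrite /beta1 rr_add1 b1N. Qed.
Lemma beta2D1 tau : beta2 (tau + 1) = beta3 tau. Proof. by rewrite /beta2 rr_add1 b2N. Qed.
Lemma beta3D1 tau : beta3 (tau + 1) = beta2 tau. Proof. by rewrite /beta3 rr_add1 b3N. Qed.

Lemma sigma_sqr tau : uhp tau -> sigma tau ^+ 2 = beta1 tau - beta2 tau.
Proof. by move=> h; apply: sg_sqr; [exact: rr_neq0 | exact: rr_lt1]. Qed.

Lemma sigma1_sqr tau : uhp tau -> sigma (tau + 1) ^+ 2 = beta1 tau - beta3 tau.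
Proof. by move=> h; rewrite sigma_sqr ?beta1D1 ?beta2D1 //; exact: uhpD1. Qed.

Lemma sigma_neq0 tau : uhp tau -> sigma tau != 0.
Proof. by move=> h; apply: sg_neq0; [exact: rr_neq0 | exact: rr_lt1]. Qed.

Lemma der_rr tau : is_derive tau 1 rr (cpi R * ii R * rr tau).
Proof.
have h := der_comp (der_affine tau 2^-1 0) (der_ex (2^-1 * tau + 0)).
have E t : 2^-1 * t + 0 = t / 2 by rewrite addr0 mulrC.
apply: der_near (der_eq h _).
  by exists 1 => // k _; rewrite /rr E.
by rewrite E -/(rr tau); move: (rr tau) => X; field.
Qed.

(** [sg_theta_nat] evaluates the Euler derivative as [r d/dr sg = - 2 b3 sg], and
    [r = exp (pi i tau)] contributes the factor [pi i]. *)
Lemma der_sigma tau : uhp tau -> is_derive tau 1 sigma (- tpi * beta3 tau * sigma tau).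
Proof.
move=> ht; have r1 := rr_lt1 ht; have r0 := rr_neq0 tau; have rc := cmod_ge0 (rr tau).
pose rho := (cmod (rr tau) + 1) / 2.
have [M [H1 H2 H3]] := @dgI_bounds R rho ltac:(rewrite /rho; lra).
have [hs hd] := der_nomesum (M := M) (rho := rho) (r0 := rr tau) ltac:(rewrite /rho; lra)
  ltac:(rewrite /rho; lra) r0 H1 H2 H3.
have E : theta_sum (@dgI R) (rr tau) = - (sg (rr tau) * b3 (rr tau)).
  have hg : has_sum (fun n : nat => n.+1%:R * gx (I * rr tau ^+ n.+1)) (2^-1 * theta_sum (@dgI R) (rr tau)).
    apply: eq_has_sum (has_sumZ 2^-1 hs) => n; rewrite -mulrA mulrCA; congr (_ * _).
    rewrite /gx /dgI !(exprMn 2 I) I2 !mulN1r !opprK.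
    move: (rr tau ^+ n.+1) => z; move: ((1 + z ^+ 2) ^+ 2) => w.
    by rewrite invfM; move: w^-1 => {}w; field.
  by rewrite -(sg_theta_nat r0 r1 hg) mulrA divff ?mul1r // pnatr_eq0.
have h := derD (der_cst tau (1 : C) (I / 2)) (derZ 2 (der_comp (der_rr tau) hd)).
apply: (der_uhp ht _ (der_eq h _)).
  by move=> t ut; rewrite /sigma sg_nomesum ?rr_neq0 //; exact: rr_lt1.
rewrite E -/(sigma tau) -/(beta3 tau); move: (sigma tau) (beta3 tau) (rr tau) r0 => s b r r0.
by field.
Qed.

Lemma der_beta1 tau : uhp tau -> is_derive tau 1 beta1 (tpi * (2 * theta_sum (@dfN R) (ex tau))).
Proof.
move=> ht; have r1 := ex_lt1 ht; have r0 := ex_neq0 tau; have rc := cmod_ge0 (ex tau).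
pose rho := (cmod (ex tau) + 1) / 2.
have [M [H1 H2 H3]] := @dfN_bounds R rho ltac:(rewrite /rho; lra).
have [hs hd] := der_nomesum (M := M) (rho := rho) (r0 := ex tau) ltac:(rewrite /rho; lra)
  ltac:(rewrite /rho; lra) r0 H1 H2 H3.
have h := derD (der_cst tau (1 : C) (- 4^-1)) (derZ 2 (der_comp (der_ex tau) hd)).
apply: (der_uhp ht _ (der_eq h _)).
  by move=> t ut; rewrite /beta1 b1E rr_sqr fsumN1_nomesum ?ex_neq0 //; exact: ex_lt1.
move: (ex tau) r0 => r r0.
by field.
Qed.

Lemma der_beta2 tau : uhp tau -> is_derive tau 1 beta2
  (tpi * (2 * theta_sum (@dfN R) (ex tau) + 2 * beta3 tau * sigma tau ^+ 2)).
Proof.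
move=> ht; have h := derB (der_beta1 ht) (der_sqr (der_sigma ht)).
apply: (der_uhp ht _ (der_eq h _)).
  by move=> t ut; rewrite sigma_sqr // opprB addrC subrK.
by move: (theta_sum _ _) (beta3 tau) (sigma tau) => a b c; ring.
Qed.

Lemma der_sigma1 tau : uhp tau ->
  is_derive tau 1 (fun t => sigma (t + 1)) (- tpi * beta2 tau * sigma (tau + 1)).
Proof.
move=> ht.
have h0 := der_affine tau 1 1.
have E t : 1 * t + 1 = t + 1 by rewrite mul1r.
have hd : is_derive (1 * tau + 1) 1 sigma (- tpi * beta3 (tau + 1) * sigma (tau + 1)).
  by rewrite E; apply: der_sigma; exact: uhpD1.
have h := der_comp h0 hd; apply: (der_near _ (der_eq h _)); last by rewrite beta3D1 mulr1.
exists 1; [exact: ltr01 | move=> k _; exact: (congr1 sigma (E _))].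
Qed.

Lemma der_beta3 tau : uhp tau -> is_derive tau 1 beta3
  (tpi * (2 * theta_sum (@dfN R) (ex tau) + 2 * beta2 tau * sigma (tau + 1) ^+ 2)).
Proof.
move=> ht; have h := derB (der_beta1 ht) (der_sqr (der_sigma1 ht)).
apply: (der_uhp ht _ (der_eq h _)).
  by move=> t ut; rewrite sigma1_sqr // opprB addrC subrK.
by move: (theta_sum _ _) (beta2 tau) (sigma _) => a b c; ring.
Qed.

(** Since [sigma^2 = beta1 - beta2] and [sigma (tau + 1)^2 = beta1 - beta3], its vanishing is the
    Halphen equation for [beta1]; the derivatives of the two squares then give the equations for
    [beta2] and [beta3]. *)
Definition defect tau : C :=
  2 * theta_sum (@dfN R) (ex tau) + beta1 tau ^+ 2 - (sigma tau * sigma (tau + 1)) ^+ 2.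

(** Both sides of [beta2 + beta3 = 4 beta2 (2 tau)] are differentiated; the arithmetic-geometric
    mean relations between [tau] and [2 tau] reduce the resulting equality to the one between the
    defects. *)
Lemma defect_double tau : uhp tau -> defect tau = 4 * defect (2 * tau).
Proof.
move=> ht; have ht2 := uhp2 ht.
have r1 := rr_lt1 ht; have r0 := rr_neq0 tau.
have e1 := sigma_sqr ht; have e2 := sigma1_sqr ht.
have e3 := sigma_sqr ht2; have e4 := sigma1_sqr ht2.
have e5 : sigma tau + sigma (tau + 1) = 2 * sigma (2 * tau).
  by rewrite /sigma rr_add1 rr_double; exact: sg_arith.
have e6 : sigma tau * sigma (tau + 1) = sigma (2 * tau + 1) ^+ 2.
  by rewrite /sigma !rr_add1 rr_double; exact: sg_geom.
have e8 : beta1 tau = beta1 (2 * tau) + beta3 (2 * tau).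
  by rewrite /beta1 /beta3 rr_double; exact: b1_double.
have hl := derD (der_beta2 ht) (der_beta3 ht).
have hr : is_derive tau 1 (fun t => beta2 t + beta3 t)
   (4 * (tpi * (2 * theta_sum (@dfN R) (ex (2 * tau)) + 2 * beta3 (2 * tau) * sigma (2 * tau) ^+ 2) * 2)).
  have h2 : is_derive (2 * tau + 0) 1 beta2 (tpi * (2 * theta_sum (@dfN R) (ex (2 * tau)) +
      2 * beta3 (2 * tau) * sigma (2 * tau) ^+ 2)).
    by rewrite addr0; exact: der_beta2.
  apply: der_uhp ht _ (derZ 4 (der_comp (der_affine tau 2 0) h2)) => t ut.
  rewrite (addr0 (2 * t)) {1}/beta2 rr_double; exact: (b2_double (rr_neq0 t) (rr_lt1 ut)).
have := der_unique hl hr; rewrite /defect.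
move: (theta_sum (@dfN R) (ex tau)) (theta_sum (@dfN R) (ex (2 * tau))) (beta1 tau) (beta2 tau) (beta3 tau)
  (beta1 (2 * tau)) (beta2 (2 * tau)) (beta3 (2 * tau)) (sigma tau) (sigma (tau + 1))
  (sigma (2 * tau)) (sigma (2 * tau + 1)) e1 e2 e3 e4 e5 e6 e8.
move=> T T' B1 B2 B3 B1' B2' B3' s u s' u' e1 e2 e3 e4 e5 e6 e8 eD.
have {}eD : 2 * T + 2 * B3 * s ^+ 2 + (2 * T + 2 * B2 * u ^+ 2) =
    8 * (2 * T' + 2 * B3' * s' ^+ 2).
  apply: (mulfI (twopii_neq0 R)); rewrite mulrDr eD; ring.
have f1 : B2 = B1 - s ^+ 2 by rewrite e1; ring.
have f2 : B3 = B1 - u ^+ 2 by rewrite e2; ring.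
have f3 : B3' = B1' - s * u by rewrite e6 e4; ring.
have f4 : s' = (s + u) / 2 by rewrite e5; field.
have f5 : B1 = 2 * B1' - s * u by rewrite e8 f3; ring.
have f6 : T' = (2 * T + 2 * B3 * s ^+ 2 + (2 * T + 2 * B2 * u ^+ 2) - 16 * B3' * s' ^+ 2) / 16.
  by rewrite eD; field.
by rewrite (exprMn 2 s') -e6 f6 f1 f2 f3 f4 f5; field.
Qed.

Lemma theta_dfN_small : exists2 K : R, 0 <= K & forall q : C, cmod q <= 2^-1 ->
  cmod (theta_sum (@dfN R) q) <= K * cmod q.
Proof.
have [M [H1 H2 H3]] := @dfN_bounds R 2^-1 ltac:(apply/andP; split; lra).
have M0 : 0 <= M by apply: le_trans (cmod_ge0 _) (H2 0 _); rewrite cmod0; lra.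
have [K hK] := @summable_poly2 R 2^-1 ltac:(apply/andP; split; lra).
have K0 : 0 <= K by have := hK [::] isT; rewrite big_nil.
exists (M * K); first exact: mulr_ge0.
move=> q hq; have qc := cmod_ge0 q.
have hs : summable_by (fun n : nat => n.+1%:R * q ^+ n.+1 * dfN (q ^+ n.+1)) (M * cmod q * K).
  have := summable_byZ (M * cmod q)%:C%C hK.
  rewrite cmod_real ger0_norm ?mulr_ge0 //; apply: summable_le => n.
  rewrite (cmodM (n.+1%:R * _)) (cmodM n.+1%:R) (cmodM (M * cmod q)%:C%C) !cmod_real cmod_nat.
  rewrite !ger0_norm ?mulr_ge0 ?exprn_ge0 ?invr_ge0 //.
  have q1 : cmod (q ^+ n.+1) <= 2^-1.
    rewrite cmodX exprS; apply: (le_trans _ hq); apply: ler_piMr => //.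
    by apply: exprn_ile1 => //; lra.
  have h1 := H2 _ q1.
  have h2 : cmod (q ^+ n.+1) <= cmod q * 2^-1 ^+ n.
    by rewrite cmodX exprS; apply: ler_wpM2l => //; rewrite lerXn2r ?nnegrE ?invr_ge0.
  have h3 : n.+1%:R * cmod (q ^+ n.+1) <= n.+1%:R ^+ 2 * (cmod q * 2^-1 ^+ n).
    apply: ler_pM => //; rewrite ?cmod_ge0 // expr2 ler_peMr // ler1n //.
  have := ler_pM (mulr_ge0 (ler0n _ n.+1) (cmod_ge0 _)) (cmod_ge0 _) h3 h1.
  lra.
have -> : M * K * cmod q = M * cmod q * K by ring.
exact: has_sum_le hs (has_tsum (ex_intro _ _ hs)).
Qed.

(** As [r] tends to 0, [beta1] and [sigma tau * sigma (tau + 1)] both tend to [- 1/4], so the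
    difference of their squares is of order [r]; 3000 exceeds the product of the bounds 56 and 30
    for their difference and sum. *)
Lemma defect_small : exists2 K : R, 0 <= K & forall tau, uhp tau -> cmod (rr tau) <= 2^-1 ->
  cmod (defect tau) <= K * cmod (rr tau).
Proof.
have [K K0 hK] := theta_dfN_small.
exists (2 * K + 3000); first lra.
move=> tau ht hr; have rc := cmod_ge0 (rr tau); have r0 := rr_neq0 tau.
have Nr0 : - rr tau != 0 by rewrite oppr_eq0.
set r := cmod (rr tau) in hr rc *.
have hq : cmod (ex tau) <= r by rewrite -rr_sqr cmodX -/r expr2; nra.
have k1 : cmod (theta_sum (@dfN R) (ex tau)) <= K * r.
  by apply: le_trans (hK _ (le_trans hq hr)) _; apply: ler_wpM2l.
have k2 : cmod (beta1 tau + 4^-1) <= 16 * r.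
  rewrite /beta1 b1E rr_sqr fsumN1_nomesum ?ex_neq0 //; last exact: ex_lt1.
  rewrite addrAC addNr add0r cmodM cmod_nat.
  have hlt : 2^-1 < 1 :> R by lra.
  have hb (z : C) : cmod z <= 2^-1 -> cmod (ff (- z)) <= ((1 - 2^-1) ^+ 2)^-1 * cmod z.
    by move=> hz; have := @ff_le R _ (- z) hlt; rewrite cmodN; apply.
  have [_ h] := has_nomesum hlt (le_trans hq hr) hb.
  have : ((1 - 2^-1) ^+ 2)^-1 * cmod (ex tau) / (1 - cmod (ex tau)) <= 8 * r.
    have -> : ((1 - 2^-1) ^+ 2)^-1 = 4 :> R by field.
    rewrite ler_pdivrMr; last by lra.
    by have := cmod_ge0 (ex tau); nra.
  by lra.
have k3 : cmod (sigma tau - I / 2) <= 8 * r by apply: sg_near.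
have k4 : cmod (sigma (tau + 1) - I / 2) <= 8 * r.
  by rewrite /sigma rr_add1; apply: sg_near; rewrite ?cmodN.
rewrite /defect.
move: k1 k2 k3 k4; move: (theta_sum _ _) (beta1 tau) (sigma tau) (sigma (tau + 1)) => T B s u k1 k2 k3 k4.
have Ihalf : cmod (I / 2) = 2^-1.
  by rewrite cmodM cmodV cmod_nat (_ : cmod I = 1) ?mul1r // /cmod /= expr0n expr1n add0r sqrtr1.
have k5 : cmod (s * u + 4^-1) <= 40 * r.
  have -> : s * u + 4^-1 = (I / 2) * (s - I / 2) + (I / 2) * (u - I / 2) + (s - I / 2) * (u - I / 2).
    have -> : (4^-1 : C) = - (I / 2) ^+ 2 by rewrite expr_div_n I2 mulNr opprK mul1r; congr (_^-1); ring.
    by ring.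
  apply: le_trans (cmodD _ _) _; apply: le_trans (lerD (cmodD _ _) (lexx _)) _.
  rewrite !(cmodM (I / 2)) (cmodM (s - _)) Ihalf.
  have := ler_pM (cmod_ge0 _) (cmod_ge0 _) k3 k4; nra.
have k6 : cmod (B - s * u) <= 56 * r.
  have -> : B - s * u = (B + 4^-1) - (s * u + 4^-1) by ring.
  by apply: le_trans (cmodD _ _) _; rewrite cmodN; lra.
have k7 : cmod (B + s * u) <= 30.
  have -> : B + s * u = (B + 4^-1) + (s * u + 4^-1) - 2^-1 by field.
  apply: le_trans (cmodD _ _) _; apply: le_trans (lerD (cmodD _ _) (lexx _)) _.
  by rewrite cmodN cmodV cmod_nat; lra.
have -> : 2 * T + B ^+ 2 - (s * u) ^+ 2 = 2 * T + (B - s * u) * (B + s * u) by ring.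
apply: le_trans (cmodD _ _) _; rewrite !cmodM cmod_nat.
have := ler_pM (cmod_ge0 _) (cmod_ge0 _) k6 k7; rewrite -cmodM; lra.
Qed.

(** For [n = 2^k] the factor [n^2] is the [4^k] accumulated by [defect_double]. With [rho = s^4],
    two factors [s^n] absorb it and [s^(2 n)] still decays. *)
Lemma sqr_geo_small (rho K e : R) : 0 < rho < 1 -> 0 <= K -> 0 < e ->
  exists N, forall n, (N <= n)%N -> n%:R ^+ 2 * (K * rho ^+ n) <= e.
Proof.
move=> /andP[p0 p1] K0 e0; pose s := Num.sqrt (Num.sqrt rho).
have sr0 : 0 < Num.sqrt rho by rewrite sqrtr_gt0.
have s0 : 0 < s by rewrite sqrtr_gt0.
have s1 : s < 1 by rewrite -[1]sqrtr1 ltr_sqrt // -[1]sqrtr1 ltr_sqrt.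
have s4 : s ^+ 4 = rho by rewrite (exprM s 2 2) !sqr_sqrtr ?ltW.
have [N hN] := @geo_small R (s ^+ 2) (K * ((1 - s)^-1) ^+ 2) e
  ltac:(by apply/andP; split; [rewrite exprn_ge0 // ltW | rewrite expr2; nra]) e0.
exists N => n hn; apply: le_trans (hN n hn).
have h := @natmul_geo_le R s n ltac:(lra).
have h2 : (n%:R * s ^+ n) ^+ 2 <= ((1 - s)^-1) ^+ 2.
  by rewrite lerXn2r ?nnegrE ?mulr_ge0 ?exprn_ge0 ?invr_ge0 ?ler0n //; lra.
have -> : n%:R ^+ 2 * (K * rho ^+ n) = K * ((n%:R * s ^+ n) ^+ 2 * (s ^+ 2) ^+ n).
  have -> : rho ^+ n = (s ^+ n) ^+ 2 * (s ^+ 2) ^+ n.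
    by rewrite -s4 -!exprM -exprD; congr (s ^+ _); lia.
  by ring.
rewrite -[X in _ <= X]mulrA; apply: ler_wpM2l => //; apply: ler_wpM2r => //.
by rewrite !exprn_ge0 // ltW.
Qed.

(** The defect at [tau] is [4^k] times the defect at [2^k tau], where the nome is [r^(2^k)]; the
    decay of the latter beats [4^k]. *)
Lemma defect_eq0 tau : uhp tau -> defect tau = 0.
Proof.
move=> ht; have [K K0 hK] := defect_small.
have it (k : nat) : uhp ((2 ^ k)%:R * tau) /\ defect tau = (2 ^ k)%:R ^+ 2 * defect ((2 ^ k)%:R * tau).
  elim: k => [|k [IH1 IH2]]; first by rewrite expn0 mul1r expr1n mul1r.
  have E : (2 ^ k.+1)%:R * tau = 2 * ((2 ^ k)%:R * tau) by rewrite expnS natrM mulrA.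
  rewrite E; split; first exact: uhp2.
  by rewrite IH2 (defect_double IH1) expnS natrM; ring.
have rE n : rr (n%:R * tau) = rr tau ^+ n by rewrite /rr -mulrA ex_nat.
apply: cmod_small => e e0.
have r1 := rr_lt1 ht; have rp : 0 < cmod (rr tau) by rewrite cmod_gt0 rr_neq0.
have [N1 h1] := @sqr_geo_small (cmod (rr tau)) K e ltac:(lra) K0 e0.
have [N2 h2] := @geo_small R (cmod (rr tau)) 1 2^-1 ltac:(lra) ltac:(lra).
pose k := maxn N1 N2; have k2 : (k <= 2 ^ k)%N by apply: ltnW; exact: ltn_expl.
have [u ->] := it k.
have hr : cmod (rr ((2 ^ k)%:R * tau)) <= 2^-1.
  by rewrite rE cmodX -[leLHS]mul1r; apply: h2; apply: leq_trans k2; rewrite leq_maxr.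
rewrite cmodM cmodX cmod_nat.
apply: le_trans (h1 (2 ^ k)%N _); last by apply: leq_trans k2; rewrite leq_maxl.
apply: ler_wpM2l; first by rewrite exprn_ge0.
by rewrite -cmodX -rE; exact: hK.
Qed.

Lemma halphen1 tau : uhp tau -> is_derive tau 1 beta1
  (tpi * ((beta1 tau - beta2 tau) * (beta1 tau - beta3 tau) - beta1 tau ^+ 2)).
Proof.
move=> ht; apply: der_eq (der_beta1 ht) _; congr (_ * _).
have := defect_eq0 ht; rewrite /defect; move: (sigma_sqr ht) (sigma1_sqr ht).
move: (theta_sum _ _) (beta1 tau) (beta2 tau) (beta3 tau) (sigma tau) (sigma _).
move=> T B1 B2 B3 s u e1 e2 /eqP.
by rewrite subr_eq0 exprMn e1 e2 => /eqP <-; ring.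
Qed.

Lemma halphen2 tau : uhp tau -> is_derive tau 1 beta2
  (tpi * ((beta2 tau - beta1 tau) * (beta2 tau - beta3 tau) - beta2 tau ^+ 2)).
Proof.
move=> ht; have h := derB (halphen1 ht) (der_sqr (der_sigma ht)).
apply: (der_uhp ht _ (der_eq h _)).
  by move=> t ut; rewrite sigma_sqr // opprB addrC subrK.
move: (sigma_sqr ht); move: (sigma tau) (beta1 tau) (beta2 tau) (beta3 tau) => s B1 B2 B3 e1.
have -> : 2 * s * (- tpi * B3 * s) = - 2 * tpi * B3 * s ^+ 2 by ring.
by rewrite e1; ring.
Qed.

Lemma halphen3 tau : uhp tau -> is_derive tau 1 beta3
  (tpi * ((beta3 tau - beta1 tau) * (beta3 tau - beta2 tau) - beta3 tau ^+ 2)).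
Proof.
move=> ht; have h := derB (halphen1 ht) (der_sqr (der_sigma1 ht)).
apply: (der_uhp ht _ (der_eq h _)).
  by move=> t ut; rewrite sigma1_sqr // opprB addrC subrK.
move: (sigma1_sqr ht); move: (sigma _) (beta1 tau) (beta2 tau) (beta3 tau) => s B1 B2 B3 e1.
have -> : 2 * s * (- tpi * B2 * s) = - 2 * tpi * B2 * s ^+ 2 by ring.
by rewrite e1; ring.
Qed.

Lemma E2_beta tau : uhp tau -> E2 tau = - 4 * (beta1 tau + beta2 tau + beta3 tau).
Proof.
move=> ht; have q1 := ex_lt1 ht; have q0 := ex_neq0 tau.
rewrite /beta1 /beta2 /beta3 b_sum ?rr_neq0 ?rr_lt1 // rr_sqr.
have hL := lambert q0 q1.
have -> : E2 tau = 1 - 24 * nomesum (@ff C) (ex tau); last first.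
  by move: (nomesum _ _) => A; field.
rewrite /E2 -/(ex tau); congr (1 - 24 * _).
apply: cvg_lim => //; apply/cvg_cmodP => e e0.
have ex_iota (i : nat) : exists n0, forall n, (n0 <= n)%N -> i \in index_iota 0 n.
  by exists i.+1 => n hn; rewrite mem_index_iota.
have [n0 hn0] := has_sum_seqlim hL (fun n => iota_uniq _ _) ex_iota e0.
(* The sum in [E2] runs over [1 <= n < N], one term fewer than a window of length [N]. *)
exists n0.+1 => // -[//|n] /= hn.
by have := hn0 n hn; rewrite big_add1.
Qed.

End Halphen.

(** * Square roots at the ramification points *)

Section GsumDerive.
Variable R : realType.
Local Notation C := R[i].
Implicit Types r y t z : C.

Definition gxsum r y : C := tsum (fun n : int => gx (y * r ^ n)).

Lemma cmodBD (x y : C) : cmod (x - y) <= cmod x + cmod y.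
Proof. by rewrite -(cmodN y); exact: cmodD. Qed.

(** The remainder is an exact rational function with factor [(z - w)^2]. The lower bounds on the
    denominators, with a factor 2 lost at the perturbed point, give decay like [a / (1 + a)^2]. *)
Lemma gg_taylor (c Y a k : R) (y h p : C) : 0 < c -> y != 0 -> p != 0 -> cmod y = Y -> cmod p = a ->
  cmod (y + h) <= 2 * Y ->
  c / 2 * (1 + a ^+ 2) <= cmod (1 - ((y + h) * p) ^+ 2) ->
  c * (1 + a ^+ 2) <= cmod (1 - (y * p) ^+ 2) -> a / (1 + a) ^+ 2 <= k ->
  cmod (gg ((y + h) * p) - gg (y * p) - 2 / y * gx (y * p) * h) <=
  200 * Y * (1 + Y ^+ 2) / c ^+ 3 * cmod h ^+ 2 * k.
Proof.
move=> c0 y0 p0 hY ha y2.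
have yc : 0 < Y by rewrite -hY cmod_gt0.
have a0 : 0 < a by rewrite -ha cmod_gt0.
set K := 200 * Y * (1 + Y ^+ 2) / c ^+ 3.
have KH : 0 <= K * cmod h ^+ 2.
  apply: mulr_ge0; rewrite ?exprn_ge0 ?cmod_ge0 // /K.
  have yc2 : 0 <= Y ^+ 2 by exact: exprn_ge0 (ltW yc).
  by apply: divr_ge0; rewrite ?exprn_ge0 ?(ltW c0) // mulr_ge0 //; lra.
set z := (y + h) * p; set w := y * p => l2 l1 l3.
have a2 : 0 < a ^+ 2 by rewrite exprn_gt0.
have dz : 0 < cmod (1 - z ^+ 2) by apply: lt_le_trans l2; rewrite mulr_gt0 ?divr_gt0 //; lra.
have dw : 0 < cmod (1 - w ^+ 2) by apply: lt_le_trans l1; rewrite mulr_gt0 //; lra.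
have dz0 : 1 - z ^+ 2 != 0 by rewrite -cmod_gt0.
have dw0 : 1 - w ^+ 2 != 0 by rewrite -cmod_gt0.
have E : gg z - gg w - 2 / y * gx w * h =
   (z - w) ^+ 2 * (z + 2 * w + z * w ^+ 2) / ((1 - z ^+ 2) * (1 - w ^+ 2) ^+ 2).
  have zw : z - w = h * p by rewrite /z /w; ring.
  have -> : 2 / y * gx w * h = (1 + w ^+ 2) / (1 - w ^+ 2) ^+ 2 * (z - w).
    by rewrite zw (_ : h * p = h * w / y) /gx; [field; rewrite dw0 y0 | rewrite /w; field].
  by rewrite /gg; field; rewrite dz0 dw0.
rewrite E cmodM cmodV (cmodM ((z - w) ^+ 2)) (cmodM (1 - z ^+ 2)) !cmodX.
have -> : cmod (z - w) = cmod h * a.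
  by rewrite (_ : z - w = h * p) ?cmodM ?ha // /z /w; ring.
have zb : cmod z <= 2 * Y * a by rewrite /z cmodM ha; apply: ler_wpM2r => //; exact: ltW.
have wb : cmod w = Y * a by rewrite /w cmodM ha hY.
have nb : cmod (z + 2 * w + z * w ^+ 2) <= 4 * Y * a * (1 + Y ^+ 2) * (1 + a ^+ 2).
  apply: le_trans (cmodD _ _) _; apply: le_trans (lerD (cmodD _ _) (lexx _)) _.
  rewrite (cmodM 2) cmod_nat (cmodM z) cmodX wb.
  have k1 : cmod z * (Y * a) ^+ 2 <= 2 * Y * a * (Y * a) ^+ 2.
    by apply: ler_wpM2r => //; rewrite exprn_ge0 // mulr_ge0 ?cmod_ge0 // ltW.
  have k2 : 2 * Y * a * (Y * a) ^+ 2 = 2 * Y * a * (Y ^+ 2 * a ^+ 2) by ring.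
  have k3 : 0 < Y * a by exact: mulr_gt0.
  have k4 : 0 < Y ^+ 2 by exact: exprn_gt0.
  have k5 := mulr_gt0 k3 k4; have k6 := mulr_gt0 k3 a2; have k7 := mulr_gt0 k5 a2.
  have -> : 4 * Y * a * (1 + Y ^+ 2) * (1 + a ^+ 2) =
    4 * (Y * a) + 4 * (Y * a * Y ^+ 2) + 4 * (Y * a * a ^+ 2)
    + 4 * (Y * a * Y ^+ 2 * a ^+ 2) by ring.
  have k8 : 2 * Y * a * (Y ^+ 2 * a ^+ 2) = 2 * (Y * a * Y ^+ 2 * a ^+ 2) by ring.
  rewrite k2 k8 in k1.
  have k9 : 2 * Y * a = 2 * (Y * a) by ring.
  rewrite k9 in zb; lra.
clearbody z w; clear E dz0 dw0 zb wb.
set A := cmod (1 - z ^+ 2) in dz l2 *; set B := cmod (1 - w ^+ 2) in dw l1 *.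
set S := 1 + a ^+ 2 in l1 l2 nb *.
have S1 : 1 <= S by rewrite /S; lra.
have den : c ^+ 3 / 2 * S ^+ 3 <= A * B ^+ 2.
  have -> : c ^+ 3 / 2 * S ^+ 3 = (c / 2 * S) * (c * S) ^+ 2 by ring.
  have cS : 0 <= c * S by rewrite mulr_ge0 ?ltW //; lra.
  apply: ler_pM => //; rewrite ?exprn_ge0 //; first by rewrite mulr_ge0 ?divr_ge0 ?ltW //; lra.
  by rewrite lerXn2r ?nnegrE // ltW.
rewrite ler_pdivrMr; last by rewrite mulr_gt0 ?exprn_gt0.
have hK : K * cmod h ^+ 2 * (a / (1 + a) ^+ 2) <= K * cmod h ^+ 2 * k.
  by apply: ler_wpM2l => //; rewrite mulr_ge0 ?exprn_ge0 ?cmod_ge0.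
apply: (@le_trans _ _ (K * cmod h ^+ 2 * (a / (1 + a) ^+ 2) * (A * B ^+ 2))); last first.
  by apply: ler_wpM2r => //; rewrite mulr_ge0 ?exprn_ge0 // ltW.
apply: (@le_trans _ _ (K * cmod h ^+ 2 * (a / (1 + a) ^+ 2) * (c ^+ 3 / 2 * S ^+ 3))); last first.
  apply: ler_wpM2l => //; apply: mulr_ge0 => //.
  by apply: divr_ge0; [exact: ltW | apply: exprn_ge0; lra].
apply: (@le_trans _ _ ((cmod h * a) ^+ 2 * (4 * Y * a * (1 + Y ^+ 2) * S))).
  by apply: ler_wpM2l => //; rewrite exprn_ge0 // mulr_ge0 ?cmod_ge0 // ltW.
have e1 : K * cmod h ^+ 2 * (a / (1 + a) ^+ 2) * (c ^+ 3 / 2 * S ^+ 3) =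
  (cmod h ^+ 2 * Y * a * (1 + Y ^+ 2) * S) * (100 * S ^+ 2 / (1 + a) ^+ 2).
  by rewrite /K; field; rewrite !gt_eqF //; lra.
have e2 : (cmod h * a) ^+ 2 * (4 * Y * a * (1 + Y ^+ 2) * S) =
  (cmod h ^+ 2 * Y * a * (1 + Y ^+ 2) * S) * (4 * a ^+ 2) by ring.
rewrite e1 e2; apply: ler_wpM2l.
  by rewrite !mulr_ge0 ?exprn_ge0 ?cmod_ge0 ?addr_ge0 ?exprn_ge0 // ?ltW //; lra.
rewrite ler_pdivlMr ?exprn_gt0 ?addr_gt0 //.
have s1 : (1 + a) ^+ 2 <= 2 * S by rewrite /S; have := sqr_ge0 (1 - a); nra.
have s2 : a ^+ 2 <= S by rewrite /S; lra.
have : a ^+ 2 * (1 + a) ^+ 2 <= S * (2 * S).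
  by apply: ler_pM => //; rewrite ?exprn_ge0 // ?addr_ge0 // ltW.
have : 0 <= S ^+ 2 by rewrite exprn_ge0 //; lra.
rewrite expr2; lra.
Qed.

Lemma der_gsum r y : r != 0 -> cmod r < 1 -> y != 0 -> regular (r ^+ 2) (y ^+ 2) ->
  is_derive y 1 (gsum r) (2 / y * gxsum r y).
Proof.
move=> r0 r1 y0 hy; have [q0 q1] := nome_sqr r0 r1.
have [c c0 hc] := nome_lower_bound q0 q1 (expf_neq0 2 y0) hy.
have yc : 0 < cmod y by rewrite cmod_gt0.
have rc : 0 < cmod r by rewrite cmod_gt0.
(* [|h| < |y| / 2] keeps [y + h] away from 0, and [|h| < c / (6 |y|)] moves [y^2] by at most
   [c / 2], because [|2 y + h| <= 3 |y|]. *)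
pose del := Num.min (cmod y / 2) (c / (6 * cmod y)).
have del0 : 0 < del by rewrite lt_min !divr_gt0 //; lra.
have aE n : cmod (r ^+ 2) ^ n = (cmod r ^ n) ^+ 2.
  by rewrite -cmodXz -sqrXz cmodX cmodXz.
have near h : cmod h < del -> [/\ cmod (y + h) <= 2 * cmod y, y + h != 0 &
    forall n : int, c / 2 * (1 + (cmod r ^ n) ^+ 2) <= cmod (1 - (y + h) ^+ 2 * (r ^+ 2) ^ n)].
  rewrite lt_min => /andP[h1 h2].
  have yh : cmod (y + h) <= 2 * cmod y by apply: le_trans (cmodD _ _) _; lra.
  split=> //; first by rewrite -cmod_gt0; have := cmodD_ge y h; lra.
  move=> n; have := hc n; rewrite aE; set a := cmod r ^ n => hn.
  have a0 : 0 < a by rewrite exprz_gt0.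
  have -> : 1 - (y + h) ^+ 2 * (r ^+ 2) ^ n =
    (1 - y ^+ 2 * (r ^+ 2) ^ n) - (h * (2 * y + h)) * (r ^+ 2) ^ n by ring.
  have := cmodB (1 - y ^+ 2 * (r ^+ 2) ^ n) ((h * (2 * y + h)) * (r ^+ 2) ^ n).
  rewrite (cmodM (h * _)) (cmodM h) cmodXz aE -/a.
  have k1 : cmod (2 * y + h) <= 3 * cmod y.
    by apply: le_trans (cmodD _ _) _; rewrite cmodM cmod_nat; lra.
  have k2 : cmod h * cmod (2 * y + h) <= c / (6 * cmod y) * (3 * cmod y).
    by apply: ler_pM; rewrite ?cmod_ge0 // ltW.
  have k3 : c / (6 * cmod y) * (3 * cmod y) = c / 2 by field; lra.
  rewrite k3 in k2.
  have k4 : cmod h * cmod (2 * y + h) * a ^+ 2 <= c / 2 * a ^+ 2.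
    by apply: ler_wpM2r => //; rewrite exprn_ge0 // ltW.
  have : 0 <= a ^+ 2 by rewrite exprn_ge0 // ltW.
  lra.
have reg h : cmod h < del -> y + h != 0 /\ regular (r ^+ 2) ((y + h) ^+ 2).
  move=> hh; have [_ h2 h3] := near h hh; split => // n.
  have a0 : 0 < cmod r ^ n by rewrite exprz_gt0.
  rewrite eq_sym -subr_eq0 -cmod_gt0; apply: lt_le_trans (h3 n).
  by rewrite mulr_gt0 ?divr_gt0 // addr_gt0 // exprn_gt0.
have gxs := has_tsum (geob_summable (geob_gx r0 r1 y0 hy)).
pose K := 200 * cmod y * (1 + cmod y ^+ 2) / c ^+ 3.
have K0 : 0 <= K.
  have yc2 : 0 <= cmod y ^+ 2 by exact: exprn_ge0 (ltW yc).
  by rewrite /K; apply: divr_ge0; rewrite ?exprn_ge0 ?(ltW c0) // mulr_ge0 //; lra.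
have [L hL] : exists L, summable_by (fun n : int => ((cmod r ^+ absz n) : R)%:C%C) L.
  apply: geob_summable; exists (cmod r), 1; split; first by rewrite rc.
  by move=> n; rewrite mul1r cmod_real ger0_norm // exprn_ge0 // ltW.
apply: (@is_derive_quad R _ _ _ (K * L) del) => // h hh.
have [y2 yh0 hlow] := near h hh.
have [_ regh] := reg h hh.
have hrem := has_sumB (has_sumB (has_gsum r0 r1 yh0 regh) (has_gsum r0 r1 y0 hy))
  (has_sumZr h (has_sumZ (2 / y) gxs)).
have -> : K * L * cmod h ^+ 2 = (K * cmod h ^+ 2) * L by ring.
apply: has_sum_le hrem.
have := summable_byZ (K * cmod h ^+ 2)%:C%C hL.
have KH : 0 <= K * cmod h ^+ 2 by rewrite mulr_ge0 ?exprn_ge0 ?cmod_ge0.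
rewrite cmod_real (ger0_norm KH).
apply: summable_le => n.
have := nome_geo_le r0 r1 n; have := hlow n; have := hc n; rewrite aE -!sqrMXz => l1 l2 l3.
rewrite cmodM !cmod_real (ger0_norm KH) (ger0_norm (exprn_ge0 _ (ltW rc))).
exact: (gg_taylor c0 y0 (expfz_neq0 n r0) erefl (cmodXz r n) y2 l2 l1 l3).
Qed.

(** A number [q^(-n)] has modulus at least 1 or at most [|q|]. *)
Lemma regular_annulus (q x : C) : q != 0 -> cmod q < cmod x -> cmod x < 1 -> regular q x.
Proof.
move=> q0 h1 h2 n; apply/eqP => h; have := congr1 (@cmod R) h; rewrite cmodM cmodXz cmod1.
have qc : 0 < cmod q by rewrite cmod_gt0.
have [n0|n0] := leP 0 n.
  have -> : n = (absz n)%:Z by lia.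
  have : cmod q ^+ absz n <= 1 by apply: exprn_ile1; lra.
  rewrite -exprnP; nra.
have -> : n = - (absz n).-1.+1%:Z by lia.
rewrite -invr_expz -exprnP exprS => e.
have k : cmod q ^+ (absz n).-1 <= 1 by apply: exprn_ile1; lra.
have k0 : 0 < cmod q ^+ (absz n).-1 by rewrite exprn_gt0.
have : cmod x = cmod q * cmod q ^+ (absz n).-1.
  by rewrite -[RHS]mul1r -e mulfVK // mulf_neq0 ?gt_eqF.
nra.
Qed.

Lemma gg_nomesum_bound r (x : C) : r != 0 -> cmod r < 1 -> cmod x ^+ 2 * cmod r <= 1 -> cmod x <= 2 ->
  has_sum (fun n : nat => gg (x * r ^+ n.+1)) (nomesum (fun z => gg (x * z)) r) /\
  cmod (nomesum (fun z => gg (x * z)) r) <= 4 * cmod r / (1 - cmod r) ^+ 2.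
Proof.
move=> r0 r1 hx1 hx2; have rc : 0 < cmod r by rewrite cmod_gt0.
have [|h1 h2] := @has_nomesum R (fun z => gg (x * z)) (2 / (1 - cmod r)) (cmod r) r r1 (lexx _).
  move=> z hz; rewrite /gg cmodM cmodV cmodM.
  have zc := cmod_ge0 z; have xc := cmod_ge0 x.
  have k : 1 - cmod r <= cmod (1 - (x * z) ^+ 2).
    have := cmodB 1 ((x * z) ^+ 2); rewrite cmod1 cmodX cmodM exprMn.
    have : cmod x ^+ 2 * cmod z ^+ 2 <= cmod r.
      apply: (@le_trans _ _ (cmod x ^+ 2 * (cmod r * cmod r))).
        by rewrite -expr2; apply: ler_wpM2l; rewrite ?exprn_ge0 // lerXn2r ?nnegrE // cmod_ge0.
      by rewrite mulrA -[leRHS]mul1r; apply: ler_wpM2r => //; exact: ltW.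
    lra.
  rewrite mulrAC; apply: ler_wpM2r => //; apply: ler_pM => //; first by rewrite invr_ge0 cmod_ge0.
  by rewrite lef_pV2 ?posrE //; lra.
split=> //; apply: le_trans h2 _.
have -> : 2 / (1 - cmod r) * cmod r / (1 - cmod r) = (2 * cmod r) / (1 - cmod r) ^+ 2 by field; lra.
by apply: ler_wpM2r; [rewrite invr_ge0 exprn_ge0 //; lra | lra].
Qed.

(** The term [n = 0] carries the pole at [y = 1]; all the others stay bounded up to the unit
    circle. *)
Lemma gsum_near_one r y : r != 0 -> cmod r < 1 -> cmod r < cmod y ^+ 2 -> cmod y < 1 -> 2^-1 <= cmod y ->
  exists2 M : C, cmod M <= 8 * cmod r / (1 - cmod r) ^+ 2 & gsum r y = gg y + M.
Proof.
move=> r0 r1 ry y1 y2; have yc := cmod_ge0 y; have y0 : y != 0 by rewrite -cmod_gt0; lra.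
have yl : cmod y ^+ 2 <= 1 by rewrite exprn_ile1 // ltW.
have yi : cmod y^-1 <= 2 by rewrite cmodV -[2]invrK lef_pV2 ?posrE ?invr_gt0 //; lra.
have yir : cmod y^-1 ^+ 2 * cmod r <= 1.
  by rewrite cmodV exprVn mulrC ler_pdivrMr ?mul1r ?exprn_gt0 ?cmod_gt0 // ltW.
have [hp bp] := gg_nomesum_bound r0 r1 (x := y) ltac:(nra) ltac:(lra).
have [hm bm] := gg_nomesum_bound r0 r1 yir yi.
have sE : gsum r y = gg y + nomesum (fun z => gg (y * z)) r - nomesum (fun z => gg (y^-1 * z)) r.
  apply: gsumP; apply: has_sum_int.
    by have := has_sum_natS (a := fun n : nat => gg (y * r ^+ n)) hp; rewrite mulr1.
  apply: eq_has_sum (has_sumN hm) => n.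
  by rewrite NegzE -invr_expz -exprnP -ggV invfM invrK.
exists (nomesum (fun z => gg (y * z)) r - nomesum (fun z => gg (y^-1 * z)) r); last by rewrite sE addrA.
apply: le_trans (cmodBD _ _) (le_trans (lerD bp bm) _).
by rewrite -mulrDl -mulrDl (_ : 4 + 4 = 8 :> R) //; lra.
Qed.

(** [gg (1 + u)] behaves like [- 1 / (2 u)] and the second factor like [2 g u], so the product tends
    to [- g]. The remainder [E'] has two bounds: the fine one is set against the pole, the crude one
    against the regular part [M']. *)
Lemma half_limit_estimate (u g M' E' k0 : C) (e B T : R) : u != 0 -> cmod u <= 2^-1 -> cmod M' <= B ->
  0 < e -> 0 <= B -> 0 <= T -> cmod E' <= e / 4 * cmod u -> cmod E' <= T * cmod u ->
  cmod u * (cmod g + B * (2 * cmod g + T) + 1) <= e / 4 ->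
  (gg (1 + u) + M') * (2 * g * u + E') = k0 -> cmod (k0 + g) <= e.
Proof.
move=> u0 uc bM e0 B0 T0 hE1 hE2 hu <-.
have Gc := cmod_ge0 g; have uu := cmod_ge0 u.
have u2 : 1 <= cmod (2 + u) by have := cmodD_ge 2 u; rewrite cmod_nat; lra.
have u20 : 2 + u != 0 by rewrite -cmod_gt0; lra.
have iu : (cmod (2 + u))^-1 <= 1 by rewrite invf_le1 //; lra.
have iu0 : 0 <= (cmod (2 + u))^-1 by rewrite invr_ge0 cmod_ge0.
have -> : (gg (1 + u) + M') * (2 * g * u + E') + g =
    - (u * g / (2 + u)) - (1 + u) / (2 + u) * (E' / u) + M' * (2 * g * u + E').
  rewrite /gg (_ : 1 - (1 + u) ^+ 2 = - (u * (2 + u))); last by ring.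
  by field; rewrite u0 u20.
have y1 : cmod (1 + u) <= 2 by apply: le_trans (cmodD _ _) _; rewrite cmod1; lra.
have p1 : cmod (u * g / (2 + u)) <= cmod u * cmod g.
  rewrite cmodM cmodV (cmodM u) -[leRHS]mulr1; apply: ler_wpM2l => //.
  by rewrite mulr_ge0 //; lra.
have p2 : cmod ((1 + u) / (2 + u) * (E' / u)) <= 2 * (e / 4).
  rewrite (cmodM ((1 + u) / _)); apply: ler_pM; rewrite ?cmod_ge0 //.
    by rewrite cmodM cmodV -[leRHS]mulr1; apply: ler_pM; rewrite ?cmod_ge0 //; lra.
  by rewrite cmodM cmodV ler_pdivrMr ?cmod_gt0.
have Nb : cmod (2 * g * u + E') <= (2 * cmod g + T) * cmod u.
  by apply: le_trans (cmodD _ _) _; rewrite (cmodM (2 * g)) (cmodM 2) cmod_nat; lra.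
have p3 : cmod (M' * (2 * g * u + E')) <= B * ((2 * cmod g + T) * cmod u).
  by rewrite cmodM; apply: ler_pM; rewrite ?cmod_ge0.
apply: le_trans (cmodD _ _) _; apply: le_trans (lerD (cmodBD _ _) (lexx _)) _.
rewrite cmodN; move: p3 hu p1 p2 => p3 hu p1 p2; clear - p1 p2 p3 hu e0 uu; lra.
Qed.

(* The product of gsum r y and gsum r (y t) is a constant; letting y tend to
   the pole at 1 identifies it with the derivative at the zero t. *)
Lemma gsum_half_derive r t : r != 0 -> cmod r < 1 -> t ^+ 2 = r ->
  gxsum r t ^+ 2 = (b2 r - b1 r) * (b2 r - b3 r).
Proof.
move=> r0 r1 ht; have [K [hK hK2]] := gsum_half_const r0 r1; rewrite -(hK2 t ht).
have t0 : t != 0 by apply: contraNneq r0 => t0; rewrite -ht t0 expr0n.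
have rc : 0 < cmod r by rewrite cmod_gt0.
have regt : regular (r ^+ 2) (t ^+ 2).
  by rewrite ht -[X in regular _ X]mul1r; apply: regular_nome => //; rewrite cmod1.
set G := gxsum r t.
suff -> : K t = - G by rewrite sqrrN.
apply/eqP; rewrite -subr_eq0 opprK; apply/eqP/cmod_small => e e0.
have tc : 0 < cmod t by rewrite cmod_gt0.
pose e1 := Num.min 1 (e / (4 * cmod t)).
have e10 : 0 < e1 by rewrite lt_min ltr01 /=; apply: divr_gt0 => //; lra.
have [d1 d10 hd] := is_derive_cmod (der_gsum r0 r1 t0 regt) e10.
pose B := 8 * cmod r / (1 - cmod r) ^+ 2.
have B0 : 0 <= B by rewrite divr_ge0 ?mulr_ge0 ?exprn_ge0 ?cmod_ge0 //; lra.
have Gc : 0 <= cmod G by exact: cmod_ge0.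
pose D := cmod G + B * (2 * cmod G + cmod t) + 1.
have D0 : 0 < D by rewrite /D; have : 0 <= B * (2 * cmod G + cmod t) by [rewrite mulr_ge0 //; lra]; lra.
have dt : 0 < d1 / cmod t by apply: divr_gt0.
have r14 : 0 < 4^-1 * (1 - cmod r) by apply: mulr_gt0; lra.
have eD : 0 < e / (2 * D) by apply: divr_gt0 => //; apply: mulr_gt0.
pose m := Num.min (Num.min (d1 / cmod t) (4^-1 * (1 - cmod r))) (e / (2 * D)).
have m0 : 0 < m by rewrite !lt_min dt r14.
have [m1 m2 m3] : [/\ m <= d1 / cmod t, m <= 4^-1 * (1 - cmod r) & m <= e / (2 * D)].
  by rewrite /m !ge_min !lexx ?orbT.
(* A small negative real [u] places [(1 + u)^2] in the annulus between [|r|] and 1, where all sums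
   converge. *)
clearbody m; pose u : C := (- (m / 2))%:C%C.
have uc : cmod u = m / 2 by rewrite /u cmod_real normrN ger0_norm // divr_ge0 // ltW.
have u0 : u != 0 by rewrite -cmod_gt0 uc; clear - m0; lra.
have uh : cmod u <= 2^-1 by rewrite uc; clear - m2 rc; lra.
have y1 : cmod (1 + u) = 1 - m / 2.
  have -> : 1 + u = (1 - m / 2)%:C%C by rewrite /u rmorphB rmorph1 rmorphN.
  by rewrite cmod_real ger0_norm //; clear - m2 rc; lra.
have ry : cmod r < cmod (1 + u) ^+ 2 by rewrite y1; clear - m2 rc m0; nra.
have ry1 : cmod (1 + u) < 1 by rewrite y1; clear - m0; lra.
have ry2 : 2^-1 <= cmod (1 + u) by rewrite y1; clear - m2 rc; lra.
have y0 : 1 + u != 0 by rewrite -cmod_gt0; clear - ry2; lra.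
have regy : regular r ((1 + u) ^+ 2) by apply: regular_annulus; rewrite ?cmodX // expr_lt1 ?cmod_ge0.
have [M bM sE] := gsum_near_one r0 r1 ry ry1 ry2.
have tu : cmod (t * u) < d1.
  rewrite cmodM uc; move: m1; rewrite ler_pdivlMr // => m1.
  by have := mulr_gt0 m0 tc; clear - m1; lra.
have := hd (t * u) tu; rewrite (gsum_half r0 r1 ht) subr0.
have -> : t + t * u = (1 + u) * t by ring.
have -> : 2 / t * gxsum r t * (t * u) = 2 * G * u by rewrite /G; field.
rewrite (cmodM t u).
have e1a : e1 <= 1 by rewrite ge_min lexx.
have e1b : e1 * cmod t <= e / 4.
  have : e1 <= e / (4 * cmod t) by rewrite ge_min lexx orbT.
  by rewrite invfM mulrA ler_pdivlMr.
have := hK t (1 + u) ht y0 regy; rewrite sE.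
move: (gsum r ((1 + u) * t)) => N hN hE.
have uu : 0 <= cmod u by exact: cmod_ge0.
apply: (@half_limit_estimate u G M (N - 2 * G * u) (K t) e B (cmod t)) => //; first exact: ltW.
- by apply: le_trans hE _; rewrite mulrA; apply: ler_wpM2r.
- by apply: le_trans hE _; rewrite -[leRHS]mul1r; apply: ler_wpM2r => //; rewrite mulr_ge0 // ltW.
- rewrite uc -/D; move: m3; rewrite ler_pdivlMr ?mulr_gt0 //; clear; lra.
by rewrite (addrC (2 * G * u)) subrK.
Qed.

End GsumDerive.

Section SquareRoots.
Variable R : realType.
Local Notation C := R[i].

Lemma der_cont (f : C -> C) (z d : C) : is_derive z 1 f d -> forall e : R, 0 < e ->
  exists2 del : R, 0 < del & forall h, cmod h < del -> cmod (f (z + h) - f z) < e.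
Proof.
move=> /is_derive_cmod /(_ 1 ltr01) [del del0 H] e e0; have dc := cmod_ge0 d.
have ed : 0 < e / (1 + cmod d) by apply: divr_gt0; lra.
exists (Num.min del (e / (1 + cmod d))); first by rewrite lt_min del0.
move=> h; rewrite lt_min ltr_pdivlMr; last by lra.
move=> /andP[/H h1 h2].
rewrite (_ : f (z + h) - f z = (f (z + h) - f z - d * h) + d * h); last by rewrite subrK.
by apply: le_lt_trans (cmodD _ _) _; rewrite (cmodM d); clear - h1 h2; lra.
Qed.

(** Both squares are the limit of [f (z + h) / h^2]. This makes [phi1_at] independent, up to sign,
    of the chosen local parameter. *)
Lemma sqrt_derive_sqr (f X Y : C -> C) (z a b : C) : f z = 0 ->
  (\forall p \near z, X p ^+ 2 = f p) -> (\forall p \near z, Y p ^+ 2 = f p) ->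
  is_derive z 1 X a -> is_derive z 1 Y b -> a ^+ 2 = b ^+ 2.
Proof.
move=> f0 /near_cmodP [e1 e10 hX] /near_cmodP [e2 e20 hY] dX dY.
have zz (e : R) : 0 < e -> cmod (z - z) < e by rewrite subrr cmod0.
have X0 : X z = 0 by apply/eqP; rewrite -sqrf_eq0 hX ?f0 // zz.
have Y0 : Y z = 0 by apply/eqP; rewrite -sqrf_eq0 hY ?f0 // zz.
apply/eqP; rewrite -subr_eq0; apply/eqP/cmod_small => e e0.
have ac := cmod_ge0 a; have bc := cmod_ge0 b.
pose e' := Num.min 1 (e / (2 * (cmod a + cmod b + 1))).
have e'0 : 0 < e' by rewrite lt_min ltr01 /=; apply: divr_gt0 => //; lra.
have [d1 d10 h1] := is_derive_cmod dX e'0; have [d2 d20 h2] := is_derive_cmod dY e'0.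
pose del := Num.min (Num.min e1 e2) (Num.min d1 d2).
have del0 : 0 < del by rewrite !lt_min e10 e20 d10.
pose h : C := (del / 2)%:C%C.
have hc : cmod h = del / 2 by rewrite cmod_real ger0_norm // divr_ge0 // ltW.
have hd : cmod h < del by rewrite hc; clear - del0; lra.
have h0 : 0 < cmod h by rewrite hc; clear - del0; lra.
move: (hd); rewrite !lt_min => /andP[/andP[k1 k2] /andP[k3 k4]].
have zh : z + h - z = h by rewrite addrC addKr.
have E : X (z + h) ^+ 2 = Y (z + h) ^+ 2 by rewrite hX ?zh // hY // zh.
have := h1 h k3; have := h2 h k4; rewrite X0 Y0 !subr0; move: E.
move: (X (z + h)) (Y (z + h)) => x y E hy hx.
have ha : h != 0 by rewrite -cmod_gt0.
have bound (d w : C) : cmod (w - d * h) <= e' * cmod h ->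
    cmod (w ^+ 2 - (d * h) ^+ 2) <= e' * (2 * cmod d + 1) * cmod h ^+ 2.
  move=> hw; rewrite (_ : w ^+ 2 - _ = (w - d * h) * (w - d * h + 2 * (d * h))); last by ring.
  have -> : e' * (2 * cmod d + 1) * cmod h ^+ 2 = (e' * cmod h) * ((2 * cmod d + 1) * cmod h) by ring.
  rewrite cmodM; apply: ler_pM; rewrite ?cmod_ge0 //.
  apply: le_trans (cmodD _ _) _; rewrite (cmodM 2) (cmodM d) cmod_nat.
  have e'1 : e' <= 1 by rewrite ge_min lexx.
  have := cmod_ge0 d; clear - hw e'1 h0; nra.
have k : cmod (a ^+ 2 - b ^+ 2) * cmod h ^+ 2 <=
    e' * (2 * (cmod a + cmod b + 1)) * cmod h ^+ 2.
  rewrite -[X in _ * X](cmodX h) -cmodM.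
  have -> : (a ^+ 2 - b ^+ 2) * h ^+ 2 =
      (y ^+ 2 - (b * h) ^+ 2) - (x ^+ 2 - (a * h) ^+ 2) by rewrite E; ring.
  apply: le_trans (cmodBD _ _) _; apply: le_trans (lerD (bound _ _ hy) (bound _ _ hx)) _.
  by rewrite -mulrDl -mulrDr le_eqVlt; apply/orP; left; apply/eqP; ring.
move: k; rewrite ler_pM2r ?exprn_gt0 // => k; apply: le_trans k _.
have : e' <= e / (2 * (cmod a + cmod b + 1)) by rewrite ge_min lexx orbT.
by rewrite ler_pdivlMr //; lra.
Qed.

Lemma regular_inv (q x : C) : regular q x -> regular q x^-1.
Proof. by move=> h n; have := h (- n); rewrite -invr_expz => h1; apply: contraNneq h1 => h2; rewrite -invr_eq1 invfM invrK h2. Qed.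

Lemma fsum_inv (q x : C) : q != 0 -> cmod q < 1 -> x != 0 -> regular q x -> fsum q x^-1 = fsum q x.
Proof.
move=> q0 q1 x0 hx; apply: fsumP.
apply: eq_has_sum (has_sum_opp (has_fsum q0 q1 x0 hx)) => n.
have e : (x * q ^ (- n))^-1 = x^-1 * q ^ n by rewrite invfM -invr_expz invrK.
by rewrite -e ffV.
Qed.

End SquareRoots.

(** * Values of [wp] at the half periods and square roots near them *)

Section HalfPeriods.
Variable R : realType.
Local Notation C := R[i].
Implicit Types z tau v : C.

(** Equal to [- E2 / 12]; subtracting it from the [beta_k] makes their sum zero, as for the
    half-period values of [wp]. *)
Definition bmean tau : C := (beta1 tau + beta2 tau + beta3 tau) / 3.

Lemma bmean_nomesum tau : uhp tau -> - 12^-1 + 2 * nomesum (@ff C) (ex tau) = bmean tau.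
Proof.
move=> ht; rewrite /bmean /beta1 /beta2 /beta3 b_sum ?rr_neq0 ?rr_lt1 // rr_sqr.
by move: (nomesum _ _) => s; field.
Qed.

Lemma wp_ex (w1 w2 : C) z : w1 != 0 -> uhp (w2 / w1) -> regular (ex (w2 / w1)) (ex (z / (2 * w1))) ->
  wp w1 w2 z = - (cpi R / w1) ^+ 2 * (fsum (ex (w2 / w1)) (ex (z / (2 * w1))) - bmean (w2 / w1)).
Proof. by move=> h1 h2 h3; rewrite -bmean_nomesum //; exact: wp_fsum. Qed.

Lemma wzeta_bmean (w1 w2 : C) : w1 != 0 -> uhp (w2 / w1) ->
  wzeta w1 w2 w1 = - (cpi R ^+ 2 / w1) * bmean (w2 / w1).
Proof. by move=> h1 h2; rewrite -bmean_nomesum //; exact: wzeta_nomesum. Qed.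

Lemma rr_regular tau : uhp tau -> regular (ex tau) (rr tau).
Proof.
move=> ht; rewrite -rr_sqr -[X in regular _ X]mul1r.
by apply: regular_nome (cmod1 _); [exact: rr_neq0 | exact: rr_lt1].
Qed.

Lemma rrN_regular tau : uhp tau -> regular (ex tau) (- rr tau).
Proof.
move=> ht; rewrite -rr_sqr -mulN1r.
by apply: regular_nome; rewrite ?rr_neq0 ?rr_lt1 // cmodN cmod1.
Qed.

Section Basis.
Variables w1 w2 : C.
Hypotheses (h1 : w1 != 0) (h2 : uhp (w2 / w1)).
Local Notation tau := (w2 / w1).
Local Notation kap := (- (cpi R / w1) ^+ 2).

Lemma ex_w1 : ex (w1 / (2 * w1)) = -1 :> C.
Proof. by rewrite -ex_half; congr ex; field. Qed.
Lemma ex_w2 : ex (w2 / (2 * w1)) = rr tau :> C.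
Proof. by rewrite /rr; congr ex; field. Qed.
Lemma ex_w3 : ex ((w1 + w2) / (2 * w1)) = - rr tau :> C.
Proof. by rewrite mulrDl exD ex_w1 ex_w2 mulN1r. Qed.

Lemma wp_w1 : wp w1 w2 w1 = kap * (beta1 tau - bmean tau).
Proof.
rewrite (wp_ex h1 h2) ex_w1 ?/beta1 ?b1E ?rr_sqr //.
by apply: regular_opp_sqr; [exact: ex_neq0 | exact: ex_lt1].
Qed.

Lemma wp_w2 : wp w1 w2 w2 = kap * (beta2 tau - bmean tau).
Proof. by rewrite (wp_ex h1 h2) ex_w2 ?/beta2 ?b2E ?rr_sqr //; exact: rr_regular. Qed.

Lemma wp_w3 : wp w1 w2 (w1 + w2) = kap * (beta3 tau - bmean tau).
Proof. by rewrite (wp_ex h1 h2) ex_w3 ?/beta3 ?b3E ?rr_sqr //; exact: rrN_regular. Qed.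

(** In the basis [(- w2, w1)] the half periods [- w2] and [w1 - w2] occur; the symmetry [x -> 1/x]
    of the f-sum brings them back. *)
Lemma wp_w2N : wp w1 w2 (- w2) = wp w1 w2 w2.
Proof.
have e : ex (- w2 / (2 * w1)) = (ex (w2 / (2 * w1)))^-1 by rewrite mulNr exN.
have hr := rr_regular h2.
rewrite !wp_ex ?e ?ex_w2 //; last exact: regular_inv.
by rewrite fsum_inv ?ex_neq0 ?ex_lt1.
Qed.

Lemma wp_w3N : wp w1 w2 (- w2 + w1) = wp w1 w2 (w1 + w2).
Proof.
have e : ex ((- w2 + w1) / (2 * w1)) = (ex ((w1 + w2) / (2 * w1)))^-1.
  by rewrite ex_w3 mulrDl exD ex_w1 mulNr exN ex_w2 mulrN1 invrN.
have hr := rrN_regular h2.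
rewrite !wp_ex ?e ?ex_w3 //; last exact: regular_inv.
by rewrite fsum_inv ?ex_lt1 ?oppr_eq0 ?ex_neq0.
Qed.

Lemma wp_w2_period : wp w1 w2 (w1 + (w1 + w2)) = wp w1 w2 w2.
Proof.
have e : ex ((w1 + (w1 + w2)) / (2 * w1)) = rr tau.
  by rewrite mulrDl exD ex_w1 ex_w3 mulN1r opprK.
by rewrite !wp_ex ?e ?ex_w2 //; exact: rr_regular.
Qed.

(** The root is [(i pi / w1) gsum r (E z)] with [E z = exp (pi i z / (2 w1))]: by [gsum_sqr] its
    square is [- (pi / w1)^2] times a difference of f-sums. At [w2] one has [E^2 = r], so
    [gsum_half_derive] gives the derivative. *)
Lemma wp_sqrt_w2 : exists X : C -> C, exists d : C,
  [/\ \forall z \near w2, derivable X z 1 /\ X z ^+ 2 = wp w1 w2 z - wp w1 w2 w2,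
      is_derive w2 1 X d &
      d ^+ 2 = (wp w1 w2 w2 - wp w1 w2 w1) * (wp w1 w2 w2 - wp w1 w2 (w1 + w2))].
Proof.
set r := rr tau; have r0 : r != 0 by exact: rr_neq0. have r1 : cmod r < 1 by exact: rr_lt1.
have rc : 0 < cmod r by rewrite cmod_gt0.
have rq : r ^+ 2 = ex tau by exact: rr_sqr.
pose E (z : C) : C := ex ((4 * w1)^-1 * z + 0); pose X (z : C) : C := ii R * cpi R / w1 * gsum r (E z).
have E2 z : E z ^+ 2 = ex (z / (2 * w1)) by rewrite /E -ex_nat; congr ex; field.
have E0 z : E z != 0 by exact: ex_neq0.
have dE (z : C) : is_derive z 1 E (2 * cpi R * ii R * E z * (4 * w1)^-1).
  exact: der_comp (der_affine z _ 0) (der_ex _).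
have dX (z : C) : regular (r ^+ 2) (E z ^+ 2) -> is_derive z 1 X
    (ii R * cpi R / w1 * (2 / E z * gxsum r (E z) * (2 * cpi R * ii R * E z * (4 * w1)^-1))).
  by move=> hz; apply: derZ; exact: (der_comp (dE z) (der_gsum r0 r1 (E0 z) hz)).
have Er : E w2 ^+ 2 = r by rewrite E2 ex_w2.
have regr : regular (r ^+ 2) (E w2 ^+ 2) by rewrite Er rq; exact: rr_regular.
exists X, (ii R * cpi R / w1 * (2 / E w2 * gxsum r (E w2) * (2 * cpi R * ii R * E w2 * (4 * w1)^-1))).
have dE2 := der_sqr (dE w2).
have e10 : 0 < 1 - cmod r by lra.
have e20 : 0 < cmod r - cmod r ^+ 2 by nra.
(* This radius keeps [E z ^ 2] in the annulus between [|r|^2] and 1, hence regular. *)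
have [del del0 hdel] := der_cont dE2 (e := Num.min (1 - cmod r) (cmod r - cmod r ^+ 2))
  ltac:(by rewrite lt_min e10).
split; last 1 first.
- have -> : ii R * cpi R / w1 * (2 / E w2 * gxsum r (E w2) * (2 * cpi R * ii R * E w2 * (4 * w1)^-1)) =
      ii R ^+ 2 * (cpi R / w1) ^+ 2 * gxsum r (E w2).
    by move: (E w2) (E0 w2) (gxsum _ _) => e e0 g; field; rewrite e0 h1.
  rewrite ii2 wp_w1 wp_w2 wp_w3.
  have := gsum_half_derive r0 r1 Er; rewrite /beta1 /beta2 /beta3 -/r.
  move: (gxsum _ _) (b1 r) (b2 r) (b3 r) (bmean _) (cpi R / w1) => g a b c s k hg.
  have -> : (-1 * k ^+ 2 * g) ^+ 2 = k ^+ 4 * g ^+ 2 by ring.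
  by rewrite hg; ring.
- apply/near_cmodP; exists del => // z hz.
  have := hdel (z - w2) hz; rewrite (addrC w2) subrK Er lt_min => /andP[l1 l2].
  have reg : regular (r ^+ 2) (E z ^+ 2).
    apply: regular_annulus; first by rewrite expf_neq0.
      rewrite (cmodX r); have := cmodD_ge r (E z ^+ 2 - r); rewrite (addrC r) subrK => l3.
      by clear - l2 l3; lra.
    have := cmodD (E z ^+ 2 - r) r; rewrite subrK => l3; clear - l1 l3; lra.
  split; first by case: (dX z reg).
  have wz : wp w1 w2 z = kap * (fsum (r ^+ 2) (E z ^+ 2) - bmean tau).
    by have := reg; rewrite E2 rq => reg'; exact: (wp_ex h1 h2 reg').
  have w2E : wp w1 w2 w2 = kap * (fsum (r ^+ 2) r - bmean tau).
    by rewrite (wp_w2) /beta2 b2E.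
  have gE := gsum_sqr r0 r1 (E0 z) reg.
  have sq (g : C) : (ii R * cpi R / w1 * g) ^+ 2 = - (cpi R / w1) ^+ 2 * g ^+ 2.
    by rewrite -(mulN1r (_ ^+ 2)) -ii2; ring.
  rewrite wz w2E /X sq gE.
  by move: (fsum _ _) (fsum _ _) (bmean _) => a b s; clear; ring.
- exact: dX.
Qed.

End Basis.

Lemma swap_basis (w1 w2 : C) : w1 != 0 -> uhp (w2 / w1) -> - w2 != 0 /\ uhp (w1 / - w2).
Proof.
move=> h1 h2; have w20 : w2 != 0.
  by apply: contraPneq h2 => ->; rewrite /uhp mul0r /= ltxx.
split; first by rewrite oppr_eq0.
rewrite /uhp (_ : w1 / - w2 = - (w2 / w1)^-1); last by field; rewrite w20 h1.
move: h2; rewrite /uhp; case: (w2 / w1) => a b /= b0.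
rewrite opprK; apply: divr_gt0 => //; have := sqr_ge0 a; have : 0 < b ^+ 2 by [rewrite exprn_gt0]; lra.
Qed.

Lemma shear_basis (w1 w2 : C) : w1 != 0 -> uhp (w2 / w1) -> uhp ((w1 + w2) / w1).
Proof. by move=> h1 /uhpD1; rewrite mulrDl divff // addrC. Qed.

Lemma beta12 tau : uhp tau -> beta1 tau != beta2 tau.
Proof. by move=> ht; rewrite -subr_eq0 -sigma_sqr // sqrf_eq0 sigma_neq0. Qed.

Lemma beta13 tau : uhp tau -> beta1 tau != beta3 tau.
Proof. by move=> ht; rewrite -subr_eq0 -sigma1_sqr // sqrf_eq0 sigma_neq0 //; exact: uhpD1. Qed.

(* The change of basis (1, tau) -> (- tau, 1) exchanges the half periods 1 and tau. *)
Lemma beta23 tau : uhp tau -> beta2 tau != beta3 tau.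
Proof.
move=> ht; have h1 := oner_neq0 C; have ht1 : uhp (tau / 1) by rewrite divr1.
have [n0 ht'] := swap_basis h1 ht1.
have k0 : - (cpi R / - tau) ^+ 2 != 0.
  by rewrite oppr_eq0 sqrf_eq0 mulf_neq0 ?invr_eq0 // cpi_neq0.
apply: contra (beta13 ht') => /eqP e.
have := wp_w3 n0 ht'; have := wp_w1 n0 ht'; rewrite !wp_swap // (wp_w2N h1 ht1) (wp_w3N h1 ht1).
rewrite (wp_w2 h1 ht1) (wp_w3 h1 ht1) !divr1 e => -> /(mulfI k0) /eqP.
by rewrite (can_eq (addrK _)).
Qed.

End HalfPeriods.

Lemma ord3_ind (P : 'I_3 -> Prop) : P k1 -> P k2 -> P k3 -> forall k, P k.
Proof.
move=> p1 p2 p3 [[|[|[|n]]] h] //.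
- by rewrite (_ : Ordinal h = k1) //; exact: val_inj.
- by rewrite (_ : Ordinal h = k2) //; exact: val_inj.
- by rewrite (_ : Ordinal h = k3) //; exact: val_inj.
Qed.

Lemma sum3 (M : nmodType) (f : 'I_3 -> M) : \sum_k f k = f k1 + f k2 + f k3.
Proof.
rewrite !big_ord_recl big_ord0 addr0 addrA.
by congr (f _ + f _ + f _); exact: val_inj.
Qed.

#[global] Opaque beta1 beta2 beta3.

(** * Critical values, and [phi_1] at the ramification points *)

Section Critical.
Variable R : realType.
Local Notation C := R[i].
Local Notation V := 'rV[R[i]]_3.
Implicit Types (t tau : C) (m u v : V) (k : 'I_3).

Lemma row3E (a b c : C) : [/\ row3 a b c 0 k1 = a, row3 a b c 0 k2 = b & row3 a b c 0 k3 = c].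
Proof. by rewrite !mxE. Qed.

Definition beta k tau : C := [:: beta1 tau; beta2 tau; beta3 tau]`_k.
Definition bprod k tau : C :=
  [:: (beta1 tau - beta2 tau) * (beta1 tau - beta3 tau);
      (beta2 tau - beta1 tau) * (beta2 tau - beta3 tau);
      (beta3 tau - beta1 tau) * (beta3 tau - beta2 tau)]`_k.
Definition bsum tau : C := beta1 tau + beta2 tau + beta3 tau.

Lemma bprod_neq0 k tau : uhp tau -> bprod k tau != 0.
Proof.
move=> ht; have h12 := beta12 ht; have h13 := beta13 ht; have h23 := beta23 ht.
have sub (a b : C) : a != b -> a - b != 0 /\ b - a != 0.
  by rewrite -[b - a]opprB oppr_eq0 subr_eq0.
have [s12 s21] := sub _ _ h12; have [s13 s31] := sub _ _ h13; have [s23 s32] := sub _ _ h23.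
by elim/ord3_ind: k; [exact: (mulf_neq0 s12 s13)|exact: (mulf_neq0 s21 s23)|exact: (mulf_neq0 s31 s32)].
Qed.

Lemma der_beta k tau : uhp tau ->
  is_derive tau 1 (beta k) (2 * cpi R * ii R * (bprod k tau - beta k tau ^+ 2)).
Proof.
move=> ht; elim/ord3_ind: k.
- exact: halphen1.
- exact: halphen2.
- exact: halphen3.
Qed.

(** By the Halphen system [b_j - b_k] has logarithmic derivative [- 4 pi i b_l], with [l] the third
    index; the two factors of [bprod k] contribute the two values other than [b_k]. *)
Lemma der_bprod k tau : uhp tau ->
  is_derive tau 1 (bprod k) (- 4 * cpi R * ii R * (bsum tau - beta k tau) * bprod k tau).
Proof.
move=> ht; have d1 := halphen1 ht; have d2 := halphen2 ht; have d3 := halphen3 ht.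
elim/ord3_ind: k; rewrite /bprod /beta /bsum /=.
- apply: der_eq (derM (derB d1 d2) (derB d1 d3)) _.
  by move: (beta1 tau) (beta2 tau) (beta3 tau) (cpi R) (ii R) => a b c p i; ring.
- apply: der_eq (derM (derB d2 d1) (derB d2 d3)) _.
  by move: (beta1 tau) (beta2 tau) (beta3 tau) (cpi R) (ii R) => a b c p i; ring.
- apply: der_eq (derM (derB d3 d1) (derB d3 d2)) _.
  by move: (beta1 tau) (beta2 tau) (beta3 tau) (cpi R) (ii R) => a b c p i; ring.
Qed.

Definition mtau m : C := w2 m / w1 m.

Lemma wp_ram m k : hurwitz_domain m ->
  wp (w1 m) (w2 m) (ram_point m k) = - (cpi R / w1 m) ^+ 2 * (beta k (mtau m) - bmean (mtau m)).
Proof.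
move=> [h1 h2]; have [r1 r2 r3] := row3E (w1 m) (w2 m) (w1 m + w2 m).
elim/ord3_ind: k; rewrite /ram_point ?r1 ?r2 ?r3.
- exact: wp_w1.
- exact: wp_w2.
- exact: wp_w3.
Qed.

Lemma lamE m k : lam m 0 k = wp (w1 m) (w2 m) (ram_point m k) + cst_term m.
Proof. by rewrite mxE. Qed.

(** The second point is [wp_sqrt_w2]; the first and third apply it to the bases [(- w2, w1)] and
    [(w1, w1 + w2)] of the same lattice. *)
Lemma ram_sqrt m k : hurwitz_domain m -> exists X : C -> C, exists d : C,
  [/\ \forall z \near ram_point m k, derivable X z 1 /\ X z ^+ 2 = covering m z - lam m 0 k,
      is_derive (ram_point m k) 1 X d &
      d ^+ 2 = (cpi R / w1 m) ^+ 4 * bprod k (mtau m)].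
Proof.
move=> hm; have [h1 h2] := hm.
have E z : covering m z - lam m 0 k = wp (w1 m) (w2 m) z - wp (w1 m) (w2 m) (ram_point m k).
  by rewrite lamE /covering opprD addrACA subrr addr0.
have [r1 r2 r3] := row3E (w1 m) (w2 m) (w1 m + w2 m).
have e1 := wp_ram k1 hm; have e2 := wp_ram k2 hm; have e3 := wp_ram k3 hm.
rewrite /ram_point r1 in e1; rewrite /ram_point r2 in e2; rewrite /ram_point r3 in e3.
have fin (X : C -> C) (d c : C) :
    (\forall z \near ram_point m k, derivable X z 1 /\
       X z ^+ 2 = wp (w1 m) (w2 m) z - wp (w1 m) (w2 m) (ram_point m k)) ->
    is_derive (ram_point m k) 1 X d -> d ^+ 2 = c -> c = (cpi R / w1 m) ^+ 4 * bprod k (mtau m) ->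
    exists X : C -> C, exists d : C,
    [/\ \forall z \near ram_point m k, derivable X z 1 /\ X z ^+ 2 = covering m z - lam m 0 k,
      is_derive (ram_point m k) 1 X d & d ^+ 2 = (cpi R / w1 m) ^+ 4 * bprod k (mtau m)].
  move=> hX dX dE cE; exists X, d; split => //; last by rewrite dE.
  by apply: filterS hX => z; rewrite E.
have [n0 n1] := swap_basis h1 h2.
have alg (a b c s p : C) : (- p ^+ 2 * (a - s) - - p ^+ 2 * (b - s)) *
  (- p ^+ 2 * (a - s) - - p ^+ 2 * (c - s)) = p ^+ 4 * ((a - b) * (a - c)) by ring.
elim/ord3_ind: k E fin => E; rewrite /ram_point ?r1 ?r2 ?r3 => fin.
- have [X [d [hX dX dE]]] := wp_sqrt_w2 n0 n1.
  apply: (fin X d _ _ dX dE).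
    by apply: filterS hX => z; rewrite !wp_swap.
  by rewrite !wp_swap // (wp_w2N h1 h2) (wp_w3N h1 h2) e1 e2 e3 alg.
- have [X [d [hX dX dE]]] := wp_sqrt_w2 h1 h2.
  by apply: (fin X d _ hX dX dE); rewrite e1 e2 e3 alg.
- have [X [d [hX dX dE]]] := wp_sqrt_w2 h1 (shear_basis h1 h2).
  apply: (fin X d _ _ dX dE).
    by apply: filterS hX => z; rewrite !wp_shear.
  by rewrite !wp_shear // (wp_w2_period h1 h2) e1 e2 e3 alg.
Qed.

(** [ram_sqrt] shows that [xget] has a candidate, and [sqrt_derive_sqr] that whichever is picked has
    the same squared derivative. *)
Lemma phi1_at_sqr m k : hurwitz_domain m ->
  phi1_at m k ^+ 2 = w1 m ^+ 2 / (4 * cpi R ^+ 4 * bprod k (mtau m)).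
Proof.
move=> hm; have [h1 h2] := hm; have [X [d [hX dX dE]]] := ram_sqrt k hm.
have hY : std_param m k (xget (fun=> 0) (std_param m k)) by apply: xgetPex; exists X.
move: hY; rewrite /phi1_at /phi1; move: (xget _ _) => Y hY.
have [dY _] := nbhs_singleton hY.
have dY1 : is_derive (ram_point m k) 1 Y (derive1 Y (ram_point m k)).
  by apply: DeriveDef; [exact: dY | exact: (esym (derive1E _ _))].
have f0 : covering m (ram_point m k) - lam m 0 k = 0 by rewrite lamE /covering subrr.
have sX : \forall p \near ram_point m k, X p ^+ 2 = covering m p - lam m 0 k.
  by apply: filterS hX => z [].
have sY : \forall p \near ram_point m k, Y p ^+ 2 = covering m p - lam m 0 k.
  by apply: filterS hY => z [].
have e := sqrt_derive_sqr (f := fun p => covering m p - lam m 0 k) f0 sX sY dX dY1.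
move: e; rewrite dE; move: (derive1 Y _) => D e; rewrite expr_div_n -e.
have b0 := bprod_neq0 k h2; have p0 := cpi_neq0 R.
have gen (b p w : C) : b != 0 -> p != 0 -> w != 0 ->
    (2 * w)^-1 ^+ 2 / ((p / w) ^+ 4 * b) = w ^+ 2 / (4 * p ^+ 4 * b).
  by move=> b0' p0' w0'; field; rewrite b0' p0' w0'.
exact: gen.
Qed.

End Critical.

(** * Coordinates and Jacobians; a local square root *)

Section DifferentialGeometry.
Variable R : realType.
Local Notation C := R[i].
Local Notation V := 'rV[R[i]]_3.

Lemma near_differentiable (U W : normedModType C) (f g : U -> W) (x : U) :
  (\forall y \near x, f y = g y) -> differentiable g x -> differentiable f x.
Proof.
move=> fg dg.
have fx : f x = g x by exact: nbhs_singleton fg.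
have fg0 : \forall h \near (0 : U), f (h + x) = g (h + x).
  by rewrite (near_shift 0 x) in fg; apply: filterS fg => h /=; rewrite subr0.
have H : f \o shift x = cst (f x) + 'd g x +o_ 0 id.
  have /diff_locally /eqaddoP h := dg.
  apply/eqaddoP => e e0; have := h e e0; apply: filterS2 fg0 => y E.
  by rewrite /= !fctE /= E fx.
have [gc _] := (diff_locallyP x g).1 dg.
apply/diff_locallyP; rewrite (diff_unique gc H); split => //.
Qed.

Lemma differentiable_row (U : normedModType C) (f : U -> V) (x : U) :
  (forall i, differentiable (fun y => f y 0 i : C) x) -> differentiable f x.
Proof.
move=> df; have -> : f = \sum_(i < 3) (fun y => f y 0 i *: (delta_mx 0 i : V)).
  by apply/funext => y; rewrite fct_sumE [LHS]row_sum_delta.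
by apply: differentiable_sum => i; apply: differentiableZl.
Qed.

Lemma der_coord_diff (x : V -> V) i (m v : V) : differentiable x m ->
  is_derive m v (fun p => x p 0 i : C) (dcoord x i m v).
Proof.
move=> dx; have dv := diff_derivable (v := v) dx.
have dE : 'D_v x m = 'd x m v by exact: deriveE.
have h : (fun h : C => h^-1 *: ((x \o shift m) (h *: v) - x m)) @ 0^' --> 'd x m v.
  by rewrite -dE; exact: dv.
have h2 : (fun h : C => h^-1 *: (((fun p => x p 0 i : C) \o shift m) (h *: v) - x m 0 i)) @ 0^'
    --> ('d x m v) 0 i.
  have -> : (fun h : C => h^-1 *: (((fun p => x p 0 i : C) \o shift m) (h *: v) - x m 0 i)) =
    (fun M : V => M 0 i : C) \o (fun h : C => h^-1 *: ((x \o shift m) (h *: v) - x m)).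
    by apply/funext => k /=; rewrite !mxE.
  by apply: cvg_comp h _; exact: coord_continuous.
by apply: DeriveDef; [apply/cvgP; exact: h2 | exact: cvg_lim h2].
Qed.

Lemma dcoordE (x : V -> V) i (m v : V) a : differentiable x m ->
  is_derive m v (fun p => x p 0 i : C) a -> dcoord x i m v = a.
Proof. by move=> dx; apply: der_unique; exact: der_coord_diff. Qed.

Lemma mul_jacobian (x : V -> V) (m v : V) : v *m 'J x m = 'd x m v.
Proof. by rewrite /jacobian mul_rV_lin1. Qed.

Lemma jacobian_unit (x : V -> V) (m : V) :
  (forall v, (forall i, dcoord x i m v = 0) -> v = 0) -> 'J x m \in unitmx.
Proof.
move=> h; rewrite -row_free_unit; apply: inj_row_free => v; rewrite mul_jacobian => e.
by apply: h => i; rewrite /dcoord e mxE.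
Qed.

Lemma dcoord_dd (x : V -> V) i j (m : V) : 'J x m \in unitmx ->
  dcoord x j m (dd x i m) = (i == j)%:R.
Proof.
by move=> u; rewrite /dcoord /dd -mul_jacobian -row_mul mulVmx // !mxE.
Qed.

Lemma dcoord_inj (x : V -> V) (m u v : V) : 'J x m \in unitmx ->
  (forall i, dcoord x i m u = dcoord x i m v) -> u = v.
Proof.
move=> hu h; have : u *m 'J x m = v *m 'J x m.
  by rewrite !mul_jacobian; apply/rowP => i; exact: h.
by move=> /(congr1 (mulmxr (invmx ('J x m)))) /=; rewrite !mulmxK.
Qed.

Lemma dcoordD (x : V -> V) i (m u v : V) : dcoord x i m (u + v) = dcoord x i m u + dcoord x i m v.
Proof. by rewrite /dcoord -!mul_jacobian mulmxDl mxE. Qed.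

Lemma dcoordZ (x : V -> V) i (m u : V) (a : C) : dcoord x i m (a *: u) = a * dcoord x i m u.
Proof. by rewrite /dcoord -!mul_jacobian -scalemxAl mxE. Qed.

(* The branch of the square root near 1 is singled out by its being the root
   closer to 1 than to -1. *)
Lemma local_sqrt : exists h : C -> C, forall w, cmod (w - 1) < 2^-1 ->
  h w ^+ 2 = w /\ is_derive w 1 h (2 * h w)^-1.
Proof.
pose h (w : C) := if cmod (sqrtC w - 1) <= cmod (sqrtC w + 1) then sqrtC w else - sqrtC w.
have h2 w : h w ^+ 2 = w by rewrite /h; case: ifP => _; rewrite ?sqrrN sqrtCK.
have hle w : cmod (h w - 1) <= cmod (h w + 1).
  rewrite /h; case: ifP => // /negbT; rewrite -ltNge => /ltW.
  by rewrite -[X in _ <= X]cmodN -[X in X <= _]cmodN !opprD !opprK.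
have h1 w : cmod (w - 1) < 2^-1 -> cmod (h w - 1) < 2^-1.
  move=> hw; have := hle w; have := cmodBD (h w + 1) (h w - 1).
  have -> : h w + 1 - (h w - 1) = 2 by ring.
  rewrite cmod_nat; have : cmod (w - 1) = cmod (h w - 1) * cmod (h w + 1).
    by rewrite -cmodM -{1}(h2 w); congr cmod; ring.
  have := cmod_ge0 (h w - 1); move: hw; clear; move: (cmod _) (cmod _) (cmod _) => a b c; nra.
have sum w w' : cmod (w - 1) < 2^-1 -> cmod (w' - 1) < 2^-1 -> 1 <= cmod (h w' + h w).
  move=> /h1 k1 /h1 k2.
  have := cmodD_ge 2 ((h w' - 1) + (h w - 1)); rewrite cmod_nat.
  have -> : 2 + ((h w' - 1) + (h w - 1)) = h w' + h w by ring.
  have := cmodD (h w' - 1) (h w - 1); move: k1 k2; clear; lra.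
exists h => w hw; split => //.
have s2 := sum w w hw hw.
have d0 : 0 < 2^-1 - cmod (w - 1) by lra.
apply: (is_derive_quad (K := 1) d0) => k hk.
have hwk : cmod (w + k - 1) < 2^-1.
  by rewrite addrAC; apply: le_lt_trans (cmodD _ _) _; clear - hk; lra.
have s1 := sum w (w + k) hw hwk.
have n1 : h (w + k) + h w != 0 by rewrite -cmod_gt0; clear - s1; lra.
have n2 : 2 * h w != 0 by rewrite -cmod_gt0 mulr_natl mulr2n; clear - s2; lra.
have n3 : h w != 0 by apply: contraNneq n2 => ->; rewrite mulr0.
have kE : k = (h (w + k) - h w) * (h (w + k) + h w).
  have := h2 (w + k); have := h2 w; move: (h (w + k)) (h w) => a b e1 e2.
  by rewrite (_ : _ * _ = a ^+ 2 - b ^+ 2); [rewrite e1 e2 addrAC subrr add0r | ring].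
have -> : h (w + k) - h w - (2 * h w)^-1 * k =
    - (k ^+ 2 / ((h (w + k) + h w) ^+ 2 * (h w + h w))).
  rewrite {2 3}kE; move: n1 n3; move: (h (w + k)) (h w) => a b n1 n3.
  have n4 : b + b != 0 by rewrite -mulr2n -mulr_natl mulf_neq0 // pnatr_eq0.
  by field; rewrite n1 n3 n4.
rewrite cmodN (cmodM (k ^+ 2)) cmodV (cmodM (_ ^+ 2)) !cmodX mul1r -[leRHS]mulr1.
apply: ler_wpM2l; first by rewrite exprn_ge0 ?cmod_ge0.
have p1 : 1 <= cmod (h (w + k) + h w) ^+ 2 * cmod (h w + h w).
  by rewrite -[leLHS]mulr1; apply: ler_pM => //; rewrite exprn_ege1.
by rewrite invf_le1 //; apply: lt_le_trans p1.
Qed.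

End DifferentialGeometry.

(** * Flat coordinates and the metric *)

Section FlatCoordinates.
Variable R : realType.
Local Notation C := R[i].
Local Notation V := 'rV[R[i]]_3.
Local Notation tpi := (2 * cpi R * ii R).
Implicit Types (t tau : C) (m u v p : V) (k : 'I_3).

Lemma sqrtC2_sqr : sqrtC (2 : C) ^+ 2 = 2. Proof. exact: sqrtCK. Qed.
Lemma sqrtC2_neq0 : sqrtC (2 : C) != 0. Proof. by rewrite sqrtC_eq0 pnatr_eq0. Qed.

Lemma diff_compC (U : normedModType C) (f : U -> C) (g : C -> C) (x : U) (d : C) :
  differentiable f x -> is_derive (f x) 1 g d -> differentiable (fun y => g (f y)) x.
Proof.
by move=> df [dg _]; apply: differentiable_comp df _; apply/derivable1_diffP.
Qed.

Lemma der_coord i m v : is_derive m v (fun p => p 0 i : C) (v 0 i).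
Proof.
apply/is_deriveP => e e0; exists 1 => // h _.
rewrite (_ : (m + h *: v) 0 i - m 0 i - v 0 i * h = 0) ?cmod0 ?mulr_ge0 ?cmod_ge0 ?ltW //.
by rewrite !mxE; ring.
Qed.

Lemma diff_w1 m : differentiable (@w1 R) m. Proof. exact: differentiable_coord. Qed.
Lemma diff_w2 m : differentiable (@w2 R) m. Proof. exact: differentiable_coord. Qed.
Lemma diff_cst_term m : differentiable (@cst_term R) m. Proof. exact: differentiable_coord. Qed.
Lemma der_w1 m v : is_derive m v (@w1 R) (w1 v). Proof. exact: der_coord. Qed.
Lemma der_w2 m v : is_derive m v (@w2 R) (w2 v). Proof. exact: der_coord. Qed.
Lemma der_cst_term m v : is_derive m v (@cst_term R) (cst_term v). Proof. exact: der_coord. Qed.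

Lemma diff_w1V m : w1 m != 0 -> differentiable (fun p : V => (w1 p)^-1 : C) m.
Proof. by move=> h; apply: differentiableV => //; exact: diff_w1. Qed.

Lemma der_w1V m v : w1 m != 0 -> is_derive m v (fun p : V => (w1 p)^-1 : C) (- (w1 m ^+ 2)^-1 * w1 v).
Proof. by move=> h; exact: der_comp (der_w1 m v) (derV h). Qed.

Lemma diff_mtau m : w1 m != 0 -> differentiable (@mtau R) m.
Proof. by move=> h; apply: (differentiableM (diff_w2 m) (diff_w1V h)). Qed.

Lemma open_hurwitz : open (@hurwitz_domain R).
Proof.
rewrite openE => m hm; have [h1 h2] := hm.
have c1 := differentiable_continuous (diff_w1 m).
have c2 := differentiable_continuous (diff_mtau h1).
have wc : 0 < cmod (w1 m) by rewrite cmod_gt0.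
have n1 : \forall p \near m, cmod (w1 p - w1 m) < cmod (w1 m).
  exact: (cvg_cmodP (nbhs_filter m) _ _).1 c1 _ wc.
have n2 : \forall p \near m, cmod (mtau p - mtau m) < complex.Im (mtau m).
  exact: (cvg_cmodP (nbhs_filter m) _ _).1 c2 _ h2.
suff : nbhs m (@hurwitz_domain R) by [].
apply: filterS2 n1 n2 => p k1 k2; split.
  by apply: contraTneq k1 => ->; rewrite sub0r cmodN ltxx.
by have := uhp_near k2; rewrite (addrC (mtau m)) subrK.
Qed.

Lemma near_hurwitz m : hurwitz_domain m -> \forall p \near m, hurwitz_domain p.
Proof. by move=> hm; exact: open_nbhs_nbhs (conj open_hurwitz hm). Qed.

Lemma tcoord1E m : tcoord m 0 k1 = tpi^-1 * mtau m.
Proof. by rewrite mxE /= invfM mulrCA. Qed.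
Lemma tcoord2E m : tcoord m 0 k2 = (sqrtC 2)^-1 * (w1 m)^-1.
Proof. by rewrite mxE /= invfM. Qed.
Lemma tcoord3E m : hurwitz_domain m ->
  tcoord m 0 k3 = (cpi R * (w1 m)^-1) ^+ 2 * bmean (mtau m) + cst_term m.
Proof.
move=> [h1 h2]; rewrite mxE /= (wzeta_bmean h1 h2) /mtau.
by move: h1; clear; move: (w1 m) (cpi R) (cst_term m) (bmean _) => w p c b w0; field.
Qed.

Lemma mtauE m : mtau m = tpi * tcoord m 0 k1.
Proof. by rewrite tcoord1E mulVKf // twopii_neq0. Qed.

Lemma w1_sqrE m : w1 m != 0 -> w1 m ^+ 2 = (2 * tcoord m 0 k2 ^+ 2)^-1.
Proof.
move=> h; rewrite tcoord2E; have := sqrtC2_sqr; have := sqrtC2_neq0.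
move: h; move: (sqrtC 2) (w1 m) => s w w0 s0 e.
have -> : 2 * (s^-1 * w^-1) ^+ 2 = (w ^+ 2)^-1 by rewrite -{1}e; field; rewrite s0 w0.
by rewrite invrK.
Qed.

Lemma tcoord2_neq0 m : w1 m != 0 -> tcoord m 0 k2 != 0.
Proof. by move=> h; rewrite tcoord2E mulf_neq0 ?invr_eq0 // sqrtC2_neq0. Qed.

Lemma der_bmean tau : uhp tau -> exists d, is_derive tau 1 (@bmean R) d.
Proof.
move=> ht; have h := derD (derD (halphen1 ht) (halphen2 ht)) (halphen3 ht).
by have h3 := derM h (der_cst tau 1 3^-1); eexists; exact: h3.
Qed.

(** The term [bmean] of [wp] at a half period is exactly what [zeta(w1) / w1] contributes to [t_3],
    so it cancels; [2 t_2^2 = w1^-2] rewrites the remaining factor. *)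
Lemma lam_tcoord m k : hurwitz_domain m ->
  lam m 0 k = tcoord m 0 k3 - 2 * cpi R ^+ 2 * tcoord m 0 k2 ^+ 2 * beta k (mtau m).
Proof.
move=> hm; have [h1 h2] := hm; rewrite lamE wp_ram // tcoord3E //.
have := congr1 GRing.inv (w1_sqrE h1); rewrite invrK.
move: h1; move: (w1 m) (tcoord m 0 k2) (cst_term m) (cpi R) (bmean _) (beta k _) => w t c p s b w0 e.
by rewrite (_ : 2 * p ^+ 2 * t ^+ 2 = p ^+ 2 * (2 * t ^+ 2)); [rewrite -e; field | ring].
Qed.

Lemma near_hurwitzS m (Q : V -> Prop) : hurwitz_domain m ->
  (forall p, hurwitz_domain p -> Q p) -> \forall p \near m, Q p.
Proof. by move=> hm h; apply: (@filterS _ (nbhs m) _ _ _ h); exact: near_hurwitz. Qed.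

Lemma diff_tcoord m : hurwitz_domain m -> differentiable (@tcoord R) m.
Proof.
move=> hm; have [h1 h2] := hm; apply: differentiable_row; apply: ord3_ind.
- apply: (@near_differentiable _ _ _ _ (fun p => tpi^-1 * mtau p)).
    by apply: near_hurwitzS => // p _; exact: tcoord1E.
  exact: (differentiableM (differentiable_cst _ _) (diff_mtau h1)).
- apply: (@near_differentiable _ _ _ _ (fun p => (sqrtC 2)^-1 * (w1 p)^-1)).
    by apply: near_hurwitzS => // p _; exact: tcoord2E.
  exact: (differentiableM (differentiable_cst _ _) (diff_w1V h1)).
apply: (@near_differentiable _ _ _ _ (fun p => (cpi R * (w1 p)^-1) * (cpi R * (w1 p)^-1) * bmean (mtau p) + cst_term p)).
  by apply: near_hurwitzS => // p hp; rewrite tcoord3E.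
have [d hd] := der_bmean h2.
have d1 := differentiableM (differentiable_cst (cpi R) m) (diff_w1V h1).
apply: differentiableD (diff_cst_term m).
exact: (differentiableM (differentiableM d1 d1) (diff_compC (diff_mtau h1) hd)).
Qed.

Definition dt i m v : C := dcoord (@tcoord R) i m v.

Lemma der_tcoord i m v : hurwitz_domain m -> is_derive m v (fun p => tcoord p 0 i : C) (dt i m v).
Proof. by move=> hm; apply: der_coord_diff; exact: diff_tcoord. Qed.

Lemma der_mtau m v : hurwitz_domain m -> is_derive m v (@mtau R) (tpi * dt k1 m v).
Proof.
move=> hm; have h := derZ tpi (der_tcoord k1 v hm).
apply: (der_near _ h); exists 1 => // a _; by rewrite [RHS]mtauE.
Qed.

Lemma near_line (D : V -> Prop) m v : (\forall p \near m, D p) ->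
  exists2 del : R, 0 < del & forall h : C, cmod h < del -> D (m + h *: v).
Proof.
move=> hD.
have : (fun h : C => m + h *: v) @ (0 : C) --> m.
  rewrite -[X in _ --> X](addr0 m) -(scale0r v).
  exact: (cvgD (cvg_cst m) (@scalel_continuous C V v 0)).
move=> /(_ _ hD) /near_cmodP [e e0 he]; exists e => // h hh.
by apply: he; rewrite subr0.
Qed.

Lemma der_nearV (f g : V -> C) m v d : (\forall p \near m, f p = g p) ->
  is_derive m v g d -> is_derive m v f d.
Proof.
by move=> fg; apply: der_near; have [e e0 he] := near_line v fg; exists e => // h /he ->.
Qed.

(** The coordinates are triangular: a vanishing [dt_2] kills the [w1] component, then [dt_1] that of
    [w2], then [dt_3] that of the constant term. *)
Lemma tcoord_unit m : hurwitz_domain m -> 'J (@tcoord R) m \in unitmx.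
Proof.
move=> hm; have [h1 h2] := hm; apply: jacobian_unit => v hv.
have v1 : w1 v = 0.
  have n2 : \forall p \near m, tcoord p 0 k2 = (sqrtC 2)^-1 * (w1 p)^-1.
    by apply: near_hurwitzS => // p _; exact: tcoord2E.
  have := dcoordE (diff_tcoord hm) (der_nearV n2 (derZ (sqrtC 2)^-1 (der_w1V v h1))).
  rewrite hv => /esym /eqP; rewrite !mulf_eq0 invr_eq0 (negPf sqrtC2_neq0) oppr_eq0 invr_eq0.
  by rewrite sqrf_eq0 (negPf h1) => /eqP.
have dtau := derM (der_w2 m v) (der_w1V v h1).
have v2 : w2 v = 0.
  have := der_unique (der_mtau v hm) dtau; rewrite /dt hv mulr0 v1 mulr0 mulr0 addr0.
  by move=> /esym /eqP; rewrite mulf_eq0 invr_eq0 (negPf h1) orbF => /eqP.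
have [d hd] := der_bmean h2.
have v3 : cst_term v = 0.
  have h3 := derD (derM (der_sqr (derZ (cpi R) (der_w1V v h1))) (der_comp (der_mtau v hm) hd)) (der_cst_term m v).
  have n3 : \forall p \near m, tcoord p 0 k3 = (cpi R * (w1 p)^-1) ^+ 2 * bmean (mtau p) + cst_term p.
    by apply: near_hurwitzS => // p; exact: tcoord3E.
  have := dcoordE (diff_tcoord hm) (der_nearV n3 h3).
  by rewrite hv /dt hv v1 !mulr0 mul0r !add0r.
by apply/rowP; apply: ord3_ind; rewrite mxE; [exact: v1 | exact: v2 | exact: v3].
Qed.

(** [d lambda_k] in terms of [dt_1, dt_2, dt_3], with [s = t_2]. The coefficient of [x1] contains
    [(2 pi i)^2 = - 4 pi^2]: one factor from the Halphen equation, one from [tau = 2 pi i t_1]. *)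
Definition lamform k (s tau x1 x2 x3 : C) : C :=
  x3 - 4 * cpi R ^+ 2 * s * beta k tau * x2
  + 8 * cpi R ^+ 4 * s ^+ 2 * (bprod k tau - beta k tau ^+ 2) * x1.

Lemma diff_lam m : hurwitz_domain m -> differentiable (@lam R) m.
Proof.
move=> hm; have [h1 h2] := hm; apply: differentiable_row => k.
apply: (@near_differentiable _ _ _ _ (fun p => tcoord p 0 k3 -
   2 * cpi R ^+ 2 * (tcoord p 0 k2 * tcoord p 0 k2) * beta k (mtau p))).
  by apply: near_hurwitzS => // p hp; rewrite lam_tcoord.
have dt i : differentiable (fun p => tcoord p 0 i : C) m.
  exact: (differentiable_comp (diff_tcoord hm) (differentiable_coord (tcoord m) 0 i)).
apply: differentiableB (dt k3) _.
apply: (differentiableM (differentiableM (differentiable_cst _ _) (differentiableM (dt k2) (dt k2)))).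
exact: (diff_compC (diff_mtau h1) (der_beta k h2)).
Qed.

Lemma dlamE m k v : hurwitz_domain m ->
  dcoord (@lam R) k m v = lamform k (tcoord m 0 k2) (mtau m) (dt k1 m v) (dt k2 m v) (dt k3 m v).
Proof.
move=> hm; have [h1 h2] := hm; apply: (dcoordE (diff_lam hm)).
have h := derB (der_tcoord k3 v hm) (derM (derZ (2 * cpi R ^+ 2) (der_sqr (der_tcoord k2 v hm)))
  (der_comp (der_mtau v hm) (der_beta k h2))).
apply: (der_nearV _ (der_eq h _)).
  by apply: near_hurwitzS => // p hp; rewrite lam_tcoord.
rewrite /lamform; have := ii2 R.
move: (ii R) (cpi R) (beta k _) (bprod k _) (dt k1 m v) (dt k2 m v) (dt k3 m v) (tcoord m 0 k2) => i p b q x y z t e.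
rewrite (_ : 8 * p ^+ 4 * t ^+ 2 * (q - b ^+ 2) * x = - (8 * p ^+ 4 * t ^+ 2 * (q - b ^+ 2) * x * (i ^+ 2))).
  by ring.
by rewrite e mulrN1 opprK.
Qed.

End FlatCoordinates.

(** * The metric in the coordinates [lam] and [tcoord] *)

Section Metric.
Variable R : realType.
Local Notation C := R[i].
Local Notation V := 'rV[R[i]]_3.
Local Notation tpi := (2 * cpi R * ii R).
Implicit Types (m u v p : V) (i j k : 'I_3).

Definition etadiag k m : C :=
  (16 * cpi R ^+ 4 * tcoord m 0 k2 ^+ 2 * bprod k (mtau m))^-1.

Lemma etadiag_neq0 k m : hurwitz_domain m -> etadiag k m != 0.
Proof.
move=> [h1 h2]; rewrite invr_eq0; apply: mulf_neq0; last exact: bprod_neq0.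
apply: mulf_neq0; last by apply: expf_neq0; exact: tcoord2_neq0.
by apply: mulf_neq0; [rewrite pnatr_eq0 | apply: expf_neq0; exact: cpi_neq0].
Qed.

Lemma eta_sum m u v : hurwitz_domain m ->
  eta_phi1 m u v = \sum_k etadiag k m * dcoord (@lam R) k m u * dcoord (@lam R) k m v.
Proof.
move=> hm; have [h1 h2] := hm; rewrite /eta_phi1 mulr_sumr; apply: eq_bigr => k _.
suff <- : 2^-1 * phi1_at m k ^+ 2 = etadiag k m by rewrite !mulrA.
rewrite (phi1_at_sqr k hm) (w1_sqrE h1) /etadiag.
have := bprod_neq0 k h2; have := tcoord2_neq0 h1; have := cpi_neq0 R.
move: (cpi R) (tcoord m 0 k2) (bprod k _) => p t b p0 t0 b0.
by field; rewrite p0 t0 b0.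
Qed.

(* The sums of z ^ j / prod (z - z') over the three points z are the complete
   homogeneous symmetric polynomials of degree j - 2. *)
Lemma lagrange_sum (a b c x0 x1 x2 x3 x4 x5 x6 : C) :
  a - b != 0 -> a - c != 0 -> b - c != 0 ->
  let P z := x0 + x1 * z + x2 * z ^+ 2 + x3 * z ^+ 3 + x4 * z ^+ 4 + x5 * z ^+ 5 + x6 * z ^+ 6 in
  let s := a + b + c in let s2 := a * b + a * c + b * c in let s3 := a * b * c in
  ((a - b) * (a - c))^-1 * P a + ((b - a) * (b - c))^-1 * P b + ((c - a) * (c - b))^-1 * P c =
  x2 + x3 * s + x4 * (s ^+ 2 - s2) + x5 * (s ^+ 3 - 2 * s * s2 + s3)
  + x6 * (s ^+ 4 - 3 * s ^+ 2 * s2 + s2 ^+ 2 + 2 * s * s3).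
Proof.
move=> ab ac bc P s s2 s3.
have ba : b - a != 0 by rewrite -opprB oppr_eq0.
have ca : c - a != 0 by rewrite -opprB oppr_eq0.
have cb : c - b != 0 by rewrite -opprB oppr_eq0.
have S0 : ((a - b) * (a - c))^-1 + ((b - a) * (b - c))^-1 + ((c - a) * (c - b))^-1 = 0.
  by field; rewrite ab ac bc ba ca cb.
have S1 : a * ((a - b) * (a - c))^-1 + b * ((b - a) * (b - c))^-1 + c * ((c - a) * (c - b))^-1 = 0.
  by field; rewrite ab ac bc ba ca cb.
have S2 : a ^+ 2 * ((a - b) * (a - c))^-1 + b ^+ 2 * ((b - a) * (b - c))^-1
    + c ^+ 2 * ((c - a) * (c - b))^-1 = 1.
  by field; rewrite ab ac bc ba ca cb.
move: ((a - b) * (a - c))^-1 ((b - a) * (b - c))^-1 ((c - a) * (c - b))^-1 S0 S1 S2 => A B D S0 S1 S2.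
pose S n := a ^+ n * A + b ^+ n * B + c ^+ n * D.
have rec n : S n.+3 = s * S n.+2 - s2 * S n.+1 + s3 * S n.
  by rewrite /S /s /s2 /s3 !exprS; ring.
have Z0 : S 0%N = 0 by rewrite /S !expr0 !mul1r.
have Z1 : S 1%N = 0 by rewrite /S !expr1.
have Z2 : S 2%N = 1 by [].
rewrite (_ : A * P a + B * P b + D * P c =
  x0 * S 0%N + x1 * S 1%N + x2 * S 2%N + x3 * S 3%N + x4 * S 4%N + x5 * S 5%N + x6 * S 6%N); last first.
  by rewrite /P /S; ring.
by rewrite !rec Z0 Z1 Z2; ring.
Qed.

(** As [bprod - z^2 = 2 z^2 - 2 s z + s2] at each of the three points [z], the forms [L] are
    quadratic polynomials [al + ga z + de z^2] with common coefficients, and [lagrange_sum] applies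
    to the product of two of them. *)
Lemma metric_identity (p t a b c x1 x2 x3 y1 y2 y3 : C) :
  p != 0 -> t != 0 -> a - b != 0 -> a - c != 0 -> b - c != 0 ->
  let L B z z1 z2 z3 := z3 - 4 * p ^+ 2 * t * z * z2 + 8 * p ^+ 4 * t ^+ 2 * (B - z ^+ 2) * z1 in
  let A := (a - b) * (a - c) in let B := (b - a) * (b - c) in let D := (c - a) * (c - b) in
  (16 * p ^+ 4 * t ^+ 2 * A)^-1 * L A a x1 x2 x3 * L A a y1 y2 y3 +
  (16 * p ^+ 4 * t ^+ 2 * B)^-1 * L B b x1 x2 x3 * L B b y1 y2 y3 +
  (16 * p ^+ 4 * t ^+ 2 * D)^-1 * L D c x1 x2 x3 * L D c y1 y2 y3 =
  x1 * y3 + x3 * y1 + x2 * y2.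
Proof.
move=> p0 t0 ab ac bc L A B D.
pose s := a + b + c; pose s2 := a * b + a * c + b * c.
have eA : A - a ^+ 2 = 2 * a ^+ 2 - 2 * s * a + s2 by rewrite /A /s /s2; ring.
have eB : B - b ^+ 2 = 2 * b ^+ 2 - 2 * s * b + s2 by rewrite /B /s /s2; ring.
have eD : D - c ^+ 2 = 2 * c ^+ 2 - 2 * s * c + s2 by rewrite /D /s /s2; ring.
pose al z1 z3 := z3 + 8 * p ^+ 4 * t ^+ 2 * s2 * z1.
pose ga z1 z2 := - 4 * p ^+ 2 * t * z2 - 16 * p ^+ 4 * t ^+ 2 * s * z1.
pose de z1 := 16 * p ^+ 4 * t ^+ 2 * z1.
have := lagrange_sum (al x1 x3 * al y1 y3) (al x1 x3 * ga y1 y2 + ga x1 x2 * al y1 y3)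
  (al x1 x3 * de y1 + ga x1 x2 * ga y1 y2 + de x1 * al y1 y3)
  (ga x1 x2 * de y1 + de x1 * ga y1 y2) (de x1 * de y1) 0 0 ab ac bc.
rewrite /= -/s -/s2 -/A -/B -/D => E.
rewrite /L eA eB eD !(invfM (16 * p ^+ 4 * t ^+ 2)).
move: A^-1 B^-1 D^-1 E => A' B' D' E; clearbody s s2.
refine (etrans _ (etrans (congr1 (fun z => (16 * p ^+ 4 * t ^+ 2)^-1 * z) E) _)).
  by rewrite /al /ga /de; move: (16 * p ^+ 4 * t ^+ 2)^-1 => w; ring.
by rewrite /al /ga /de; field; rewrite p0 t0.
Qed.

Lemma beta_sub_neq0 tau : uhp tau -> [/\ beta k1 tau - beta k2 tau != 0 :> C,
  beta k1 tau - beta k3 tau != 0 & beta k2 tau - beta k3 tau != 0].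
Proof.
move=> ht; have h12 := beta12 ht; have h13 := beta13 ht; have h23 := beta23 ht.
have sub (a b : C) : a != b -> a - b != 0 by rewrite subr_eq0.
by split; [exact: sub _ _ h12 | exact: sub _ _ h13 | exact: sub _ _ h23].
Qed.

Lemma eta_dt m u v : hurwitz_domain m -> eta_phi1 m u v =
  dt k1 m u * dt k3 m v + dt k3 m u * dt k1 m v + dt k2 m u * dt k2 m v.
Proof.
move=> hm; have [h1 h2] := hm; rewrite eta_sum // sum3 !dlamE // /etadiag.
have [ab ac bc] := beta_sub_neq0 h2.
exact: (metric_identity _ _ _ _ _ _ (cpi_neq0 R) (tcoord2_neq0 h1) ab ac bc).
Qed.

Lemma dt_dd i j m : hurwitz_domain m -> dt j m (dd (@tcoord R) i m) = (i == j)%:R.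
Proof. by move=> hm; apply: dcoord_dd; exact: tcoord_unit. Qed.

(** A vector killed by all [d lambda_k] is orthogonal to everything by [eta_sum], while [eta_dt]
    shows the metric to be nondegenerate in the coordinates [t]. *)
Lemma lam_unit m : hurwitz_domain m -> 'J (@lam R) m \in unitmx.
Proof.
move=> hm; apply: jacobian_unit => v hv.
have e0 u : eta_phi1 m v u = 0.
  by rewrite eta_sum // big1 // => k _; rewrite hv mulr0 mul0r.
apply: (dcoord_inj (tcoord_unit hm)) => i; rewrite -/(dt i m v) -/(dt i m 0).
have d0 : dt i m 0 = 0 by rewrite -(scale0r (0 : V)) /dt dcoordZ mul0r.
rewrite d0 {d0}; have := e0 (dd (@tcoord R) k3 m); have := e0 (dd (@tcoord R) k2 m).
have := e0 (dd (@tcoord R) k1 m); rewrite !eta_dt // !dt_dd //=.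
rewrite !mulr0 !mulr1 !addr0 !add0r.
by elim/ord3_ind: i.
Qed.

Lemma lam_coordinates : local_coordinates hurwitz_domain (@lam R).
Proof. by move=> m hm; split; [exact: diff_lam | exact: lam_unit]. Qed.

Lemma eta_flat : flat_coordinates hurwitz_domain (@eta_phi1 R) (@tcoord R).
Proof.
split; first by move=> m hm; split; [exact: diff_tcoord | exact: tcoord_unit].
exists (\matrix_(i, j) ((i == k1)%:R * (j == k3)%:R + (i == k3)%:R * (j == k1)%:R
  + (i == k2)%:R * (j == k2)%:R)).
by move=> m hm i j; rewrite eta_dt // !dt_dd // mxE.
Qed.

Lemma eta_dd_lam m j v : hurwitz_domain m ->
  eta_phi1 m (dd (@lam R) j m) v = etadiag j m * dcoord (@lam R) j m v.
Proof.
move=> hm; rewrite eta_sum // (bigD1 j) //= dcoord_dd ?lam_unit // eqxx mulr1 big1 ?addr0 //.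
by move=> k kj; rewrite dcoord_dd ?lam_unit // eq_sym (negPf kj) mulr0 mul0r.
Qed.

Lemma eta_lam_diag m i j : hurwitz_domain m ->
  eta_phi1 m (dd (@lam R) i m) (dd (@lam R) j m) = etadiag i m * (j == i)%:R.
Proof. by move=> hm; rewrite eta_dd_lam // dcoord_dd ?lam_unit. Qed.

Lemma unit_field_dd m : hurwitz_domain m -> unit_field m = dd (@tcoord R) k3 m.
Proof.
move=> hm; apply: (dcoord_inj (lam_unit hm)) => i.
rewrite [RHS]dlamE // !dt_dd // /unit_field sum3 !dcoordD !dcoord_dd ?lam_unit //.
rewrite /lamform /= !mulr0 subr0 addr0.
by elim/ord3_ind: i; rewrite /= ?addr0 ?add0r.
Qed.

Lemma dcoord_euler m i : hurwitz_domain m -> dcoord (@lam R) i m (euler_field m) = lam m 0 i.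
Proof.
move=> hm; rewrite /euler_field sum3 !dcoordD !dcoordZ !dcoord_dd ?lam_unit //.
by elim/ord3_ind: i; rewrite /= ?mulr0 ?mulr1 ?addr0 ?add0r.
Qed.

Lemma euler_field_dd m : hurwitz_domain m -> euler_field m =
  (tcoord m 0 k2 / 2) *: dd (@tcoord R) k2 m + tcoord m 0 k3 *: dd (@tcoord R) k3 m.
Proof.
move=> hm; apply: (dcoord_inj (lam_unit hm)) => i.
rewrite dcoord_euler // lam_tcoord // dcoordD !dcoordZ !dlamE // !dt_dd // /lamform /=.
move: (tcoord m 0 k2) (tcoord m 0 k3) (beta i _) (bprod i _) (cpi R) => t s b q p.
by field.
Qed.

(** [dt_1] and [dt_2] are the metric duals of [d/dt_3] and [d/dt_2], and the metric is diagonal in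
    [lam]; the components follow without inverting a Jacobian. *)
Lemma dt_dd_lam m j : hurwitz_domain m ->
  dt k1 m (dd (@lam R) j m) = etadiag j m /\
  dt k2 m (dd (@lam R) j m) = - 4 * cpi R ^+ 2 * tcoord m 0 k2 * beta j (mtau m) * etadiag j m.
Proof.
move=> hm.
have key w : eta_phi1 m w (dd (@tcoord R) k3 m) = dt k1 m w /\
    eta_phi1 m w (dd (@tcoord R) k2 m) = dt k2 m w.
  by rewrite !eta_dt // !dt_dd //= !mulr0 !mulr1 !addr0 add0r.
have [<- <-] := key (dd (@lam R) j m); rewrite !(eta_dd_lam j _ hm) !(dlamE j _ hm) !dt_dd // /lamform /=.
rewrite !mulr0 !mulr1 !addr0 subr0 mulr1 sub0r; split=> //.
by move: (etadiag j m) (beta j _) (tcoord m 0 k2) (cpi R) => e b t p; ring.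
Qed.

Lemma diff_tcoord_i i m : hurwitz_domain m -> differentiable (fun p => tcoord p 0 i : C) m.
Proof. by move=> hm; exact: (differentiable_comp (diff_tcoord hm) (differentiable_coord (tcoord m) 0 i)). Qed.

Lemma diff_etadiag k m : hurwitz_domain m -> differentiable (etadiag k) m.
Proof.
move=> hm; have [h1 h2] := hm; apply: (differentiableV _ _); last first.
  by have := etadiag_neq0 k hm; rewrite invr_eq0.
have dt2 := diff_tcoord_i k2 hm.
have d1 := differentiableM (differentiable_cst (16 * cpi R ^+ 4) m) (differentiableM dt2 dt2).
exact: (differentiableM d1 (diff_compC (diff_mtau h1) (der_bprod k h2))).
Qed.

(** Dividing by the value at [m] brings the argument near 1, where [local_sqrt] is
    differentiable. *)
Lemma sqrt_etadiag k m : hurwitz_domain m -> exists H : V -> C,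
  \forall p \near m, differentiable H p /\ H p ^+ 2 = etadiag k p.
Proof.
move=> hm; have [h hh] := local_sqrt R; have e0 := etadiag_neq0 k hm.
pose q (p : V) : C := (etadiag k m)^-1 * etadiag k p.
have qm : q m = 1 by exact: mulVf e0.
exists (fun p => sqrtC (etadiag k m) * h (q p)).
have dq p : hurwitz_domain p -> differentiable q p.
  by move=> hp; apply: (differentiableM (differentiable_cst _ _)); exact: diff_etadiag.
have c := differentiable_continuous (dq m hm).
have n1 : \forall p \near m, cmod (q p - 1) < 2^-1.
  have := (cvg_cmodP (nbhs_filter m) _ _).1 c 2^-1 ltac:(lra).
  by rewrite qm.
have n2 := near_hurwitz hm.
apply: filterS2 n1 n2 => p p1 p2; have [q1 q2] := hh _ p1; split.
  by apply: (differentiableM (differentiable_cst _ _)); exact: diff_compC (dq p p2) q2.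
by rewrite (exprMn 2 (sqrtC _)) q1 sqrtCK /q mulVKf.
Qed.

Lemma der_etadiagV k m v : hurwitz_domain m -> is_derive m v (fun p => (etadiag k p)^-1)
  ((etadiag k m)^-1 * (2 * dt k2 m v / tcoord m 0 k2
     + 8 * cpi R ^+ 2 * (bsum (mtau m) - beta k (mtau m)) * dt k1 m v)).
Proof.
move=> hm; have [h1 h2] := hm.
have h := derM (derZ (16 * cpi R ^+ 4) (der_sqr (der_tcoord k2 v hm)))
  (der_comp (der_mtau v hm) (der_bprod k h2)).
have t0 := tcoord2_neq0 h1.
apply: (der_nearV _ (der_eq h _)).
  by apply: near_hurwitzS => // p _; rewrite /etadiag invrK.
rewrite /etadiag invrK; have := ii2 R; move: t0.
move: (tcoord m 0 k2) (dt k1 m v) (dt k2 m v) (cpi R) (ii R) (bprod k _) (beta k _) (bsum _)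
  => t x y p i b c s t0 e.
have -> : - 4 * p * i * (s - c) * b * (2 * p * i * x) = 8 * p ^+ 2 * (s - c) * b * x.
  by rewrite (_ : _ * _ = - (8 * p ^+ 2 * (s - c) * b * x * i ^+ 2)); [rewrite e; ring | ring].
by field.
Qed.

(** Obtained by differentiating [H^2 / eta_kk = 1]. As [eta_jj = H_j^2], dividing by [H_j] leaves
    [- 4 pi^2 H_k H_j (s - b_k - b_j)], symmetric in [j] and [k]: this is the Egoroff property. *)
Lemma der_sqrt_etadiag k j m (H : V -> C) : hurwitz_domain m ->
  (\forall p \near m, differentiable H p /\ H p ^+ 2 = etadiag k p) ->
  'D_(dd (@lam R) j m) H m =
  - 4 * cpi R ^+ 2 * H m * etadiag j m * (bsum (mtau m) - beta k (mtau m) - beta j (mtau m)).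
Proof.
move=> hm hH; have [h1 h2] := hm; have [dH HE] := nbhs_singleton hH.
have e0 := etadiag_neq0 k hm; have t0 := tcoord2_neq0 h1.
set v := dd _ j m; have dv := diff_derivable (v := v) dH.
have dHv : is_derive m v H ('D_v H m) by exact: DeriveDef.
have h := derM (der_sqr dHv) (der_etadiagV k v hm).
have h' : is_derive m v (fun p => H p ^+ 2 * (etadiag k p)^-1) 0.
  apply: (der_nearV _ (der_cst m v 1)).
  have hn := near_hurwitz hm; apply: filterS2 hH hn => p [_ ->] hp.
  by rewrite (divff (etadiag_neq0 k hp)).
have := der_unique h h'; have [-> ->] := dt_dd_lam j hm.
have H0 : H m != 0 by rewrite -sqrf_eq0 HE.
rewrite -HE; move: H0 t0.
move: ('D_v H m) (H m) (etadiag j m) (tcoord m 0 k2) (cpi R) (beta j _) (beta k _) (bsum _)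
  => d x e t p b c s x0 t0 E.
have : 2 * x * d * (x ^+ 2)^-1 = - (x ^+ 2 * ((x ^+ 2)^-1 * (2 * (-4 * p ^+ 2 * t * b * e) / t + 8 * p ^+ 2 * (s - c) * e))).
  by apply/eqP; rewrite -addr_eq0 E.
move=> /(congr1 (fun z => z * x / 2)).
have -> : 2 * x * d * (x ^+ 2)^-1 * x / 2 = d by field.
by move=> ->; field; rewrite x0 t0.
Qed.

Lemma near_ord3 (P : 'I_3 -> V -> Prop) m :
  (forall k, \forall p \near m, P k p) -> \forall p \near m, forall k, P k p.
Proof. by move=> h; apply: filterS3 (h k1) (h k2) (h k3) => p; exact: ord3_ind. Qed.

Lemma eta_darboux_egoroff : darboux_egoroff hurwitz_domain (@eta_phi1 R) (@lam R).
Proof.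
split.
- exact: lam_coordinates.
- move=> m hm i j; rewrite eta_lam_diag // mulf_eq0 (negPf (etadiag_neq0 i hm)) /=.
  by rewrite (eq_sym j i); case: (i == j); rewrite ?oner_eq0 ?eqxx.
- move=> m hm; exists hurwitz_domain, (@tcoord R); split => //.
    exact: open_hurwitz.
  exact: eta_flat.
move=> m hm; have [H hH] := choice (fun k => sqrt_etadiag k hm).
exists H; split.
  have hn := near_hurwitz hm; have hH3 := near_ord3 hH.
  by apply: filterS2 hH3 hn => p h3 hp i; rewrite eta_lam_diag // eqxx mulr1; exact: h3.
move=> i j _; rewrite (der_sqrt_etadiag j hm (hH i)) (der_sqrt_etadiag i hm (hH j)).
have [_ <-] := nbhs_singleton (hH i); have [_ <-] := nbhs_singleton (hH j).
have H0 k : H k m != 0.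
  by have [_ hk] := nbhs_singleton (hH k); rewrite -sqrf_eq0 hk etadiag_neq0.
move: (H0 i) (H0 j); move: (H i m) (H j m) (cpi R) (beta i _) (beta j _) (bsum _) => x y p a b s x0 y0.
by field; rewrite x0 y0.
Qed.

End Metric.

(** * The prepotential *)

Section Prepotential.
Variable R : realType.
Local Notation C := R[i].
Local Notation V := 'rV[R[i]]_3.
Local Notation tpi := (2 * cpi R * ii R).
Implicit Types (m u v p t : V) (i j k : 'I_3) (tau : C).

Definition bsum2 tau : C := beta1 tau * beta2 tau + beta1 tau * beta3 tau + beta2 tau * beta3 tau.
Definition bsum3 tau : C := beta1 tau * beta2 tau * beta3 tau.

(** The Halphen system in elementary symmetric functions, equivalent to Ramanujan's system for [E2],
    [E4], [E6]. Its closure makes the derivatives of [F] polynomial in [t], [bsum], [bsum2] and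
    [bsum3]. *)
Lemma der_bsum tau : uhp tau -> is_derive tau 1 (@bsum R) (tpi * - bsum2 tau).
Proof.
move=> ht; apply: der_eq (derD (derD (halphen1 ht) (halphen2 ht)) (halphen3 ht)) _.
rewrite /bsum2; move: (beta1 tau) (beta2 tau) (beta3 tau) (cpi R) (ii R) => a b c p i; ring.
Qed.

Lemma der_bsum2 tau : uhp tau -> is_derive tau 1 bsum2 (tpi * (- 6 * bsum3 tau)).
Proof.
move=> ht; have d1 := halphen1 ht; have d2 := halphen2 ht; have d3 := halphen3 ht.
apply: der_eq (derD (derD (derM d1 d2) (derM d1 d3)) (derM d2 d3)) _.
rewrite /bsum3; move: (beta1 tau) (beta2 tau) (beta3 tau) (cpi R) (ii R) => a b c p i; ring.
Qed.

Lemma der_bsum3 tau : uhp tau ->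
  is_derive tau 1 bsum3 (tpi * (bsum2 tau ^+ 2 - 4 * bsum tau * bsum3 tau)).
Proof.
move=> ht; have d1 := halphen1 ht; have d2 := halphen2 ht; have d3 := halphen3 ht.
apply: der_eq (derM (derM d1 d2) d3) _.
rewrite /bsum /bsum2 /bsum3.
move: (beta1 tau) (beta2 tau) (beta3 tau) (cpi R) (ii R) => a b c p i; ring.
Qed.

Lemma E2_bsum tau : uhp tau -> E2 tau = - 4 * bsum tau.
Proof. exact: E2_beta. Qed.

Lemma der_E2 tau : uhp tau -> is_derive tau 1 (@E2 R) (tpi * (4 * bsum2 tau)).
Proof.
move=> ht; apply: (der_uhp ht _ (der_eq (derZ (- 4) (der_bsum ht)) _)).
  by move=> t0 h0; rewrite E2_bsum.
by move: (bsum2 tau) (cpi R) (ii R) => s p i; ring.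
Qed.

Lemma tpi_sqr : tpi ^+ 2 = - 4 * cpi R ^+ 2.
Proof.
rewrite (_ : tpi ^+ 2 = 4 * cpi R ^+ 2 * ii R ^+ 2); last by move: (cpi R) (ii R) => p i; ring.
by rewrite ii2; ring.
Qed.

Definition gradF (t1 t2 t3 : C) k : C :=
  [:: t3 ^+ 2 / 2 - 2 / 3 * cpi R ^+ 4 * t2 ^+ 4 * bsum2 (tpi * t1);
      t3 * t2 - 2 / 3 * cpi R ^+ 2 * t2 ^+ 3 * bsum (tpi * t1);
      t3 * t1 + t2 ^+ 2 / 2]`_k.

Section AlongCurve.
Variables (U : normedModType C) (x v : U) (T1 T2 T3 : U -> C) (a1 a2 a3 : C).
Hypotheses (d1 : is_derive x v T1 a1) (d2 : is_derive x v T2 a2) (d3 : is_derive x v T3 a3).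
Hypothesis hx : uhp (tpi * T1 x).

(** Stated for functions [T1], [T2], [T3] on any normed module: it serves for the coordinate
    directions of t-space and for the Euler field on [hurwitz_domain]. *)
Lemma der_F : is_derive x v (fun y => T3 y ^+ 2 / 2 * T1 y + T3 y / 2 * T2 y ^+ 2 +
    cpi R ^+ 2 / 24 * T2 y ^+ 4 * E2 (tpi * T1 y))
  (a1 * gradF (T1 x) (T2 x) (T3 x) k1 + a2 * gradF (T1 x) (T2 x) (T3 x) k2
    + a3 * gradF (T1 x) (T2 x) (T3 x) k3).
Proof.
have dE := der_comp (derZ tpi d1) (der_E2 hx).
have h2 := der_sqr d2.
have h := derD (derD (derM (derM (der_sqr d3) (der_cst x v 2^-1)) d1)
  (derM (derM d3 (der_cst x v 2^-1)) h2))
  (derM (derZ (cpi R ^+ 2 / 24) (der_sqr h2)) dE).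
have E : (fun y => T3 y ^+ 2 / 2 * T1 y + T3 y / 2 * T2 y ^+ 2 +
    cpi R ^+ 2 / 24 * T2 y ^+ 4 * E2 (tpi * T1 y)) =
  (fun y => T3 y ^+ 2 / 2 * T1 y + T3 y / 2 * T2 y ^+ 2 +
    cpi R ^+ 2 / 24 * (T2 y ^+ 2) ^+ 2 * E2 (tpi * T1 y)).
  by apply/funext => y; rewrite -exprM.
rewrite E; apply: der_eq (h) _; rewrite /gradF /= E2_bsum //.
rewrite (_ : tpi * (4 * bsum2 (tpi * T1 x)) * (tpi * a1) = 4 * bsum2 (tpi * T1 x) * a1 * tpi ^+ 2); last first.
  by move: (tpi) (bsum2 _) => q s; ring.
rewrite tpi_sqr; move: (cpi R) (T3 x) (T2 x) (T1 x) (bsum _) (bsum2 _) => p t3 t2 t1 s s2.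
by field.
Qed.

Lemma der_F1 : is_derive x v (fun y => gradF (T1 y) (T2 y) (T3 y) k1)
  (a1 * (- 16 * cpi R ^+ 6 * T2 x ^+ 4 * bsum3 (tpi * T1 x))
   + a2 * (- (8 / 3) * cpi R ^+ 4 * T2 x ^+ 3 * bsum2 (tpi * T1 x)) + a3 * T3 x).
Proof.
have dE := der_comp (derZ tpi d1) (der_bsum2 hx).
have h := derB (derM (der_sqr d3) (der_cst x v 2^-1))
  (derM (derZ (2 / 3 * cpi R ^+ 4) (der_sqr (der_sqr d2))) dE).
have E : (fun y => gradF (T1 y) (T2 y) (T3 y) k1) =
  (fun y => T3 y ^+ 2 / 2 - 2 / 3 * cpi R ^+ 4 * (T2 y ^+ 2) ^+ 2 * bsum2 (tpi * T1 y)).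
  by apply/funext => y; rewrite -exprM.
rewrite E; apply: der_eq (h) _.
rewrite (_ : tpi * (- 6 * bsum3 (tpi * T1 x)) * (tpi * a1) = - 6 * bsum3 (tpi * T1 x) * a1 * tpi ^+ 2); last first.
  by move: (tpi) (bsum3 _) => q s; ring.
rewrite tpi_sqr; move: (cpi R) (T3 x) (T2 x) (T1 x) (bsum3 _) (bsum2 _) => p t3 t2 t1 s s2.
by field.
Qed.

Lemma der_F2 : is_derive x v (fun y => gradF (T1 y) (T2 y) (T3 y) k2)
  (a1 * (- (8 / 3) * cpi R ^+ 4 * T2 x ^+ 3 * bsum2 (tpi * T1 x))
   + a2 * (T3 x - 2 * cpi R ^+ 2 * T2 x ^+ 2 * bsum (tpi * T1 x)) + a3 * T2 x).
Proof.
have dE := der_comp (derZ tpi d1) (der_bsum hx).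
have h := derB (derM d3 d2)
  (derM (derZ (2 / 3 * cpi R ^+ 2) (derM d2 (der_sqr d2))) dE).
have E : (fun y => gradF (T1 y) (T2 y) (T3 y) k2) =
  (fun y => T3 y * T2 y - 2 / 3 * cpi R ^+ 2 * (T2 y * T2 y ^+ 2) * bsum (tpi * T1 y)).
  by apply/funext => y; rewrite -exprS.
rewrite E; apply: der_eq (h) _.
rewrite (_ : tpi * - bsum2 (tpi * T1 x) * (tpi * a1) = - bsum2 (tpi * T1 x) * a1 * tpi ^+ 2); last first.
  by move: (tpi) (bsum2 _) => q s; ring.
rewrite tpi_sqr; move: (cpi R) (T3 x) (T2 x) (T1 x) (bsum _) (bsum2 _) => p t3 t2 t1 s s2.
by field.
Qed.

Lemma der_F3 : is_derive x v (fun y => gradF (T1 y) (T2 y) (T3 y) k3)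
  (a1 * T3 x + a2 * T2 x + a3 * T1 x).
Proof.
have h := derD (derM d3 d1) (derM (der_sqr d2) (der_cst x v 2^-1)).
rewrite /gradF /=; apply: der_eq (h) _.
by move: (T1 x) (T2 x) (T3 x) => t1 t2 t3; field.
Qed.

Lemma der_F11 : is_derive x v (fun y => - 16 * cpi R ^+ 6 * T2 y ^+ 4 * bsum3 (tpi * T1 y))
  (a1 * (64 * cpi R ^+ 8 * T2 x ^+ 4 * (bsum2 (tpi * T1 x) ^+ 2 - 4 * bsum (tpi * T1 x) * bsum3 (tpi * T1 x)))
   - a2 * (64 * cpi R ^+ 6 * T2 x ^+ 3 * bsum3 (tpi * T1 x))).
Proof.
have dE := der_comp (derZ tpi d1) (der_bsum3 hx).
have h := derM (derZ (- 16 * cpi R ^+ 6) (der_sqr (der_sqr d2))) dE.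
have E : (fun y => - 16 * cpi R ^+ 6 * T2 y ^+ 4 * bsum3 (tpi * T1 y)) =
  (fun y => - 16 * cpi R ^+ 6 * (T2 y ^+ 2) ^+ 2 * bsum3 (tpi * T1 y)).
  by apply/funext => y; rewrite -exprM.
rewrite E; apply: der_eq (h) _.
set w := _ ^+ 2 - _; rewrite (_ : tpi * w * (tpi * a1) = w * a1 * tpi ^+ 2); last first.
  by clearbody w; move: (tpi) => q; ring.
rewrite tpi_sqr; clearbody w; move: (cpi R) (T2 x) (bsum3 _) => p t2 s.
by ring.
Qed.

Lemma der_F12 : is_derive x v (fun y => - (8 / 3) * cpi R ^+ 4 * T2 y ^+ 3 * bsum2 (tpi * T1 y))
  (- a1 * (64 * cpi R ^+ 6 * T2 x ^+ 3 * bsum3 (tpi * T1 x))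
   - a2 * (8 * cpi R ^+ 4 * T2 x ^+ 2 * bsum2 (tpi * T1 x))).
Proof.
have dE := der_comp (derZ tpi d1) (der_bsum2 hx).
have h := derM (derZ (- (8 / 3) * cpi R ^+ 4) (derM d2 (der_sqr d2))) dE.
have E : (fun y => - (8 / 3) * cpi R ^+ 4 * T2 y ^+ 3 * bsum2 (tpi * T1 y)) =
  (fun y => - (8 / 3) * cpi R ^+ 4 * (T2 y * T2 y ^+ 2) * bsum2 (tpi * T1 y)).
  by apply/funext => y; rewrite -exprS.
rewrite E; apply: der_eq (h) _.
rewrite (_ : tpi * (- 6 * bsum3 (tpi * T1 x)) * (tpi * a1) = - 6 * bsum3 (tpi * T1 x) * a1 * tpi ^+ 2); last first.
  by move: (tpi) (bsum3 _) => q s; ring.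
rewrite tpi_sqr; move: (cpi R) (T2 x) (bsum3 _) (bsum2 _) => p t2 s s2.
by field.
Qed.

Lemma der_F22 : is_derive x v (fun y => T3 y - 2 * cpi R ^+ 2 * T2 y ^+ 2 * bsum (tpi * T1 y))
  (- a1 * (8 * cpi R ^+ 4 * T2 x ^+ 2 * bsum2 (tpi * T1 x))
   - a2 * (4 * cpi R ^+ 2 * T2 x * bsum (tpi * T1 x)) + a3).
Proof.
have dE := der_comp (derZ tpi d1) (der_bsum hx).
have h := derB d3 (derM (derZ (2 * cpi R ^+ 2) (der_sqr d2)) dE).
apply: der_eq (h) _.
rewrite (_ : tpi * - bsum2 (tpi * T1 x) * (tpi * a1) = - bsum2 (tpi * T1 x) * a1 * tpi ^+ 2); last first.
  by move: (tpi) (bsum2 _) => q s; ring.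
rewrite tpi_sqr; move: (cpi R) (T3 x) (T2 x) (bsum _) (bsum2 _) => p t3 t2 s s2.
by ring.
Qed.

End AlongCurve.

End Prepotential.

(** * Third derivatives of [F], the structure constants and quasi-homogeneity *)

Section ThirdDerivatives.
Variable R : realType.
Local Notation C := R[i].
Local Notation V := 'rV[R[i]]_3.
Local Notation tpi := (2 * cpi R * ii R).
Implicit Types (m u v p t : V) (i j k : 'I_3) (tau : C).

Definition hessF (t1 t2 t3 : C) j k : C :=
  [:: [:: - 16 * cpi R ^+ 6 * t2 ^+ 4 * bsum3 (tpi * t1);
          - (8 / 3) * cpi R ^+ 4 * t2 ^+ 3 * bsum2 (tpi * t1); t3]`_k;
      [:: - (8 / 3) * cpi R ^+ 4 * t2 ^+ 3 * bsum2 (tpi * t1);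
          t3 - 2 * cpi R ^+ 2 * t2 ^+ 2 * bsum (tpi * t1); t2]`_k;
      [:: t3; t2; t1]`_k]`_j.

(** The analogue of [metric_identity] for three factors, now of degree up to 6. The first two
    factors are the directions [t_1] and [t_2]; products involving [t_3] are handled by the unit
    property. *)
Lemma cubic_identity (p t a b c x1 x2 x3 : C) :
  p != 0 -> t != 0 -> a - b != 0 -> a - c != 0 -> b - c != 0 ->
  let L B z z1 z2 z3 := z3 - 4 * p ^+ 2 * t * z * z2 + 8 * p ^+ 4 * t ^+ 2 * (B - z ^+ 2) * z1 in
  let A := (a - b) * (a - c) in let B := (b - a) * (b - c) in let D := (c - a) * (c - b) in
  let s := a + b + c in let s2 := a * b + a * c + b * c in let s3 := a * b * c in
  let T y1 y2 y1' y2' :=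
    (16 * p ^+ 4 * t ^+ 2 * A)^-1 * L A a y1 y2 0 * L A a y1' y2' 0 * L A a x1 x2 x3 +
    (16 * p ^+ 4 * t ^+ 2 * B)^-1 * L B b y1 y2 0 * L B b y1' y2' 0 * L B b x1 x2 x3 +
    (16 * p ^+ 4 * t ^+ 2 * D)^-1 * L D c y1 y2 0 * L D c y1' y2' 0 * L D c x1 x2 x3 in
  [/\ T 1 0 1 0 = x1 * (64 * p ^+ 8 * t ^+ 4 * (s2 ^+ 2 - 4 * s * s3)) - x2 * (64 * p ^+ 6 * t ^+ 3 * s3),
      T 1 0 0 1 = - x1 * (64 * p ^+ 6 * t ^+ 3 * s3) - x2 * (8 * p ^+ 4 * t ^+ 2 * s2) &
      T 0 1 0 1 = - x1 * (8 * p ^+ 4 * t ^+ 2 * s2) - x2 * (4 * p ^+ 2 * t * s) + x3].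
Proof.
move=> p0 t0 ab ac bc L A B D s s2 s3 T.
have eA : A - a ^+ 2 = 2 * a ^+ 2 - 2 * s * a + s2 by rewrite /A /s /s2; ring.
have eB : B - b ^+ 2 = 2 * b ^+ 2 - 2 * s * b + s2 by rewrite /B /s /s2; ring.
have eD : D - c ^+ 2 = 2 * c ^+ 2 - 2 * s * c + s2 by rewrite /D /s /s2; ring.
pose e := 16 * p ^+ 4 * t ^+ 2; pose h := 8 * p ^+ 4 * t ^+ 2; pose g := - 4 * p ^+ 2 * t.
(* [al + ga z + de z^2] is the third factor; the directions [t_1] and [t_2] give
   [h (2 z^2 - 2 s z + s2)] and [g z], whose products are expanded below. *)
pose al := x3 + h * s2 * x1; pose ga := g * x2 - 2 * h * s * x1; pose de := 2 * h * x1.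
have E11 := lagrange_sum (h ^+ 2 * s2 ^+ 2 * al)
  (h ^+ 2 * (s2 ^+ 2 * ga - 4 * s * s2 * al))
  (h ^+ 2 * (s2 ^+ 2 * de - 4 * s * s2 * ga + (4 * s ^+ 2 + 4 * s2) * al))
  (h ^+ 2 * (- 4 * s * s2 * de + (4 * s ^+ 2 + 4 * s2) * ga - 8 * s * al))
  (h ^+ 2 * ((4 * s ^+ 2 + 4 * s2) * de - 8 * s * ga + 4 * al))
  (h ^+ 2 * (- 8 * s * de + 4 * ga)) (h ^+ 2 * 4 * de) ab ac bc.
have E12 := lagrange_sum 0 (g * h * s2 * al) (g * h * (s2 * ga - 2 * s * al))
  (g * h * (s2 * de - 2 * s * ga + 2 * al)) (g * h * (- 2 * s * de + 2 * ga)) (g * h * 2 * de) 0 ab ac bc.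
have E22 := lagrange_sum 0 0 (g ^+ 2 * al) (g ^+ 2 * ga) (g ^+ 2 * de) 0 0 ab ac bc.
rewrite /= -/s -/s2 -/s3 -/A -/B -/D in E11 E12 E22.
rewrite /T /L eA eB eD !(invfM (16 * p ^+ 4 * t ^+ 2)) -/e.
move: A^-1 B^-1 D^-1 E11 E12 E22 => A' B' D' E11 E12 E22; clearbody s s2 s3.
have e0 : e != 0 by rewrite /e !mulf_neq0 ?expf_neq0 ?pnatr_eq0.
split.
- refine (etrans _ (etrans (congr1 (fun z => e^-1 * z) E11) _)).
    by rewrite /al /ga /de /h /g; move: e^-1 => w; ring.
  by rewrite /al /ga /de /e /h /g; field; rewrite p0 t0.
- refine (etrans _ (etrans (congr1 (fun z => e^-1 * z) E12) _)).
    by rewrite /al /ga /de /h /g; move: e^-1 => w; ring.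
  by rewrite /al /ga /de /e /h /g; field; rewrite p0 t0.
refine (etrans _ (etrans (congr1 (fun z => e^-1 * z) E22) _)).
  by rewrite /al /ga /de /h /g; move: e^-1 => w; ring.
by rewrite /al /ga /de /e /h /g; field; rewrite p0 t0.
Qed.

Lemma eta_hmul m u v w : hurwitz_domain m -> eta_phi1 m (hmul m u v) w =
  \sum_k etadiag k m * dcoord (@lam R) k m u * dcoord (@lam R) k m v * dcoord (@lam R) k m w.
Proof.
move=> hm; rewrite eta_sum //; apply: eq_bigr => k _; congr (_ * _).
rewrite -mulrA; congr (_ * _); rewrite /hmul sum3 !dcoordD !dcoordZ !dcoord_dd ?lam_unit //.
by elim/ord3_ind: k; rewrite /= ?mulr0 ?mulr1 ?addr0 ?add0r.
Qed.

Lemma hmulC m u v : hmul m u v = hmul m v u.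
Proof. by rewrite /hmul; apply: eq_bigr => k _; rewrite mulrC. Qed.

Lemma dt_hmul_unit m u v : hurwitz_domain m ->
  eta_phi1 m (hmul m u (dd (@tcoord R) k3 m)) v = eta_phi1 m u v.
Proof.
move=> hm; rewrite eta_hmul // eta_sum //; apply: eq_bigr => k _.
rewrite (dlamE k (dd _ k3 m)) // !dt_dd // /lamform /= !mulr0 subr0 addr0 mulr1.
by [].
Qed.

Lemma eta_hmulC m u v w : hurwitz_domain m ->
  eta_phi1 m (hmul m u v) w = eta_phi1 m (hmul m v w) u.
Proof.
move=> hm; rewrite !eta_hmul //; apply: eq_bigr => k _.
by move: (etadiag k m) (dcoord _ k m u) (dcoord _ k m v) (dcoord _ k m w) => e a b c; ring.
Qed.

Definition thirdF m (x1 x2 x3 : C) j k : C :=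
  eta_phi1 m (hmul m (dd (@tcoord R) j m) (dd (@tcoord R) k m))
    (x1 *: dd (@tcoord R) k1 m + x2 *: dd (@tcoord R) k2 m + x3 *: dd (@tcoord R) k3 m).

Lemma dt_comb m (x1 x2 x3 : C) : hurwitz_domain m ->
  let v := x1 *: dd (@tcoord R) k1 m + x2 *: dd (@tcoord R) k2 m + x3 *: dd (@tcoord R) k3 m in
  [/\ dt k1 m v = x1, dt k2 m v = x2 & dt k3 m v = x3].
Proof.
move=> hm v; rewrite /dt /v !dcoordD !dcoordZ -!/(dt _ m _) !dt_dd //=.
by rewrite !mulr0 !mulr1 !addr0 !add0r.
Qed.

(** Entries with an index [k3] reduce to the metric because [d/dt_3] is the unit; [cubic_identity]
    gives the entries over [k1] and [k2], up to symmetry. *)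
Lemma der_hessF m (x1 x2 x3 : C) j k : hurwitz_domain m ->
  is_derive (tcoord m) (row3 x1 x2 x3) (fun t : V => hessF (t 0 k1) (t 0 k2) (t 0 k3) j k)
    (thirdF m x1 x2 x3 j k).
Proof.
move=> hm; have [h1 h2] := hm; set v := row3 x1 x2 x3.
have [v1 v2 v3] := row3E x1 x2 x3.
have d1 := der_coord k1 (tcoord m) v; have d2 := der_coord k2 (tcoord m) v.
have d3 := der_coord k3 (tcoord m) v; rewrite v1 in d1; rewrite v2 in d2; rewrite v3 in d3.
have hx : uhp (tpi * tcoord m 0 k1) by rewrite -mtauE.
have [ab ac bc] := beta_sub_neq0 h2; have t0 := tcoord2_neq0 h1.
have [c11 c12 c22] := cubic_identity x1 x2 x3 (cpi_neq0 R) t0 ab ac bc.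
have [w1E w2E w3E] := dt_comb x1 x2 x3 hm.
have unitE u : eta_phi1 m (hmul m u (dd (@tcoord R) k3 m))
    (x1 *: dd (@tcoord R) k1 m + x2 *: dd (@tcoord R) k2 m + x3 *: dd (@tcoord R) k3 m) =
  dt k1 m u * x3 + dt k3 m u * x1 + dt k2 m u * x2.
  by rewrite dt_hmul_unit // eta_dt // w1E w2E w3E.
have sumE u w : eta_phi1 m (hmul m u w)
    (x1 *: dd (@tcoord R) k1 m + x2 *: dd (@tcoord R) k2 m + x3 *: dd (@tcoord R) k3 m) =
  \sum_k etadiag k m * lamform k (tcoord m 0 k2) (mtau m) (dt k1 m u) (dt k2 m u) (dt k3 m u)
    * lamform k (tcoord m 0 k2) (mtau m) (dt k1 m w) (dt k2 m w) (dt k3 m w)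
    * lamform k (tcoord m 0 k2) (mtau m) x1 x2 x3.
  by rewrite eta_hmul //; apply: eq_bigr => l _; rewrite !dlamE // w1E w2E w3E.
have symT : thirdF m x1 x2 x3 k j = thirdF m x1 x2 x3 j k by rewrite /thirdF hmulC.
have f11 := der_F11 d1 d2 hx; have f12 := der_F12 d1 d2 hx; have f22 := der_F22 d1 d2 d3 hx.
rewrite -!mtauE in f11 f12 f22.
have T11 : thirdF m x1 x2 x3 k1 k1 = x1 * (64 * cpi R ^+ 8 * tcoord m 0 k2 ^+ 4 *
    (bsum2 (mtau m) ^+ 2 - 4 * bsum (mtau m) * bsum3 (mtau m)))
    - x2 * (64 * cpi R ^+ 6 * tcoord m 0 k2 ^+ 3 * bsum3 (mtau m)).
  by rewrite /thirdF sumE sum3 !dt_dd //=; exact: c11.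
have T12 : thirdF m x1 x2 x3 k1 k2 = - x1 * (64 * cpi R ^+ 6 * tcoord m 0 k2 ^+ 3 * bsum3 (mtau m))
    - x2 * (8 * cpi R ^+ 4 * tcoord m 0 k2 ^+ 2 * bsum2 (mtau m)).
  by rewrite /thirdF sumE sum3 !dt_dd //=; exact: c12.
have T22 : thirdF m x1 x2 x3 k2 k2 = - x1 * (8 * cpi R ^+ 4 * tcoord m 0 k2 ^+ 2 * bsum2 (mtau m))
    - x2 * (4 * cpi R ^+ 2 * tcoord m 0 k2 * bsum (mtau m)) + x3.
  by rewrite /thirdF sumE sum3 !dt_dd //=; exact: c22.
have T13 : thirdF m x1 x2 x3 k1 k3 = x3.
  by rewrite /thirdF unitE !dt_dd //= !mul0r mul1r !addr0.
have T23 : thirdF m x1 x2 x3 k2 k3 = x2.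
  by rewrite /thirdF unitE !dt_dd //= !mul0r mul1r !add0r.
have T33 : thirdF m x1 x2 x3 k3 k3 = x1.
  by rewrite /thirdF unitE !dt_dd //= !mul0r mul1r add0r addr0.
elim/ord3_ind: j symT; elim/ord3_ind: k => symT; rewrite /hessF /=.
- by rewrite T11; exact: f11.
- by rewrite T12; exact: f12.
- by rewrite T13; exact: d3.
- by rewrite -symT T12; exact: f12.
- by rewrite T22; exact: f22.
- by rewrite T23; exact: d2.
- by rewrite -symT T13; exact: d3.
- by rewrite -symT T23; exact: d2.
- by rewrite T33; exact: d1.
Qed.

(** An open set of t-space that contains the image of [tcoord]: iterated partial derivatives at
    [tcoord m] need the lower ones on a neighbourhood in t-space. *)
Definition sdom : set V := [set t | uhp (tpi * t 0 k1)].

Lemma near_sdom t : sdom t -> \forall p \near t, sdom p.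
Proof.
move=> ht.
have dc : differentiable (fun p : V => tpi * p 0 k1) t.
  exact: (differentiableM (differentiable_cst _ _) (differentiable_coord t 0 k1)).
have c := differentiable_continuous dc.
have n : \forall p \near t, cmod (tpi * (p : V) 0 k1 - tpi * t 0 k1) < complex.Im (tpi * t 0 k1).
  exact: (cvg_cmodP (nbhs_filter t) _ _).1 c _ ht.
apply: filterS n => p hp; rewrite /sdom /=.
by have := uhp_near hp; rewrite (addrC (tpi * t 0 k1)) subrK.
Qed.

Lemma sdom_tcoord m : hurwitz_domain m -> sdom (tcoord m).
Proof. by move=> [_ h]; rewrite /sdom /= -mtauE. Qed.

Lemma delta_row3 c : (delta_mx 0 c : V) = row3 (c == k1)%:R (c == k2)%:R (c == k3)%:R.
Proof. by apply/rowP => i; rewrite !mxE; elim/ord3_ind: c; elim/ord3_ind: i. Qed.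

Lemma der_Fphi1 t c : sdom t ->
  is_derive t (delta_mx 0 c) (@Fphi1 R) (gradF (t 0 k1) (t 0 k2) (t 0 k3) c).
Proof.
move=> ht; set v := delta_mx 0 c.
have d1 := der_coord k1 t v; have d2 := der_coord k2 t v; have d3 := der_coord k3 t v.
apply: der_eq (der_F d1 d2 d3 ht) _; rewrite /v !mxE.
by elim/ord3_ind: c {v d1 d2 d3}; rewrite /= !(mul0r, mul1r, addr0, add0r).
Qed.

Lemma der_gradF t b c : sdom t ->
  is_derive t (delta_mx 0 b) (fun t : V => gradF (t 0 k1) (t 0 k2) (t 0 k3) c)
    (hessF (t 0 k1) (t 0 k2) (t 0 k3) b c).
Proof.
move=> ht; set v := delta_mx 0 b.
have d1 := der_coord k1 t v; have d2 := der_coord k2 t v; have d3 := der_coord k3 t v.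
elim/ord3_ind: c.
- apply: der_eq (der_F1 d1 d2 d3 ht) _; rewrite /v !mxE.
  by elim/ord3_ind: b {v d1 d2 d3}; rewrite /= !(mul0r, mul1r, addr0, add0r).
- apply: der_eq (der_F2 d1 d2 d3 ht) _; rewrite /v !mxE.
  by elim/ord3_ind: b {v d1 d2 d3}; rewrite /= !(mul0r, mul1r, addr0, add0r).
apply: der_eq (der_F3 d1 d2 d3) _; rewrite /v !mxE.
by elim/ord3_ind: b {v d1 d2 d3}; rewrite /= !(mul0r, mul1r, addr0, add0r).
Qed.

Lemma partial1 t c : sdom t -> partial c (@Fphi1 R) t = gradF (t 0 k1) (t 0 k2) (t 0 k3) c.
Proof. by move=> /(der_Fphi1 c) [_ <-]. Qed.

Lemma der_partial1 t b c : sdom t ->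
  is_derive t (delta_mx 0 b) (partial c (@Fphi1 R)) (hessF (t 0 k1) (t 0 k2) (t 0 k3) b c).
Proof.
move=> ht; have hn := near_sdom ht; apply: (der_nearV _ (der_gradF b c ht)).
by apply: filterS hn => p; exact: partial1.
Qed.

Lemma partial2 t b c : sdom t ->
  partial b (partial c (@Fphi1 R)) t = hessF (t 0 k1) (t 0 k2) (t 0 k3) b c.
Proof. by move=> /(der_partial1 b c) [_ <-]. Qed.

Lemma der_partial2 m a b c : hurwitz_domain m ->
  is_derive (tcoord m) (delta_mx 0 a) (partial b (partial c (@Fphi1 R)))
    (thirdF m (a == k1)%:R (a == k2)%:R (a == k3)%:R b c).
Proof.
move=> hm; have hn := near_sdom (sdom_tcoord hm); rewrite delta_row3.
apply: (der_nearV _ (der_hessF _ _ _ b c hm)).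
by apply: filterS hn => p; exact: partial2.
Qed.

Lemma Fphi1_prepotential :
  prepotential hurwitz_domain (@eta_phi1 R) (@hmul R) (@tcoord R) (@Fphi1 R).
Proof.
move=> m hm a b c; have hs := sdom_tcoord hm.
have [e1 _] := der_Fphi1 c hs; have [e2 _] := der_partial1 b c hs.
have [e3 e4] := der_partial2 a b c hm; split => //.
(* Total symmetry of [eta(u o v, w)] moves the direction of the last derivative to the last slot. *)
rewrite [LHS]e4 [RHS]eta_hmulC // /thirdF.
have -> : (a == k1)%:R *: dd (@tcoord R) k1 m + (a == k2)%:R *: dd (@tcoord R) k2 m
    + (a == k3)%:R *: dd (@tcoord R) k3 m = dd (@tcoord R) a m.
  by elim/ord3_ind: a {e3 e4}; rewrite /= !(scale0r, scale1r, addr0, add0r).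
by [].
Qed.

(** Along the Euler field [t_1] is constant and [t_2], [t_3] have weights [1/2] and 1, for which
    [t_3^2], [t_3 t_2^2] and [t_2^4] all have weight 2. *)
Lemma euler_Fphi1 m : hurwitz_domain m ->
  is_derive m (euler_field m) (@Fphi1 R \o @tcoord R) (2 * Fphi1 (tcoord m)).
Proof.
move=> hm; have hs := sdom_tcoord hm; set E := euler_field m.
have a1 : dt k1 m E = 0.
  by rewrite /E euler_field_dd // /dt dcoordD !dcoordZ -!/(dt _ m _) !dt_dd //= !mulr0 addr0.
have a2 : dt k2 m E = tcoord m 0 k2 / 2.
  by rewrite /E euler_field_dd // /dt dcoordD !dcoordZ -!/(dt _ m _) !dt_dd //= mulr0 mulr1 addr0.
have a3 : dt k3 m E = tcoord m 0 k3.
  by rewrite /E euler_field_dd // /dt dcoordD !dcoordZ -!/(dt _ m _) !dt_dd //= mulr0 mulr1 add0r.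
have d1 := der_tcoord k1 E hm; have d2 := der_tcoord k2 E hm; have d3 := der_tcoord k3 E hm.
apply: der_eq (der_F d1 d2 d3 hs) _; rewrite a1 a2 a3 /Fphi1 E2_bsum // /gradF /=.
move: (cpi R) (tcoord m 0 k3) (tcoord m 0 k2) (bsum _) (bsum2 _) => p t3 t2 s s2.
by move: (tcoord m 0 k1) => t1; field.
Qed.

End ThirdDerivatives.

Theorem theorem7p1 (R : realType) :
  darboux_egoroff hurwitz_domain (@eta_phi1 R) (@lam R) /\
  flat_coordinates hurwitz_domain (@eta_phi1 R) (@tcoord R) /\
  (forall m : 'rV[R[i]]_3, hurwitz_domain m ->
     unit_field m = dd (@tcoord R) k3 m) /\
  (forall m : 'rV[R[i]]_3, hurwitz_domain m ->
     euler_field m =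
       (tcoord m 0 k2 / 2) *: dd (@tcoord R) k2 m
       + tcoord m 0 k3 *: dd (@tcoord R) k3 m) /\
  prepotential hurwitz_domain (@eta_phi1 R) (@hmul R) (@tcoord R) (@Fphi1 R) /\
  (forall m : 'rV[R[i]]_3, hurwitz_domain m ->
     is_derive m (euler_field m) (@Fphi1 R \o @tcoord R)
       (2 * Fphi1 (tcoord m))).
Proof.
split; first exact: eta_darboux_egoroff.
split; first exact: eta_flat.
split; first by move=> m; exact: unit_field_dd.
split; first by move=> m; exact: euler_field_dd.
split; first exact: Fphi1_prepotential.
by move=> m; exact: euler_Fphi1.
Qed.
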